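(* Let $\{N_j:j\ge1\}$ be independent Poisson random variables with $\mathbb E N_j=1/j$, and let $\{S_{ji}:i,j\ge1\}$ be independent random variables, independent of the $N_j$, with $S_{ji}$ having the Gamma$(j,1)$ distribution. Define $$S_n=\sum_{j=1}^n\sum_{i=1}^{N_j}S_{ji},\qquad T_n=\sum_{j=1}^n jN_j,\qquad V_n=n^{-1/2}\{S_n-T_n\},\qquad W_n=\frac{T_n}{n}.$$ Then, as $n\to\infty$, the pair $(V_n,W_n)$ converges in distribution to a pair $(V,W)$ of random variables whose distribution is infinitely divisible with characteristic function $$\phi_{(V,W)}(t,u)=\mathbb E\, e^{itV+iuW}=\exp\left\{\int_0^1\frac{e^{-\left(\frac12t^2-iu\right)y}-1}{y}\,dy\right\},\qquad t,u\in\mathbb R.$$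
   Context: Gamma$(j,1)$ is the law of a sum of $j$ independent standard exponential variables. Empty sums are $0$. *)

(* Defs.v *)
From HB Require Import structures.
From mathcomp Require Export all_boot all_order all_algebra.
From mathcomp Require Export finmap complex.
From mathcomp Require Export all_classical all_reals all_analysis measurable_realfun.
Export Order.TTheory GRing.Theory Num.Theory.
Export numFieldNormedType.Exports.

Set Implicit Arguments.
Unset Strict Implicit.
Unset Printing Implicit Defensive.

Local Open Scope classical_set_scope.
Local Open Scope ring_scope.

Section Independence.
Context d (T : measurableType d) (R : realType) (P : probability T R).

(* Independence is stated for set systems so that a single family can mix
   variables with values in different spaces. *)
Definition mutually_independent (I : choiceType) (D : set I)
    (F : I -> set (set T)) : Prop :=
  forall (J : {fset I}) (A : I -> set T),
    [set` J] `<=` D -> (forall i, i \in J -> F i (A i)) ->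
    P (\bigcap_(i in [set` J]) A i) = (\prod_(i <- J) P (A i))%E.

Definition sigma_of d' (T' : measurableType d') (X : T -> T') : set (set T) :=
  preimage_set_system [set: T] X measurable.

Definition has_law d' (T' : measurableType d') (X : {RV P >-> T'})
    (nu : set T' -> \bar R) : Prop :=
  forall A, measurable A -> distribution P X A = nu A.

Definition iid d' (T' : measurableType d') (m : nat)
    (X : 'I_m -> {RV P >-> T'}) (nu : set T' -> \bar R) : Prop :=
  mutually_independent [set: 'I_m] (fun i => sigma_of (X i)) /\
  (forall i, has_law (X i) nu).

End Independence.
Arguments has_law {d T R} P {d' T'} X nu.
Arguments iid {d T R} P {d' T' m} X nu.

(* Gamma(j,1) as the law of a sum of j independent standard exponential
   variables, living on some auxiliary probability space. *)
Definition is_gamma1 (R : realType) (j : nat) (nu : set R -> \bar R) : Prop :=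
  exists d (T : measurableType d) (P : probability T R)
      (E : 'I_j -> {RV P >-> R}),
    iid P E (exponential_prob 1) /\
    (forall A, measurable A ->
       nu A = P ((fun w => \sum_(i < j) E i w) @^-1` A)).

Definition infinitely_divisible (R : realType)
    (mu : set (R * R) -> \bar R) : Prop :=
  forall m : nat, (0 < m)%N ->
  exists (nu : probability (R * R)%type R),
  exists d (T : measurableType d) (P : probability T R)
      (X : 'I_m -> {RV P >-> (R * R)%type}),
    iid P X nu /\
    (forall A, measurable A ->
       mu A = P ((fun w => \sum_(i < m) (X i w : R * R)) @^-1` A)).

Definition pairRV (T U V : Type) (X : T -> U) (Y : T -> V) : T -> U * V :=
  fun w => (X w, Y w).

Section PairRV.
Context d d1 d2 (T : measurableType d) (U : measurableType d1)
  (V : measurableType d2) (X : {mfun T >-> U}) (Y : {mfun T >-> V}).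

Lemma measurable_pairRV : measurable_fun [set: T] (pairRV X Y).
Proof. exact: measurable_fun_pair. Qed.

HB.instance Definition _ :=
  isMeasurableFun.Build _ _ _ _ (pairRV X Y) measurable_pairRV.
End PairRV.

(* The product sigma-algebra on R * R is the Borel one, so continuous test
   functions are measurable. *)
Definition cvg_in_distribution (R : realType)
    d (T : measurableType d) (P : probability T R)
    d' (T' : measurableType d') (Q : probability T' R)
    (X : nat -> {RV P >-> (R * R)%type}) (Y : {RV Q >-> (R * R)%type}) : Prop :=
  forall f : R * R -> R, continuous f -> (exists M, forall x, `|f x| <= M) ->
    ('E_P[f \o X n] @[n --> \oo] --> 'E_Q[f \o Y])%E.

Arguments cvg_in_distribution {R d T} P {d' T'} Q X Y.

Section ComplexIntegral.
Variable R : realType.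

Definition expC (z : R[i]) : R[i] :=
  (expR (complex.Re z) * cos (complex.Im z) +i* (expR (complex.Re z) * sin (complex.Im z)))%C.

Definition Cintegral d (T : measurableType d) (mu : {measure set T -> \bar R})
    (D : set T) (f : T -> R[i]) : R[i] :=
  (Rintegral mu D (fun x => complex.Re (f x)) +i* Rintegral mu D (fun x => complex.Im (f x)))%C.

Definition charfun2 d (T : measurableType d) (P : probability T R)
    (V W : {RV P >-> R}) (t u : R) : R[i] :=
  Cintegral P [set: T]
    (fun w => expC ('i%C * (t * V w)%:C%C + 'i%C * (u * W w)%:C%C)).

End ComplexIntegral.
Arguments charfun2 {R d T} P V W t u.

(* The families are indexed from 1, as in N_j and S_{ji} with i, j >= 1; the
   values at index 0 are never used. *)
Section Sums.
Context (R : realType) d (T : measurableType d) (P : probability T R).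
Variables (N : nat -> {RV P >-> nat}) (S : nat -> nat -> {RV P >-> R}).

Definition Ssum (n : nat) : T -> R := fun w =>
  \sum_(1 <= j < n.+1) \sum_(1 <= i < (N j w).+1) S j i w.

Definition Tsum (n : nat) : T -> R := fun w =>
  \sum_(1 <= j < n.+1) (j * N j w)%:R.

Definition Vn (n : nat) : T -> R := fun w =>
  (Num.sqrt n%:R)^-1 * (Ssum n w - Tsum n w).

Definition Wn (n : nat) : T -> R := fun w => Tsum n w / n%:R.

Lemma measurable_random_sum j :
  measurable_fun [set: T] (fun w => \sum_(1 <= i < (N j w).+1) S j i w).
Proof.
move=> _ A mA; rewrite setTI.
pose s k w : R := \sum_(1 <= i < k.+1) S j i w.
rewrite (_ : _ @^-1` A = \bigcup_k (N j @^-1` [set k] `&` s k @^-1` A)).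
  apply: bigcup_measurable => k _; apply: measurableI; first exact: measurable_funPTI.
  rewrite -[X in measurable X]setTI; apply: measurable_sum => // i.
by apply/seteqP; split => [w Aw|w [k _ [/= <-]]//]; exists (N j w).
Qed.

Lemma measurable_Ssum n : measurable_fun [set: T] (Ssum n).
Proof.
apply: measurable_sum => j; exact: measurable_random_sum.
Qed.

Lemma measurable_Tsum n : measurable_fun [set: T] (Tsum n).
Proof.
apply: measurable_sum => j.
by apply: (@measurableT_comp _ _ _ _ _ _ (fun k : nat => (j * k)%:R : R)).
Qed.

Lemma measurable_Vn n : measurable_fun [set: T] (Vn n).
Proof.
apply: measurable_funM => //; apply: measurable_funB.
  exact: measurable_Ssum.
exact: measurable_Tsum.
Qed.

Lemma measurable_Wn n : measurable_fun [set: T] (Wn n).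
Proof. by apply: measurable_funM => //; exact: measurable_Tsum. Qed.

HB.instance Definition _ n :=
  isMeasurableFun.Build _ _ _ _ (Vn n) (measurable_Vn n).
HB.instance Definition _ n :=
  isMeasurableFun.Build _ _ _ _ (Wn n) (measurable_Wn n).

End Sums.

(* Main.v *)
(* The limit is (sqrt(W) Z, W), with W = sum_k exp(-(E_1 + ... + E_k)) for iid
   exponentials E_i, which exist on the given space as the S_{1,i}, and Z standard
   normal independent of W.  Conditionally on [N], V_n is n^(-1/2) times a sum of
   T_n centred exponentials; Lindeberg replacement compares E Psi(V_n)^k g(W_n) with
   E g(W_n) F_k(W_n), where Psi is the logistic function and F_k(w) is the mean of
   Psi^k under the centred normal law of variance w.  The Laplace transform of W_n
   is the exponential of a Riemann sum converging to the exponent of W.  Bernstein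
   polynomials in exp(-w) and in Psi(v) pass from these test functions to bounded
   continuous ones.  With E_i / theta in place of E_i the laws of (sqrt(W) Z, W)
   form a convolution semigroup in theta, whence infinite divisibility. *)
Require Import Defs.
From HB Require Import structures.
From mathcomp Require Import ring lra.

Set Implicit Arguments.
Unset Strict Implicit.
Unset Printing Implicit Defensive.

Local Open Scope classical_set_scope.
Local Open Scope ring_scope.

(** * Bounded measurable functions, on which means need no integrability side conditions *)

Section BoundedMeasurable.
Context (R : realType) d (T : measurableType d).
Implicit Types f g : T -> R.

(** No continuity theorem for characteristic functions and no separate tightness estimate is used. A
    chart onto a dense part of [[0, 1]] makes Bernstein approximation uniform for functions with
    compact support, and the mass near infinity is controlled because the cut-offs are themselves
    test functions whose means converge. The logistic function serves twice: it is a chart of the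
    line, and the derivatives of its powers are polynomials in it, hence bounded, as third-order
    Taylor estimates require.

    The obstacle is that the number [T_n] of summands is random and unbounded. Replacing them costs
    a multiple of [T_n n^(-3/2) = W_n / sqrt n], which has no uniform bound; it is capped by a
    constant, and the mean of the capped error is governed by the convergence of [W_n] alone,
    without moments.

    The transform of [W] comes from a function of the partial sum and the last product whose mean is
    conserved along the series. Complex integrals are avoided: the cosines carry a free phase, and
    the phases 0 and [-pi/2] give real and imaginary parts. *)

Definition bmeas f := measurable_fun [set: T] f /\ exists M, forall x, `|f x| <= M.

Lemma bmeas_cst c : bmeas (fun=> c).
Proof. by split => //; exists `|c|. Qed.

Lemma bmeasD f g : bmeas f -> bmeas g -> bmeas (fun x => f x + g x).
Proof.
move=> [mf [M hM]] [mg [N hN]]; split; first exact: measurable_funD.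
by exists (M + N) => x; rewrite (le_trans (ler_normD _ _))// lerD.
Qed.

Lemma bmeasN f : bmeas f -> bmeas (fun x => - f x).
Proof.
move=> [mf [M hM]]; split; first exact: measurableT_comp.
by exists M => x; rewrite normrN.
Qed.

Lemma bmeasB f g : bmeas f -> bmeas g -> bmeas (fun x => f x - g x).
Proof. by move=> bf bg; apply: bmeasD => //; exact: bmeasN. Qed.

Lemma bmeasM f g : bmeas f -> bmeas g -> bmeas (fun x => f x * g x).
Proof.
move=> [mf [M hM]] [mg [N hN]]; split; first exact: measurable_funM.
exists (M * N) => x; rewrite normrM ler_pM//.
Qed.

Lemma bmeasX f n : bmeas f -> bmeas (fun x => f x ^+ n).
Proof.
move=> bf; elim: n => [|n ih]; first exact: bmeas_cst.
by under eq_fun do rewrite exprS; exact: bmeasM.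
Qed.

Lemma bmeas_norm f : bmeas f -> bmeas (fun x => `|f x|).
Proof.
move=> [mf [M hM]]; split; first exact: measurableT_comp.
by exists M => x; rewrite normr_id.
Qed.

Lemma bmeas_sum (I : Type) (s : seq I) (F : I -> T -> R) :
  (forall i, bmeas (F i)) -> bmeas (fun x => \sum_(i <- s) F i x).
Proof.
move=> bF; elim: s => [|i s ih].
  by under eq_fun do rewrite big_nil; exact: bmeas_cst.
by under eq_fun do rewrite big_cons; exact: bmeasD.
Qed.

Lemma bmeas_indic (A : set T) : measurable A -> bmeas (\1_A : T -> R).
Proof.
move=> mA; split; first exact: measurable_indic.
by exists 1 => x; rewrite indicE; case: (_ \in _); rewrite ?normr1 ?normr0.
Qed.

End BoundedMeasurable.

Lemma bmeas_comp (R : realType) d d' (T : measurableType d)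
    (T' : measurableType d') (g : T' -> T) (f : T -> R) :
  measurable_fun setT g -> bmeas f -> bmeas (f \o g).
Proof.
move=> mg [mf [M hM]]; split; first exact: measurableT_comp.
by exists M => x; exact: hM.
Qed.

Lemma bmeas_expN (R : realType) d (T : measurableType d) (X : T -> R) :
  measurable_fun setT X -> (forall w, 0 <= X w) -> bmeas (fun w => expR (- X w)).
Proof.
move=> mX X0; split; last first.
  by exists 1 => w; rewrite ger0_norm ?expR_ge0// -[leRHS]expR0 ler_expR oppr_le0.
apply: (@measurableT_comp _ _ _ _ _ _ (@expR R)) => //.
exact: (@measurableT_comp _ _ _ _ _ _ (@GRing.opp R)).
Qed.

(** * Means: image laws, linearity, bounded convergence, Fubini *)

Section TransferIntegral.
Context (R : realType) d d' (T : measurableType d) (U : measurableType d').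
Variables (P : probability T R) (X : {RV P >-> U}) (f : U -> R).
Hypothesis mf : measurable_fun setT f.

Lemma Rintegral_distribution :
  \int[distribution P X]_y f y = \int[P]_x f (X x).
Proof.
rewrite /Rintegral; congr fine; rewrite integralE [RHS]integralE.
rewrite !ge0_integral_distribution//.
- congr (_ - _)%E; apply: eq_integral => x _ /=; by rewrite ?funeposE ?funenegE.
- exact/measurable_funeneg/measurable_EFinP.
- exact/measurable_funepos/measurable_EFinP.
Qed.

Lemma integrable_distribution : P.-integrable setT (EFin \o (f \o X)) ->
  (distribution P X).-integrable setT (EFin \o f).
Proof.
move=> /integrableP[_ fi]; apply/integrableP; split; first exact/measurable_EFinP.
by rewrite ge0_integral_distribution//; apply: measurableT_comp => //; exact/measurable_EFinP.
Qed.

End TransferIntegral.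

Section Expectations.
Context (R : realType) d (T : measurableType d) (P : probability T R).
Implicit Types f g : T -> R.

Lemma bmeas_integrable f : bmeas f -> P.-integrable [set: T] (EFin \o f).
Proof.
move=> [mf [M hM]]; apply: (@le_integrable _ _ _ P _ measurableT _ (EFin \o cst M)).
- exact/measurable_EFinP.
- by move=> x _ /=; rewrite lee_fin (le_trans (hM x))// ler_norm.
- exact: finite_measure_integrable_cst.
Qed.

Lemma meanE f : bmeas f -> (\int[P]_x f x)%:E = (\int[P]_x (f x)%:E)%E.
Proof.
move=> bf; rewrite /Rintegral fineK//.
exact: integrable_fin_num (bmeas_integrable bf).
Qed.

Lemma mean_cst c : \int[P]_x (c : R) = c.
Proof. by rewrite Rintegral_cst//= probability_setT/= mulr1. Qed.

Lemma meanD f g : bmeas f -> bmeas g ->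
  \int[P]_x (f x + g x) = \int[P]_x f x + \int[P]_x g x.
Proof. by move=> bf bg; rewrite RintegralD//; exact: bmeas_integrable. Qed.

Lemma meanB f g : bmeas f -> bmeas g ->
  \int[P]_x (f x - g x) = \int[P]_x f x - \int[P]_x g x.
Proof. by move=> bf bg; rewrite RintegralB//; exact: bmeas_integrable. Qed.

Lemma meanZ c f : bmeas f -> \int[P]_x (c * f x) = c * \int[P]_x f x.
Proof. by move=> bf; rewrite RintegralZl//; exact: bmeas_integrable. Qed.

Lemma mean_sum (I : Type) (s : seq I) (F : I -> T -> R) :
  (forall i, bmeas (F i)) ->
  \int[P]_x (\sum_(i <- s) F i x) = \sum_(i <- s) \int[P]_x F i x.
Proof.
move=> bF; elim: s => [|i s ih].
  rewrite big_nil -[RHS]mean_cst; apply: eq_Rintegral => x _.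
  by rewrite big_nil.
rewrite big_cons -ih -meanD//; last exact: bmeas_sum.
by apply: eq_Rintegral => x _; rewrite big_cons.
Qed.

Lemma le_mean f g : bmeas f -> bmeas g -> (forall x, f x <= g x) ->
  \int[P]_x f x <= \int[P]_x g x.
Proof.
by move=> bf bg fg; apply: le_Rintegral => //; exact: bmeas_integrable.
Qed.

Lemma mean_norm f : bmeas f -> `|\int[P]_x f x| <= \int[P]_x `|f x|.
Proof. by move=> bf; apply: le_normr_Rintegral => //; exact: bmeas_integrable. Qed.

Lemma norm_mean_le f M : bmeas f -> (forall x, `|f x| <= M) ->
  `|\int[P]_x f x| <= M.
Proof.
move=> bf fM; rewrite (le_trans (mean_norm bf))// -[leRHS]mean_cst.
by apply: le_mean => //; [exact: bmeas_norm|exact: bmeas_cst].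
Qed.

Lemma mean_dist f g e : bmeas f -> bmeas g -> (forall x, `|f x - g x| <= e) ->
  `|\int[P]_x f x - \int[P]_x g x| <= e.
Proof.
by move=> bf bg fg; rewrite -meanB//; apply: norm_mean_le => //; exact: bmeasB.
Qed.

Lemma mean_cvg (f_ : nat -> T -> R) f M :
  (forall n, measurable_fun setT (f_ n)) -> measurable_fun setT f ->
  (forall n x, `|f_ n x| <= M) -> {ae P, forall x, f_ n x @[n --> \oo] --> f x} ->
  \int[P]_x f_ n x @[n --> \oo] --> \int[P]_x f x.
Proof.
move=> mf_ mf f_M cf.
have [|||||i _ c] := @dominated_convergence _ _ _ P setT measurableT
  (fun n => EFin \o f_ n) (EFin \o f) (EFin \o cst M).
- by move=> n; exact/measurable_EFinP.
- exact/measurable_EFinP.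
- apply: filterS cf => x cx _; apply: cvg_EFin => //.
  by apply: nearW.
- exact: finite_measure_integrable_cst.
- by apply: aeW => x n _ /=; rewrite lee_fin.
- by apply: fine_cvg; rewrite fineK ?integrable_fin_num.
Qed.

Lemma mean_distribution d' (T' : measurableType d') (X : {RV P >-> T'}) (f : T' -> R) :
  bmeas f -> \int[distribution P X]_y f y = \int[P]_x f (X x).
Proof. by case=> mf _; exact: Rintegral_distribution. Qed.

End Expectations.

Section BoundedFubini.
Context (R : realType) d1 d2 (T1 : measurableType d1) (T2 : measurableType d2).
Variables (P1 : probability T1 R) (P2 : probability T2 R).
Variable f : T1 * T2 -> R.
Hypothesis bf : bmeas f.

Lemma bmeas_pair1 x : bmeas (fun y => f (x, y)).
Proof. by apply: bmeas_comp bf; exact: measurable_pair1. Qed.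

Lemma bmeas_pair2 y : bmeas (fun x => f (x, y)).
Proof. by apply: bmeas_comp bf; exact: measurable_pair2. Qed.

Lemma bmeas_mean1 : bmeas (fun x => \int[P2]_y f (x, y)).
Proof.
split; last first.
  case: (bf) => _ [M hM]; exists M => x.
  by apply: norm_mean_le => //; exact: bmeas_pair1.
apply/measurable_EFinP.
have -> : EFin \o (fun x => \int[P2]_y f (x, y)) = (fun x => \int[P2]_y (f (x, y))%:E)%E.
  by apply/funext => x /=; rewrite meanE//; exact: bmeas_pair1.
apply: (@measurable_fubini_F _ _ _ _ _ P1 P2 (EFin \o f)).
exact: (@bmeas_integrable _ _ _ (P1 \x P2)%E).
Qed.

Lemma bmeas_mean2 : bmeas (fun y => \int[P1]_x f (x, y)).
Proof.
split; last first.
  case: (bf) => _ [M hM]; exists M => y.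
  by apply: norm_mean_le => //; exact: bmeas_pair2.
apply/measurable_EFinP.
have -> : EFin \o (fun y => \int[P1]_x f (x, y)) = (fun y => \int[P1]_x (f (x, y))%:E)%E.
  by apply/funext => y /=; rewrite meanE//; exact: bmeas_pair2.
apply: (@measurable_fubini_G _ _ _ _ _ P1 P2 (EFin \o f)).
exact: (@bmeas_integrable _ _ _ (P1 \x P2)%E).
Qed.

Lemma mean_prod1 : \int[(P1 \x P2)%E]_z f z = \int[P1]_x \int[P2]_y f (x, y).
Proof.
apply: EFin_inj; rewrite !meanE//; last exact: bmeas_mean1.
rewrite -(@integral12_prod_meas1 _ _ _ _ _ P1 P2 (EFin \o f)); last first.
  exact: (@bmeas_integrable _ _ _ (P1 \x P2)%E).
by apply: eq_integral => x _; rewrite meanE//; exact: bmeas_pair1.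
Qed.

Lemma mean_swap :
  \int[P1]_x \int[P2]_y f (x, y) = \int[P2]_y \int[P1]_x f (x, y).
Proof.
rewrite -mean_prod1; apply: EFin_inj; rewrite !meanE//; last exact: bmeas_mean2.
rewrite -(@integral21_prod_meas1 _ _ _ _ _ P1 P2 (EFin \o f)); last first.
  exact: (@bmeas_integrable _ _ _ (P1 \x P2)%E).
by apply: eq_integral => x _; rewrite meanE//; exact: bmeas_pair2.
Qed.

End BoundedFubini.

(** * Independence of blocks of an independent family *)

Section Grouping.
Context (R : realType) d (T : measurableType d) (P : probability T R).
Variables (I : choiceType) (D : set I) (F : I -> set (set T)).
Hypothesis Fm : forall i, F i `<=` measurable.
Hypothesis FT : forall i, F i setT.
Hypothesis FI : forall i, setI_closed (F i).
Hypothesis indF : mutually_independent P D F.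

Definition generated (J : set I) : set (set T) := <<s \bigcup_(i in J) F i >>.

(* The finite cylinders form a pi-system generating [generated J]; factors
   outside [s] are trivial, so [s] may be enlarged at will. *)
Let cylinder (J : set I) (A : set T) := exists (s : {fset I}) (B : I -> set T),
  [/\ [set` s] `<=` J, forall i, F i (B i), forall i, i \notin s -> B i = setT &
      A = \bigcap_i B i].

Let cylinderT J : cylinder J setT.
Proof.
exists fset0, (fun=> setT); split => //; last by rewrite bigcapT.
Qed.

Let cylinderI J : setI_closed (cylinder J).
Proof.
move=> _ _ [s [B [sJ FB Bs ->]]] [t [C [tJ FC Ct ->]]].
exists (s `|` t)%fset, (fun i => B i `&` C i); split.
- by move=> i /=; rewrite inE => /orP[/sJ|/tJ].
- by move=> i; exact: FI.
- move=> i; rewrite inE negb_or => /andP[/Bs -> /Ct ->].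
  by rewrite setIT.
- by rewrite bigcapI.
Qed.

Let cylinder_measurable J : cylinder J `<=` measurable.
Proof.
move=> _ [s [B [sJ FB Bs ->]]].
rewrite (_ : \bigcap_i B i = \bigcap_(i in [set` s]) B i); last first.
  apply/seteqP; split => x Bx i //= _; first exact: Bx.
  have [/Bx//|/Bs ->//] := boolP (i \in s).
by apply: fin_bigcap_measurable => // i _; exact: Fm (FB i).
Qed.

Let cylinderE (s : {fset I}) (B : I -> set T) : [set` s] `<=` D ->
  (forall i, F i (B i)) -> (forall i, i \notin s -> B i = setT) ->
  P (\bigcap_i B i) = (\prod_(i <- s) P (B i))%E.
Proof.
move=> sD FB Bs; rewrite -(indF sD)//.
congr (P _); apply/seteqP; split => x Bx i //= _; first exact: Bx.
have [/Bx//|/Bs ->//] := boolP (i \in s).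
Qed.

Let cylinder_indep J1 J2 A B : J1 `<=` D -> J2 `<=` D -> [disjoint J1 & J2]%classic ->
  cylinder J1 A -> cylinder J2 B -> P (A `&` B) = (P A * P B)%E.
Proof.
move=> J1D J2D J12 [s [A' [sJ FA As ->]]] [t [B' [tJ FB Bt ->]]].
rewrite -bigcapI.
have stD : [set` (s `|` t)%fset] `<=` D.
  by move=> i /=; rewrite inE => /orP[/sJ/J1D|/tJ/J2D].
rewrite !(@cylinderE (s `|` t)%fset)//.
- rewrite -big_split/=; apply: eq_bigr => i _.
  have [is_|/As ->] := boolP (i \in s); last by rewrite setTI probability_setT mul1e.
  have [it|/Bt ->] := boolP (i \in t); last by rewrite setIT probability_setT mule1.
  by exfalso; move/disj_setPS : J12 => /(_ i); apply; split; [exact: sJ|exact: tJ].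
- by move=> i; rewrite inE negb_or => /andP[_ /Bt].
- by move=> i; rewrite inE negb_or => /andP[/As].
- by move=> i; exact: FI.
- by move=> i; rewrite inE negb_or => /andP[/As -> /Bt ->]; rewrite setIT.
Qed.

Let generated_cylinder J A : generated J A -> <<s cylinder J >> A.
Proof.
apply: (@sub_smallest2r _ (@sigma_algebra T setT)); first exact: smallest_sigma_algebra.
move=> B [i Ji FB].
exists [fset i]%fset, (fun j => if j == i then B else setT); split.
- by move=> j /=; rewrite inE => /eqP ->.
- by move=> j; case: eqP => [->//|_]; exact: FT.
- by move=> j; rewrite inE => /negbTE ->.
- apply/seteqP; split => [x Bx j _|x /(_ i Logic.I)]; last by rewrite eqxx.
  by case: ifP.
Qed.

Lemma generated_measurable J : generated J `<=` measurable.
Proof.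
apply: smallest_sub; first exact: sigma_algebra_measurable.
by move=> A [i _ /Fm].
Qed.

(** Dynkin's argument twice. For a fixed cylinder [C] of the second block, the restriction of [P] to
    [C] and [P C] times [P] are finite measures agreeing on the cylinders of the first block, hence
    on [generated J1]. Then [A] is fixed and the second block is treated in the same way. *)
Lemma generated_indep J1 J2 A B : J1 `<=` D -> J2 `<=` D ->
  [disjoint J1 & J2]%classic -> generated J1 A -> generated J2 B ->
  P (A `&` B) = (P A * P B)%E.
Proof.
move=> J1D J2D J12 gA gB.
have cylB C : cylinder J2 C -> P (A `&` C) = (P A * P C)%E.
  move=> cC; have mC := cylinder_measurable cC.
  have PC : (0 <= fine (P C))%R by exact: fine_ge0.
  rewrite (_ : (P A * P C)%E = mscale (NngNum PC) P A); last first.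
    by rewrite /mscale/= fineK ?fin_num_measure// [LHS]muleC.
  apply: (@g_sigma_algebra_measure_unique _ _ _ (cylinder J1) _ (fun=> setT) _ _ (mrestr P mC)) => //=.
  - by rewrite bigcup_const.
  - move=> E cE; rewrite /mrestr (cylinder_indep J1D J2D)//.
    by rewrite /mscale/= fineK ?fin_num_measure// [LHS]muleC.
  - by move=> _; rewrite /mrestr setTI ltey_eq fin_num_measure.
  - exact: generated_cylinder.
have mA := generated_measurable gA.
have PA : (0 <= fine (P A))%R by exact: fine_ge0.
rewrite setIC (_ : (P A * P B)%E = mscale (NngNum PA) P B); last first.
  by rewrite /mscale/= fineK ?fin_num_measure.
apply: (@g_sigma_algebra_measure_unique _ _ _ (cylinder J2) _ (fun=> setT) _ _ (mrestr P mA)) => //=.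
- by rewrite bigcup_const.
- move=> E cE; rewrite /mrestr setIC cylB//.
  by rewrite /mscale/= fineK ?fin_num_measure.
- by move=> _; rewrite /mrestr setTI ltey_eq fin_num_measure.
- exact: generated_cylinder.
Qed.

End Grouping.

(** By independence the joint law is the product of the marginal laws, so Fubini applies to the
    laws. Both integrals are pulled back to [P], so that later uses need not name the laws. *)
Lemma mean_indep (R : realType) d (T : measurableType d) (P : probability T R)
    d1 d2 (U1 : measurableType d1) (U2 : measurableType d2)
    (X : T -> U1) (Y : T -> U2) (f : U1 * U2 -> R) :
  measurable_fun setT X -> measurable_fun setT Y ->
  (forall A B, measurable A -> measurable B ->
    P (X @^-1` A `&` Y @^-1` B) = (P (X @^-1` A) * P (Y @^-1` B))%E) ->
  bmeas f ->
  \int[P]_w f (X w, Y w) = \int[P]_w \int[P]_v f (X w, Y v).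
Proof.
move=> mX mY indXY bf.
pose X' : {mfun T >-> U1} := HB.pack X (isMeasurableFun.Build _ _ _ _ X mX).
pose Y' : {mfun T >-> U2} := HB.pack Y (isMeasurableFun.Build _ _ _ _ Y mY).
have -> : \int[P]_w f (X w, Y w) = \int[distribution P (pairRV X' Y')]_z f z.
  by rewrite mean_distribution.
have -> : \int[distribution P (pairRV X' Y')]_z f z =
          \int[(distribution P X' \x distribution P Y')%E]_z f z.
  rewrite /Rintegral; congr fine; apply: eq_measure_integral => A mA _.
  exact/esym/product_measure_unique.
rewrite mean_prod1//.
have b1 := bmeas_mean1 (distribution P X') (distribution P Y') bf.
rewrite (mean_distribution _ b1).
apply: eq_Rintegral => w _; rewrite mean_distribution//.
exact: bmeas_pair1.
Qed.

Lemma mean_decouple (R : realType) d (T : measurableType d) (P : probability T R)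
    (I : choiceType) (D : set I) (F : I -> set (set T)) (J1 J2 : set I)
    d1 d2 (U1 : measurableType d1) (U2 : measurableType d2)
    (X : T -> U1) (Y : T -> U2) (f : U1 * U2 -> R) :
  (forall i, F i `<=` measurable) -> (forall i, F i setT) ->
  (forall i, setI_closed (F i)) -> mutually_independent P D F ->
  J1 `<=` D -> J2 `<=` D -> [disjoint J1 & J2]%classic ->
  (forall A, measurable A -> generated F J1 (X @^-1` A)) ->
  (forall A, measurable A -> generated F J2 (Y @^-1` A)) ->
  bmeas f ->
  \int[P]_w f (X w, Y w) = \int[P]_w \int[P]_v f (X w, Y v).
Proof.
move=> Fm FT FI indF J1D J2D J12 gX gY bf; apply: mean_indep => //.
- by move=> _ A mA; rewrite setTI; exact: generated_measurable (gX _ mA).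
- by move=> _ A mA; rewrite setTI; exact: generated_measurable (gY _ mA).
- move=> A B mA mB; apply: (generated_indep Fm FT FI indF J1D J2D J12).
    exact: gX.
  exact: gY.
Qed.

(** * Bernstein approximation through a chart *)

Section Bernstein.
Context (R : realType).
Implicit Types (g : nat -> R) (x : R) (n : nat).

(* The Bernstein polynomial as a binomial(n, x) mean, conditioning on the first
   trial. *)
Fixpoint bernstein n g x : R :=
  if n is n'.+1 then
    (1 - x) * bernstein n' g x + x * bernstein n' (fun k => g k.+1) x
  else g 0%N.

Lemma le_bernstein n g h x : 0 <= x <= 1 ->
  (forall k, (k <= n)%N -> g k <= h k) -> bernstein n g x <= bernstein n h x.
Proof.
move=> /andP[x0 x1]; elim: n g h => [|n ih] g h gh /=; first exact: gh.
apply: lerD; apply: ler_wpM2l; rewrite ?subr_ge0//; apply: ih => k kn.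
  by apply: gh; exact: leqW.
exact: gh.
Qed.

Lemma bernstein_cst n c x : bernstein n (fun=> c) x = c.
Proof. by elim: n => [//|n ih] /=; rewrite ih -mulrDl subrK mul1r. Qed.

Lemma bernsteinD n g h x :
  bernstein n (fun k => g k + h k) x = bernstein n g x + bernstein n h x.
Proof. by elim: n g h => [//|n ih] g h /=; rewrite !ih; ring. Qed.

Lemma bernsteinZ n c g x : bernstein n (fun k => c * g k) x = c * bernstein n g x.
Proof. by elim: n g => [//|n ih] g /=; rewrite !ih; ring. Qed.

(** Variance plus squared bias of a binomial variable about [c]. An arbitrary [c] keeps the
    induction going, since a success in the first trial replaces [c] by [c - 1]. *)
Lemma bernstein_variance n c x :
  bernstein n (fun k => (k%:R - c) ^+ 2) x =
  n%:R * (x * (1 - x)) + (n%:R * x - c) ^+ 2.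
Proof.
elim: n c => [|n ih] c /=; first by ring.
have e : (fun k => (k.+1%:R - c) ^+ 2 : R) = (fun k : nat => (k%:R - (c - 1)) ^+ 2).
  by apply/funext => k; rewrite -natr1; ring.
by rewrite e !ih -[n.+1%:R]natr1; ring.
Qed.

(** Chebyshev's argument with inexact nodes: [y k] is only within [1/n] of [k/n], because a chart
    reaches a dense set only. The constant 4 comes from [(x - y k)^2 <= 2 (x - k/n)^2 + 2/n^2] and
    the binomial variance [x (1 - x) / n]. *)
Lemma bernstein_dist n g a e K x (y : nat -> R) : 0 <= x <= 1 -> 0 <= K -> (0 < n)%N ->
  (forall k, (k <= n)%N -> `|y k - k%:R / n%:R| <= n%:R^-1) ->
  (forall k, (k <= n)%N -> `|a - g k| <= e + K * (x - y k) ^+ 2) ->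
  `|a - bernstein n g x| <= e + K * 4 / n%:R.
Proof.
move=> x01 K0 n0 yk ag; have n_gt0 : 0 < n%:R :> R by rewrite ltr0n.
pose q := fun k : nat => e + 2 * K / n%:R ^+ 2 * (k%:R - n%:R * x) ^+ 2 + 2 * K / n%:R ^+ 2.
have agq k : (k <= n)%N -> `|a - g k| <= q k.
  move=> kn; apply: (le_trans (ag k kn)); rewrite /q -addrA lerD2l.
  rewrite -subr_ge0.
  rewrite (_ : _ - _ = K * (2 * (k%:R / n%:R - x) ^+ 2 + 2 / n%:R ^+ 2 - (x - y k) ^+ 2)); last first.
    by field; rewrite gt_eqF.
  apply: mulr_ge0 => //; have := yk k kn.
  set u := k%:R / n%:R; set w := n%:R^-1; rewrite -exprVn -/w => yu.
  have yu2 : (y k - u) ^+ 2 <= w ^+ 2.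
    by rewrite -ler_sqrt ?sqr_ge0// !sqrtr_sqr (le_trans yu)// ler_norm.
  rewrite (_ : _ - _ = 2 * (w ^+ 2 - (y k - u) ^+ 2) + (x - u + (y k - u)) ^+ 2); last by ring.
  by rewrite addr_ge0 ?sqr_ge0// mulr_ge0// subr_ge0.
have qE : bernstein n q x <= e + K * 4 / n%:R.
  rewrite /q !bernsteinD !bernstein_cst bernsteinZ bernstein_variance subrr expr0n/= addr0.
  rewrite -!addrA lerD2l.
  rewrite -subr_ge0 (_ : _ - _ = 2 * K / n%:R * (2 - x * (1 - x) - n%:R^-1)); last first.
    by field; rewrite gt_eqF.
  have ? : n%:R^-1 <= 1 :> R by rewrite invf_le1// ler1n.
  case/andP: x01 => x0 x1; apply: mulr_ge0; last by nra.
  by rewrite divr_ge0 ?mulr_ge0// ltW.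
rewrite (le_trans _ qE)// ler_norml; apply/andP; split.
  rewrite lerNl opprB lerBlDr -[a](bernstein_cst n _ x) -bernsteinD.
  by apply: le_bernstein => // k /agq; rewrite ler_norml; lra.
rewrite lerBlDr -[a](bernstein_cst n _ x) -bernsteinD.
by apply: le_bernstein => // k /agq; rewrite ler_norml; lra.
Qed.

End Bernstein.

Section BernsteinApproximation.
Context (R : realType).

(** Compactness enters as near-covering, the radius running through the filter of right
    neighbourhoods of 0. The second point [v'] may leave [K], so interpolation nodes need no
    localisation. *)
Lemma compact_unif_first (f : R * R -> R) (K : set (R * R)) e :
  continuous f -> compact K -> 0 < e ->
  exists2 dl, 0 < dl & forall v w v', K (v, w) -> `|v - v'| < dl ->
    `|f (v, w) - f (v', w)| <= e.
Proof.
move=> cf cK e0.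
have /= := (@compact_near_coveringP _ K).1 cK R (at_right 0)
  (fun dl p => forall v', `|p.1 - v'| < dl -> `|f p - f (v', p.2)| <= e) _.
have h : forall x, K x -> \forall x' \near x & i \near at_right 0,
    forall v', `|x'.1 - v'| < i -> `|f x' - f (v', x'.2)| <= e.
  move=> [a b] _.
  have e2 : 0 < e / 2 by rewrite divr_gt0.
  have /cvgrPdist_le/(_ _ e2) [[A B] /= [/nbhs_ballP[r1 /= r10 Ar] /nbhs_ballP[r2 /= r20 Br]] AB] := cf (a, b).
  exists (ball a (r1 / 2) `*` ball b r2, [set i | 0 < i < r1 / 2]) => /=.
    split.
      exists (ball a (r1 / 2), ball b r2) => //=.
      by split; apply/nbhs_ballP; [exists (r1 / 2) => //=; rewrite divr_gt0|exists r2].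
    near=> i; apply/andP; split; first by near: i; exact: nbhs_right_gt.
    by near: i; apply: nbhs_right_lt; rewrite divr_gt0.
  move=> [[a' b'] i] /= [[aa' bb'] /andP[i0 ir]] v' av.
  have fa : `|f (a, b) - f (a', b')| <= e / 2.
    apply: (AB (a', b')); split => /=; last exact: Br.
    by apply: Ar; apply: le_ball aa'; rewrite ler_pdivrMr// ler_pMr// ler1n.
  have fv : `|f (a, b) - f (v', b')| <= e / 2.
    apply: (AB (v', b')); split => /=; last exact: Br.
    apply: Ar; rewrite /ball/= -(subrKA a') (le_lt_trans (ler_normD _ _))//.
    move: aa'; rewrite /ball/= => aa'.
    by rewrite [ltRHS](splitr r1) ltrD// (lt_trans av).
  rewrite -(subrKA (f (a, b))) (le_trans (ler_normD _ _))// [leRHS]splitr lerD//.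
  by rewrite distrC.
move=> /(_ _)/(_ h) near0.
have [dl [dl0 hdl]] : exists dl, 0 < dl /\ K `<=` (fun p => forall v', `|p.1 - v'| < dl -> `|f p - f (v', p.2)| <= e).
  near (0:R)^'+ => dl; exists dl; split; first by near: dl; exact: nbhs_right_gt.
  by near: dl.
by exists dl => // v w v' Kvw vv; exact: (hdl (v, w)).
Unshelve. all: by end_near. Qed.

(* Any chart [Theta] onto a dense part of [0, 1] transports Bernstein
   approximation to functions with compact support; only a quantitative
   injectivity of [Theta] on compact sets is needed. *)
Lemma bernstein_chart (f : R * R -> R) (A : set R) (Theta : R -> R) M L :
  continuous f -> (forall p, `|f p| <= M) ->
  (forall v w, L < `|v| \/ L < `|w| -> f (v, w) = 0) ->
  (forall v, A v -> 0 <= Theta v <= 1) ->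
  (forall dl, 0 < dl -> exists2 kp, 0 < kp & forall v v', A v -> A v' ->
     `|v| <= L -> dl <= `|v - v'| -> kp <= `|Theta v - Theta v'|) ->
  (forall x e, 0 <= x <= 1 -> 0 < e -> exists2 v, A v & `|Theta v - x| <= e) ->
  forall e, 0 < e -> exists N (y : nat -> R), forall v w, A v ->
    `|f (v, w) - bernstein N (fun k => f (y k, w)) (Theta v)| <= e.
Proof.
move=> cf fM fL T01 Tinj Tdense e e0.
have e2 : 0 < e / 2 by rewrite divr_gt0.
have cK : compact ((`[- L, L] : set R) `*` (`[- L, L] : set R)).
  by apply: compact_setX; exact: segment_compact.
have [dl dl0 fdl] := compact_unif_first cf cK e2.
have [kp kp0 Tkp] := Tinj _ dl0.
have M0 : 0 <= M by exact: le_trans (fM (0, 0)).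
(* For points at least [dl] apart the charts differ by at least [kp], so the trivial bound [2 * M]
   is at most [K] times the squared chart distance; closer points are covered by [e / 2]. *)
pose K : R := 2 * M / kp ^+ 2.
have K0 : 0 <= K by apply: divr_ge0; [exact: mulr_ge0|exact: sqr_ge0].
have half v w v' : A v -> A v' -> `|v| <= L ->
    `|f (v, w) - f (v', w)| <= e / 2 + K * (Theta v - Theta v') ^+ 2.
  move=> Av Av' vL.
  have [wL|wL] := lerP `|w| L; last first.
    by rewrite !fL ?subrr ?normr0; [|by right|by right]; rewrite addr_ge0 ?(ltW e2)// mulr_ge0 ?sqr_ge0.
  have [vv|vv] := ltP `|v - v'| dl.
    rewrite (le_trans (fdl v w v' _ vv))//; last first.
      by rewrite lerDl mulr_ge0 ?sqr_ge0.
    by split => /=; rewrite in_itv/= -ler_norml.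
  have kT := Tkp _ _ Av Av' vL vv.
  rewrite (@le_trans _ _ (2 * M))//.
    by rewrite (le_trans (ler_normB _ _))// mulr2n mulrDl mul1r lerD.
  have kT2 : kp ^+ 2 <= (Theta v - Theta v') ^+ 2.
    by rewrite -[leRHS]real_normK ?num_real// lerXn2r// ?nnegrE// ltW.
  rewrite -[leLHS]add0r; apply: lerD; first exact: ltW.
  rewrite -[leLHS](@divfK _ (kp ^+ 2)) ?gt_eqF ?exprn_gt0// -/K.
  exact: ler_wpM2l.
(* The chart estimate needs one point in the support range; by symmetry either will do, and if both
   are outside, [f] vanishes at both. *)
have quasi v w v' : A v -> A v' ->
    `|f (v, w) - f (v', w)| <= e / 2 + K * (Theta v - Theta v') ^+ 2.
  move=> Av Av'; have [vL|vL] := lerP `|v| L; first exact: half.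
  have [vL'|vL'] := lerP `|v'| L.
    rewrite distrC (le_trans (half _ _ _ Av' Av vL'))//.
    by rewrite -(opprB (Theta v)) sqrrN.
  rewrite !fL; [|by left|by left].
  by rewrite subrr normr0 addr_ge0 ?(ltW e2)// mulr_ge0 ?sqr_ge0.
pose N := (Num.truncn (K * 4 / (e / 2))).+1.
have N0 : 0 < N%:R :> R by rewrite ltr0n.
have NK : K * 4 / N%:R <= e / 2.
  rewrite ler_pdivrMr// [e / 2 * _]mulrC -ler_pdivrMr// ltW//.
  exact: truncnS_gt.
have /choice[y hy] : forall k, exists v, A v /\ ((k <= N)%N -> `|Theta v - k%:R / N%:R| <= N%:R^-1).
  move=> k; have [kN|kN] := leqP k N; last first.
    by have [v Av _] := Tdense 0 1 ltac:(by rewrite lexx ler01) ltr01; exists v.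
  have [||v Av Tv] := Tdense (k%:R / N%:R) N%:R^-1.
  - by rewrite divr_ge0//= ler_pdivrMr// mul1r ler_nat.
  - by rewrite invr_gt0.
  by exists v.
exists N, y => v w Av.
rewrite (le_trans (@bernstein_dist _ N _ _ (e / 2) K (Theta v) (Theta \o y) (T01 _ Av) K0 _ _ _))//.
- by move=> k kN /=; exact: (hy k).2.
- by move=> k kN /=; apply: quasi => //; exact: (hy k).1.
- by rewrite [leRHS]splitr lerD2l.
Qed.

End BernsteinApproximation.

(** * The class of functions whose means converge, and cut-offs *)

Section ConvergenceClass.
Context (R : realType) d (T : measurableType d) (P : probability T R).
Context d' (T' : measurableType d') (Q : probability T' R).
Context dY (Y : measurableType dY).
Variables (X_ : nat -> T -> Y) (X : T' -> Y).
Hypothesis mX_ : forall n, measurable_fun setT (X_ n).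
Hypothesis mX : measurable_fun setT X.
Implicit Types h : Y -> R.

Definition cvg_mean h := \int[P]_w h (X_ n w) @[n --> \oo] --> \int[Q]_w h (X w).

Let bX_ h n : bmeas h -> bmeas (fun w => h (X_ n w)).
Proof. exact: bmeas_comp. Qed.

Let bX h : bmeas h -> bmeas (fun w => h (X w)).
Proof. exact: bmeas_comp. Qed.

Lemma cvg_meanD h1 h2 : bmeas h1 -> bmeas h2 -> cvg_mean h1 -> cvg_mean h2 ->
  cvg_mean (fun y => h1 y + h2 y).
Proof.
move=> b1 b2 c1 c2; rewrite /cvg_mean meanD; [|exact: bX|exact: bX].
under eq_fun do rewrite (meanD _ (bX_ _ b1) (bX_ _ b2)).
exact: cvgD.
Qed.

Lemma cvg_meanB h1 h2 : bmeas h1 -> bmeas h2 -> cvg_mean h1 -> cvg_mean h2 ->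
  cvg_mean (fun y => h1 y - h2 y).
Proof.
move=> b1 b2 c1 c2; rewrite /cvg_mean meanB; [|exact: bX|exact: bX].
under eq_fun do rewrite (meanB _ (bX_ _ b1) (bX_ _ b2)).
exact: cvgB.
Qed.

Lemma cvg_meanZ c h : bmeas h -> cvg_mean h -> cvg_mean (fun y => c * h y).
Proof.
move=> bh ch; rewrite /cvg_mean meanZ; last exact: bX.
under eq_fun do rewrite (meanZ _ _ (bX_ _ bh)).
by apply: cvgMl_tmp => //; exact: cvg_cst.
Qed.

Lemma cvg_mean_approx h : bmeas h ->
  (forall e, 0 < e -> exists h', [/\ bmeas h', cvg_mean h',
     forall n w, `|h (X_ n w) - h' (X_ n w)| <= e &
     forall w, `|h (X w) - h' (X w)| <= e]) ->
  cvg_mean h.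
Proof.
move=> bh happ; apply/cvgrPdist_le => e e0.
have e3 : 0 < e / 3 by rewrite divr_gt0.
have [h' [bh' ch' hn hX]] := happ _ e3.
have /cvgrPdist_le/(_ _ e3) near1 := ch'.
near=> n.
have i1 : `|\int[Q]_w h (X w) - \int[Q]_w h' (X w)| <= e / 3.
  by apply: mean_dist; [exact: bX|exact: bX|].
have i2 : `|\int[P]_w h (X_ n w) - \int[P]_w h' (X_ n w)| <= e / 3.
  by apply: mean_dist; [exact: bX_|exact: bX_|].
have i3 : `|\int[Q]_w h' (X w) - \int[P]_w h' (X_ n w)| <= e / 3 by near: n.
move: i1 i2 i3; rewrite !ler_norml; lra.
Unshelve. all: by end_near. Qed.

(* Tightness for free: if the limit charges the cut-off [chi] almost fully and
   [chi] itself is a convergence function, so do the approximating laws. *)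
Lemma cvg_mean_cutoff h M : bmeas h -> (forall y, `|h y| <= M) ->
  (forall e, 0 < e -> exists chi, [/\ bmeas chi, forall y, 0 <= chi y <= 1,
     cvg_mean chi, cvg_mean (fun y => h y * chi y) & 1 - e <= \int[Q]_w chi (X w)]) ->
  cvg_mean h.
Proof.
move=> bh hM hcut; apply/cvgrPdist_le => e e0.
have M0 : 0 <= M by exact: le_trans (hM (X point)).
(* The limit loses at most [M r] to the cut-off and the approximants at most [2 M r]; with [e / 4]
   for the cut-off function itself the total stays below [e]. Using [M + 1] keeps the divisor
   positive. *)
pose r := e / (4 * (M + 1)).
have r0 : 0 < r by rewrite divr_gt0// mulr_gt0// ltr_wpDl.
have rM : r * (4 * (M + 1)) = e by rewrite divfK// gt_eqF// mulr_gt0// ltr_wpDl.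
have [chi [bc c01 cc chc Qc]] := hcut _ r0.
have e4 : 0 < e / 4 by rewrite divr_gt0.
have bhc := bmeasM bh bc.
have b1c : bmeas (fun y => M * (1 - chi y)).
  by apply: bmeasM; [exact: bmeas_cst|apply: bmeasB => //; exact: bmeas_cst].
have hchi y : `|h y - h y * chi y| <= M * (1 - chi y).
  rewrite -{1}[h y]mulr1 -mulrBr normrM ler_pM//.
  by rewrite ger0_norm// subr_ge0; case/andP: (c01 y).
have cut d0 (S : measurableType d0) (p : probability S R) (Z : S -> Y) :
    measurable_fun setT Z ->
    `|\int[p]_w h (Z w) - \int[p]_w (h (Z w) * chi (Z w))| <=
    M * (1 - \int[p]_w chi (Z w)).
  move=> mZ; have bZ (f : Y -> R) : bmeas f -> bmeas (fun w => f (Z w)) by exact: bmeas_comp.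
  rewrite -(meanB p (bZ _ bh) (bZ _ bhc)).
  rewrite (le_trans (mean_norm _ _))//; first by apply: bmeasB; [exact: bZ _ bh|exact: bZ _ bhc].
  rewrite -[X in M * (X - _)](mean_cst p) -(meanB p (bmeas_cst _ _) (bZ _ bc)).
  rewrite -(meanZ p); last by apply: bmeasB; [exact: bmeas_cst|exact: bZ _ bc].
  apply: le_mean => //.
    by apply/bmeas_norm/bmeasB; [exact: bZ _ bh|exact: bZ _ bhc].
  exact: bZ _ b1c.
have /cvgrPdist_le/(_ _ r0) nearc := cc.
have /cvgrPdist_le/(_ _ e4) nearh := chc.
near=> n.
have i1 := cut _ _ Q X mX.
have i2 := cut _ _ P (X_ n) (mX_ n).
have i3 : `|\int[Q]_w (h (X w) * chi (X w)) - \int[P]_w (h (X_ n w) * chi (X_ n w))| <= e / 4.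
  by near: n.
have i4 : `|\int[Q]_w chi (X w) - \int[P]_w chi (X_ n w)| <= r by near: n.
have j1 : M * (1 - \int[Q]_w chi (X w)) <= M * r.
  by apply: ler_wpM2l => //; rewrite lerBlDr; lra.
have j2 : M * (1 - \int[P]_w chi (X_ n w)) <= M * (2 * r).
  by apply: ler_wpM2l => //; move: i4; rewrite ler_norml; lra.
have Mr : M * r * 4 <= e - 4 * r by rewrite -rM; lra.
move: i1 i2 i3; rewrite !ler_norml; lra.
Unshelve. all: by end_near. Qed.

End ConvergenceClass.

Section Cutoff.
Context (R : realType).
Implicit Types L x : R.

Definition cutoff L x : R := Num.max 0 (Num.min 1 (L + 1 - `|x|)).

Lemma cutoff01 L x : 0 <= cutoff L x <= 1.
Proof. by rewrite /cutoff le_max lexx/= ge_max ler01 ge_min lexx. Qed.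

Lemma cutoff_eq1 L x : `|x| <= L -> cutoff L x = 1.
Proof.
move=> xL; rewrite /cutoff min_l; last by rewrite lerBrDr addrC lerD2r.
by rewrite max_r.
Qed.

Lemma cutoff_eq0 L x : L + 1 <= `|x| -> cutoff L x = 0.
Proof.
by move=> xL; rewrite /cutoff max_l// ge_min subr_le0 xL orbT.
Qed.

Lemma continuous_cutoff L : continuous (cutoff L).
Proof.
move=> x; apply: (@continuous_max _ _ (fun=> 0) (fun x => Num.min 1 (L + 1 - `|x|))).
  exact: cvg_cst.
apply: (@continuous_min _ _ (fun=> 1) (fun x => L + 1 - `|x|)).
  exact: cvg_cst.
apply: cvgB; first exact: cvg_cst.
exact: norm_continuous.
Qed.

Lemma bmeas_cutoff L : bmeas (cutoff L).
Proof.
split; first by apply: continuous_measurable_fun; exact: continuous_cutoff.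
by exists 1 => x; have /andP[? ?] := cutoff01 L x; rewrite ger0_norm.
Qed.

Lemma mean_cutoff_cvg d (T : measurableType d) (P : probability T R) (X : T -> R) :
  measurable_fun setT X ->
  \int[P]_w cutoff n%:R (X w) @[n --> \oo] --> (1:R).
Proof.
move=> mX; rewrite -[X in _ --> X](mean_cst P 1).
apply: (@mean_cvg _ _ _ _ _ _ 1) => //.
- move=> n; apply: (@measurableT_comp _ _ _ _ _ _ (cutoff n%:R)) => //.
  by case: (bmeas_cutoff n%:R).
- by move=> n w; have /andP[? ?] := cutoff01 n%:R (X w); rewrite ger0_norm.
- apply: aeW => w; apply: cvg_near_cst; near=> n.
  apply: cutoff_eq1; near: n; exact: nbhs_infty_ger.
Unshelve. all: by end_near. Qed.
End Cutoff.

(** * Continuous functions on the plane are measurable *)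

Section PlaneContinuity.
Context (R : realType).

(** Every open set is the union of the squares with rational centre and radius that it contains, a
    countable family of measurable rectangles. This links the product sigma-algebra to the
    topology. *)
Lemma open_measurable_plane (U : set (R * R)) : open U -> measurable U.
Proof.
move=> oU.
pose box (q : rat * rat * rat) : set (R * R) :=
  ball (ratr q.1.1 : R) (ratr q.2) `*` ball (ratr q.1.2 : R) (ratr q.2).
have -> : U = \bigcup_(q in [set q | box q `<=` U]) box q; last first.
  rewrite bigcup_mkcond; apply: countable_bigcupT_measurable => // q.
  case: ifP => _ //; apply: measurableX; exact: measurable_ball.
apply/seteqP; split => [[a b] Uab|p [q qU]]; last exact: qU.
have /nbhs_ballP[e /= e0 eU] := open_nbhs_nbhs (conj oU Uab).
have [r /andP[r0 re]] : exists r : rat, (0 : R) < ratr r < e / 2.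
  have [r] := @rat_in_itvoo R 0 (e / 2) ltac:(by rewrite divr_gt0).
  by rewrite in_itv/=; exists r.
have near_rat (c : R) : exists q : rat, `|ratr q - c| < ratr r.
  have [q] := @rat_in_itvoo R (c - ratr r) (c + ratr r) ltac:(by rewrite ltrBlDr -addrA ltrDl addr_gt0).
  by rewrite in_itv/= => /andP[? ?]; exists q; rewrite ltr_norml; lra.
have [q1 h1] := near_rat a; have [q2 h2] := near_rat b.
exists (q1, q2, r) => /=; last by split.
move=> [a' b'] [/= h1' h2']; apply: eU.
move: h1 h2 h1' h2'; rewrite /ball/= /ball/= => h1 h2 h1' h2'.
split => /=.
  rewrite distrC in h1; rewrite /ball/= -(subrKA (ratr q1)) (le_lt_trans (ler_normD _ _))//; lra.
rewrite distrC in h2; rewrite /ball/= -(subrKA (ratr q2)) (le_lt_trans (ler_normD _ _))//; lra.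
Qed.

Lemma continuous_measurable_plane (f : R * R -> R) :
  continuous f -> measurable_fun [set: R * R] f.
Proof.
move=> cf mD; apply: (measurability _ (RGenOInfty.measurableE R)) => //.
move=> /= _ [_ [a ->] <-]; rewrite setTI; apply: open_measurable_plane.
apply: open_comp; first by move=> x _; exact: cf.
exact: interval_open.
Qed.

Lemma bmeas_plane (f : R * R -> R) M : continuous f -> (forall p, `|f p| <= M) -> bmeas f.
Proof. by move=> cf fM; split; [exact: continuous_measurable_plane|exists M]. Qed.

Lemma bmeas_line (f : R -> R) M : continuous f -> (forall x, `|f x| <= M) -> bmeas f.
Proof. by move=> cf fM; split; [exact: continuous_measurable_fun|exists M]. Qed.

End PlaneContinuity.

(** * The charts [exp(-v)] and logistic *)

Section Charts.
Context (R : realType).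

(** A displacement by [dl] multiplies or divides [exp(-v)] by at least [exp(dl)], and [exp(-v)] is
    at least [exp(-L)]; this gives the constant. *)
Lemma expN_chart_inj (L dl : R) : 0 < dl ->
  exists2 kp, 0 < kp & forall v v', `|v| <= L -> dl <= `|v - v'| ->
    kp <= `|expR (- v) - expR (- v')|.
Proof.
move=> dl0; exists (expR (- L) * (1 - expR (- dl))).
  by rewrite mulr_gt0 ?expR_gt0// subr_gt0 expR_lt1 oppr_lt0.
move=> v v' /ler_normlP[? vL].
have eL : expR (- L) <= expR (- v) by rewrite ler_expR lerN2.
have ed : 0 <= 1 - expR (- dl) by rewrite subr_ge0 -[leRHS]expR0 ler_expR oppr_le0 ltW.
rewrite ler_normr => dvv; apply: (le_trans (ler_wpM2r ed eL)).
rewrite ler_normr opprB; case/orP: dvv => dvv; apply/orP.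
  right; have xy : expR (- v) <= expR (- v') * expR (- dl) by rewrite -expRD ler_expR; lra.
  have : expR (- v) <= expR (- v') by rewrite ler_expR; lra.
  by move: ed; nra.
left; have : expR (- v') <= expR (- v) * expR (- dl) by rewrite -expRD ler_expR; lra.
lra.
Qed.

Lemma expN_chart_dense (x e : R) : 0 <= x <= 1 -> 0 < e ->
  exists2 v, 0 <= v & `|expR (- v) - x| <= e.
Proof.
(* The value 0 is not attained, so [x] is raised to at least [min e 1] before taking the logarithm;
   staying below 1 makes the preimage nonnegative. *)
move=> /andP[x0 x1] e0; pose y := Num.max x (Num.min e 1).
have y0 : 0 < y by rewrite lt_max lt_min e0 ltr01 orbT.
have y1 : y <= 1 by rewrite ge_max x1 ge_min lexx orbT.
have yx : `|y - x| <= e.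
  rewrite ger0_norm ?subr_ge0 ?le_max ?lexx//.
  rewrite lerBlDr ge_max lerDr (ltW e0)/= (le_trans (_ : _ <= e))//.
    by rewrite ge_min lexx.
  by rewrite lerDl.
exists (- ln y); first by rewrite oppr_ge0 -ln1 ler_ln// posrE.
by rewrite opprK lnK// posrE.
Qed.

(** Its derivative is [logistic - logistic^2], so differentiating its powers never leaves the
    polynomials in it. *)
Definition logistic (v : R) : R := (1 + expR (- v))^-1.

Lemma logistic_gt0 v : 0 < logistic v.
Proof. by rewrite invr_gt0 addr_gt0 ?expR_gt0. Qed.

Lemma logistic_lt1 v : logistic v < 1.
Proof. by rewrite invf_lt1 ?ltrDl ?addr_gt0 ?expR_gt0. Qed.

Lemma continuous_logistic : continuous logistic.
Proof.
move=> v; apply: cvgV; first by rewrite gt_eqF// addr_gt0 ?expR_gt0.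
apply: cvgD; first exact: cvg_cst.
apply: (@continuous_comp _ _ _ (fun x : R => - x) expR); first exact: opp_continuous.
exact: continuous_expR.
Qed.

Lemma logistic_chart_inj (L dl : R) : 0 < dl ->
  exists2 kp, 0 < kp & forall v v', `|v| <= L -> dl <= `|v - v'| ->
    kp <= `|logistic v - logistic v'|.
Proof.
move=> dl0; pose c := expR L; pose q := expR (- dl).
have q0 : 0 < q := expR_gt0 _; have c0 : 0 < c := expR_gt0 _.
have q1 : q < 1 by rewrite expR_lt1 oppr_lt0.
pose kp := (1 - q) / ((1 + c) * (1 + c) * c * 2).
have kp0 : 0 < kp by rewrite divr_gt0 ?subr_gt0// !mulr_gt0// addr_gt0.
(* Here [a = exp(-v)], [b = exp(-v')], and the gap is [|b - a| / ((1 + a) (1 + b))]. If [b] is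
   small, the denominator is at most [(1 + c)^2] and [a >= 1/c]. If [b] is large, [1 + b <= 2 c b]
   compensates the unbounded denominator. The constant [kp] covers both cases. *)
have key a b : c^-1 <= a <= c -> 0 < b -> (b <= a * q \/ a <= b * q) ->
    kp <= `|(1 + a)^-1 - (1 + b)^-1|.
  move=> /andP[ca ac] b0 hb.
  have a0 : 0 < a by rewrite (lt_le_trans _ ca)// invr_gt0.
  have ca1 : 1 <= c * a by rewrite -[leLHS](@mulfV _ c) ?gt_eqF// ler_pM2l.
  rewrite (_ : _ - _ = (b - a) / ((1 + a) * (1 + b))); last first.
    by field; rewrite !gt_eqF ?addr_gt0.
  rewrite normrM [X in _ * X]ger0_norm; last by rewrite invr_ge0 mulr_ge0 ?addr_ge0// ltW.
  have d1 : 0 < (1 + a) * (1 + b) by rewrite mulr_gt0// addr_gt0.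
  rewrite ler_pdivlMr// /kp mulrAC ler_pdivrMr; last by rewrite !mulr_gt0// addr_gt0.
  case: hb => hb.
    rewrite ler0_norm; last by nra.
    have h1 : a * (1 - q) <= - (b - a) by lra.
    have : (1 - q) * ((1 + a) * (1 + b)) <= (a * (1 - q)) * ((1 + c) * (1 + c) * c * 2).
      rewrite (_ : a * (1 - q) * _ = (1 - q) * ((1 + c) * (1 + c) * (c * a * 2))); last by ring.
      rewrite ler_pM2l ?subr_gt0//.
      have : b <= a by nra.
      have : (1 + a) * (1 + b) <= (1 + c) * (1 + c) by apply: ler_pM; nra.
      have : 0 < (1 + c) * (1 + c) by rewrite mulr_gt0// addr_gt0.
      set X := (1 + c) * (1 + c); set Y := (1 + a) * (1 + b); nra.
    move/le_trans; apply; rewrite ler_wpM2r// !mulr_ge0// ?addr_ge0// ltW//.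
  rewrite ger0_norm; last by nra.
  have h1 : b * (1 - q) <= b - a by lra.
  have : (1 - q) * ((1 + a) * (1 + b)) <= (b * (1 - q)) * ((1 + c) * (1 + c) * c * 2).
    rewrite (_ : b * (1 - q) * _ = (1 - q) * ((1 + c) * (((1 + c) * 2) * (c * b)))); last by ring.
    rewrite ler_pM2l ?subr_gt0//.
    apply: ler_pM; [by rewrite addr_ge0// ltW|by rewrite addr_ge0// ltW|by rewrite lerD2l|].
    have ab : a <= b by nra.
    have c1 : 1 <= c by nra.
    have cb : 1 <= c * b by nra.
    have bcb : b <= c * b by nra.
    move: (c * b) cb bcb => X X1 bX; nra.
  move/le_trans; apply; rewrite ler_wpM2r// !mulr_ge0// ?addr_ge0// ltW//.
exists kp => // v v' /ler_normlP[vL vL'] vv; apply: key; last 2 first.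
- exact: expR_gt0.
- have [vv'|vv'] := lerP v v'.
    left; rewrite -expRD ler_expR; move: vv; rewrite ler0_norm ?subr_le0//; lra.
  right; rewrite -expRD ler_expR; move: vv; rewrite ger0_norm ?subr_ge0 ?(ltW vv')//; lra.
- by rewrite -expRN !ler_expR; apply/andP; split; lra.
Qed.

Lemma logistic_chart_dense (x e : R) : 0 <= x <= 1 -> 0 < e ->
  exists v, `|logistic v - x| <= e.
Proof.
move=> /andP[x0 x1] e0; pose r := Num.min e 2^-1.
have r0 : 0 < r by rewrite lt_min e0/= invr_gt0.
have re : r <= e by rewrite ge_min lexx.
have r2 : r <= 2^-1 by rewrite ge_min lexx orbT.
have [y [y0 y1 yx]] : exists y, [/\ 0 < y, y < 1 & `|y - x| <= e].
  have [xr|xr] := lerP x 2^-1.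
    by exists (x + r / 2); split; [lra|lra|rewrite ler_norml; lra].
  by exists (x - r / 2); split; [lra|lra|rewrite ler_norml; lra].
exists (- ln (y^-1 - 1)); rewrite /logistic opprK lnK; last first.
  by rewrite posrE subr_gt0 invf_gt1.
by rewrite (_ : 1 + (y^-1 - 1) = y^-1) ?invrK//; ring.
Qed.

End Charts.

(** * From chart polynomials to all bounded continuous functions *)

Section WeakConvergence.
Context (R : realType) d (T : measurableType d) (P : probability T R).
Context d' (T' : measurableType d') (Q : probability T' R).

(** Each step of the Bernstein recursion multiplies by [Theta] or [1 - Theta], so the induction on
    the degree carries an arbitrary power of [Theta] in front. *)
Lemma cvg_mean_bernstein dY (Y : measurableType dY) (X_ : nat -> T -> Y)
    (X : T' -> Y) (Theta : Y -> R) :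
  (forall n, measurable_fun setT (X_ n)) -> measurable_fun setT X -> bmeas Theta ->
  forall N (g : nat -> Y -> R), (forall k, bmeas (g k)) ->
  (forall m k, cvg_mean P Q X_ X (fun y => Theta y ^+ m * g k y)) ->
  bmeas (fun y => bernstein N (g^~ y) (Theta y)) /\
  forall m, cvg_mean P Q X_ X (fun y => Theta y ^+ m * bernstein N (g^~ y) (Theta y)).
Proof.
move=> mX_ mX bT; elim=> [|N ih] g bg cg /=; first by split => // m; exact: cg.
have [b1 c1] := ih g bg cg.
have [b2 c2] := ih (fun k => g k.+1) (fun k => bg _) (fun m k => cg _ _).
split.
  by apply: bmeasD; apply: bmeasM => //; apply: bmeasB => //; exact: bmeas_cst.
move=> m.
have -> : (fun y => Theta y ^+ m * ((1 - Theta y) * bernstein N (g^~ y) (Theta y) +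
    Theta y * bernstein N (fun k => g k.+1 y) (Theta y))) =
  (fun y => Theta y ^+ m * bernstein N (g^~ y) (Theta y) -
     Theta y ^+ m.+1 * bernstein N (g^~ y) (Theta y) +
     Theta y ^+ m.+1 * bernstein N (fun k => g k.+1 y) (Theta y)).
  by apply/funext => y; rewrite exprS; ring.
have bm j h : bmeas h -> bmeas (fun y => Theta y ^+ j * h y).
  by move=> bh; apply: bmeasM => //; exact: bmeasX.
apply: cvg_meanD => //; [by apply: bmeasB; exact: bm|exact: bm|].
by apply: cvg_meanB => //; exact: bm.
Qed.

Let continuous_fst (g : R -> R) : continuous g -> continuous (fun p : R * R => g p.1).
Proof. by move=> cg p; apply: continuous_comp; [exact: cvg_fst|exact: cg]. Qed.

Let continuous_snd (g : R -> R) : continuous g -> continuous (fun p : R * R => g p.2).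
Proof. by move=> cg p; apply: continuous_comp; [exact: cvg_snd|exact: cg]. Qed.

Let plane_cutoff (f : R * R -> R) (L : R) (p : R * R) : R :=
  f p * (cutoff L p.1 * cutoff L p.2).

Let continuous_plane_cutoff f L : continuous f -> continuous (plane_cutoff f L).
Proof.
move=> cf p; apply: cvgM; first exact: cf.
by apply: cvgM; [apply: continuous_fst|apply: continuous_snd]; exact: continuous_cutoff.
Qed.

Let plane_cutoff_le f L M p : (forall p, `|f p| <= M) -> `|plane_cutoff f L p| <= M.
Proof.
move=> fM; rewrite normrM -[leRHS]mulr1 ler_pM// ger0_norm.
  have /andP[? ?] := cutoff01 L p.1; have /andP[? ?] := cutoff01 L p.2.
  exact: mulr_ile1.
by have /andP[? _] := cutoff01 L p.1; have /andP[? _] := cutoff01 L p.2; rewrite mulr_ge0.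
Qed.

Let plane_cutoff0 f L v w : L + 1 < `|v| \/ L + 1 < `|w| -> plane_cutoff f L (v, w) = 0.
Proof.
by rewrite /plane_cutoff/=; case=> h; rewrite (cutoff_eq0 (ltW h)) ?mul0r ?mulr0.
Qed.

(* On the half-line the chart exp(-v) turns convergence of Laplace transforms
   at integers into convergence of all bounded continuous means. *)
Theorem laplace_weak_cvg (X_ : nat -> T -> R) (X : T' -> R) :
  (forall n, measurable_fun setT (X_ n)) -> measurable_fun setT X ->
  (forall n w, 0 <= X_ n w) -> (forall w, 0 <= X w) ->
  (forall m : nat, \int[P]_w expR (- (m%:R * X_ n w)) @[n --> \oo] -->
     \int[Q]_w expR (- (m%:R * X w))) ->
  forall (f : R -> R) M, continuous f -> (forall x, `|f x| <= M) ->
  cvg_mean P Q X_ X f.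
Proof.
move=> mX_ mX X_0 X0 lap f M cf fM.
(* The absolute value makes the chart bounded on the whole line; the variables only see its
   nonnegative half. *)
pose Theta (v : R) := expR (- `|v|).
have cT : continuous Theta.
  move=> v; apply: (@continuous_comp _ _ _ (fun v : R => - `|v|) expR).
    by apply: cvgN; exact: norm_continuous.
  exact: continuous_expR.
have T01 v : 0 <= Theta v <= 1.
  by rewrite /Theta expR_ge0/= -[leRHS]expR0 ler_expR oppr_le0.
have bT : bmeas Theta.
  by apply: (bmeas_line (M := 1)) => // v; have /andP[? ?] := T01 v; rewrite ger0_norm.
have cT_ m : cvg_mean P Q X_ X (fun v => Theta v ^+ m).
  have h x : 0 <= x -> Theta x ^+ m = expR (- (m%:R * x)).
    by move=> x0; rewrite /Theta ger0_norm// -mulrN expRM_natl.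
  rewrite /cvg_mean; under eq_Rintegral do rewrite h//.
  rewrite (_ : (fun n => _) = (fun n => \int[P]_w expR (- (m%:R * X_ n w)))); first exact: lap.
  by apply/funext => n; apply: eq_Rintegral => w _; exact: h.
have Tinj L dl : 0 < dl -> exists2 kp, 0 < kp & forall v v',
    [set v | 0 <= v] v -> [set v | 0 <= v] v' -> `|v| <= L -> dl <= `|v - v'| ->
    kp <= `|Theta v - Theta v'|.
  move=> dl0; have [kp kp0 h] := expN_chart_inj L dl0.
  exists kp => // v v' /= v0 v'0 vL; rewrite /Theta (ger0_norm v0) (ger0_norm v'0).
  exact: h.
have Tdense x r : 0 <= x <= 1 -> 0 < r ->
    exists2 v, [set v | 0 <= v] v & `|Theta v - x| <= r.
  move=> x01 r0; have [v v0 vx] := expN_chart_dense x01 r0.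
  by exists v => //; rewrite /Theta (ger0_norm v0).
have compact_case (g : R -> R) K (L : nat) : continuous g -> (forall x, `|g x| <= K) ->
    cvg_mean P Q X_ X (fun v => g v * cutoff L%:R v).
  move=> cg gK.
  (* The line is embedded in the plane at second coordinate 0, where the second cut-off equals 1, so
     that [bernstein_chart] applies. *)
  pose F := plane_cutoff (fun p => g p.1) L%:R.
  have FE v : F (v, 0) = g v * cutoff L%:R v.
    by rewrite /F /plane_cutoff/= (@cutoff_eq1 _ _ 0) ?normr0// mulr1.
  apply: cvg_mean_approx => //.
    apply: bmeasM; first exact: bmeas_line cg gK.
    exact: bmeas_cutoff.
  move=> e e0.
  have cF : continuous F by apply/continuous_plane_cutoff/continuous_fst.
  have FK p : `|F p| <= K by apply: plane_cutoff_le => ?; exact: gK.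
  have [N [y hy]] := bernstein_chart cF FK (@plane_cutoff0 _ _)
    (fun v _ => T01 v) (Tinj (L%:R + 1)) Tdense e0.
  pose a k (_ : R) := F (y k, 0).
  have ca m k : cvg_mean P Q X_ X (fun v => Theta v ^+ m * a k v).
    rewrite (_ : (fun v => _) = (fun v => F (y k, 0) * Theta v ^+ m)).
      by apply: (cvg_meanZ mX_ mX); [exact: bmeasX|exact: cT_].
    by apply/funext => v; rewrite mulrC.
  have [bb cb] := cvg_mean_bernstein mX_ mX bT N (fun k => bmeas_cst _ _) ca.
  exists (fun v => bernstein N (a^~ v) (Theta v)); split => //.
  - by have := cb 0%N; under eq_fun do rewrite expr0 mul1r.
  - by move=> n w; rewrite -FE; exact: (hy _ 0 (X_0 n w)).
  - by move=> w; rewrite -FE; exact: (hy _ 0 (X0 w)).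
apply: (@cvg_mean_cutoff _ _ _ _ _ _ _ _ _ _ _ _ _ _ M) => //.
  exact: bmeas_line cf fM.
move=> e e0.
have /cvgrPdist_le/(_ _ e0)[L _ /(_ L (leqnn _)) hL] := mean_cutoff_cvg Q mX.
exists (cutoff L%:R); split.
- exact: bmeas_cutoff.
- exact: cutoff01.
- rewrite (_ : cutoff L%:R = (fun v => 1 * cutoff L%:R v)).
    apply: (compact_case (fun=> 1) 1); last by move=> ?; rewrite normr1.
    by move=> x; exact: cvg_cst.
  by apply/funext => v; rewrite mul1r.
- exact: compact_case fM.
- by move: hL; rewrite ler_norml; lra.
Qed.

(** Only the first coordinate is charted. The Bernstein coefficients are then continuous functions
    of the second coordinate, so the approximants are finite combinations of exactly the products
    assumed to converge. *)
Theorem logistic_weak_cvg (X_ : nat -> T -> R * R) (X : T' -> R * R) :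
  (forall n, measurable_fun setT (X_ n)) -> measurable_fun setT X ->
  (forall (m : nat) (g : R -> R) K, continuous g -> (forall x, `|g x| <= K) ->
    cvg_mean P Q X_ X (fun p => logistic p.1 ^+ m * g p.2)) ->
  forall (f : R * R -> R) M, continuous f -> (forall x, `|f x| <= M) ->
  cvg_mean P Q X_ X f.
Proof.
move=> mX_ mX lap f M cf fM.
have cT := @continuous_logistic R.
have T01 (v : R) : 0 <= logistic v <= 1.
  by rewrite !ltW ?logistic_gt0 ?logistic_lt1.
have bT : bmeas (fun p : R * R => logistic p.1).
  apply: (bmeas_plane (M := 1)); first exact: continuous_fst.
  by move=> p; have /andP[? ?] := T01 p.1; rewrite ger0_norm.
have Tinj (L dl : R) : 0 < dl -> exists2 kp, 0 < kp & forall v v',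
    setT v -> setT v' -> `|v| <= L -> dl <= `|v - v'| ->
    kp <= `|logistic v - logistic v'|.
  move=> dl0; have [kp kp0 h] := logistic_chart_inj L dl0.
  by exists kp => // v v' _ _; exact: h.
have Tdense (x r : R) : 0 <= x <= 1 -> 0 < r -> exists2 v, setT v & `|logistic v - x| <= r.
  by move=> x01 r0; have [v vx] := logistic_chart_dense x01 r0; exists v.
have compact_case g K (L : nat) : continuous g -> (forall x, `|g x| <= K) ->
    cvg_mean P Q X_ X (plane_cutoff g L%:R).
  move=> cg gK.
  pose F := plane_cutoff g L%:R.
  have cF : continuous F by exact: continuous_plane_cutoff.
  have FK p : `|F p| <= K by exact: plane_cutoff_le.
  apply: cvg_mean_approx => //.
    exact: bmeas_plane cF FK.
  move=> e e0.
  have [N [y hy]] := bernstein_chart cF FK (@plane_cutoff0 _ _)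
    (fun v (_ : setT v) => T01 v) (Tinj (L%:R + 1)) Tdense e0.
  pose a k (p : R * R) := F (y k, p.2).
  have ca k : continuous (fun w => F (y k, w)).
    move=> w; apply: (@continuous_comp _ _ _ (fun w => (y k, w)) F); last exact: cF.
    move=> A [[B C] [/= nB nC] BCA]; apply: filterS nC => z Cz; apply: BCA.
    by split => //=; exact: nbhs_singleton.
  have [bb cb] := @cvg_mean_bernstein _ _ X_ X _ mX_ mX bT N a
    (fun k => bmeas_plane (continuous_snd (ca k)) (fun p => FK (y k, p.2)))
    (fun m k => lap m _ _ (ca k) (fun w => FK (y k, w))).
  exists (fun p => bernstein N (a^~ p) (logistic p.1)); split => //.
  - by have := cb 0%N; under eq_fun do rewrite expr0 mul1r.
  - by move=> n w; rewrite [X_ n w]surjective_pairing; exact: hy.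
  - by move=> w; rewrite [X w]surjective_pairing; exact: hy.
apply: (@cvg_mean_cutoff _ _ _ _ _ _ _ _ _ _ _ _ _ _ M) => //.
  exact: bmeas_plane cf fM.
move=> e e0.
have e2 : 0 < e / 2 by rewrite divr_gt0.
have mX1 : measurable_fun setT (fun w => (X w).1) by exact: measurableT_comp.
have mX2 : measurable_fun setT (fun w => (X w).2) by exact: measurableT_comp.
have /cvgrPdist_le/(_ _ e2) near1 := mean_cutoff_cvg Q mX1.
have /cvgrPdist_le/(_ _ e2) near2 := mean_cutoff_cvg Q mX2.
have [L _ /(_ L (leqnn _)) [hL1 hL2]] := filterI near1 near2.
pose chi := plane_cutoff (fun=> 1) L%:R.
have chiE p : chi p = cutoff L%:R p.1 * cutoff L%:R p.2 by rewrite /chi/plane_cutoff mul1r.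
have cut1 (p : R * R) := cutoff01 (L%:R : R) p.1.
have cut2 (p : R * R) := cutoff01 (L%:R : R) p.2.
have c1 : continuous (fun _ : R * R => 1 : R) by move=> p; exact: cvg_cst.
have bchi : bmeas chi.
  apply: (bmeas_plane (M := 1)); first exact: continuous_plane_cutoff.
  by move=> p; apply: plane_cutoff_le => ?; rewrite normr1.
exists chi; split => //.
- move=> p; rewrite chiE; have /andP[? ?] := cut1 p; have /andP[? ?] := cut2 p.
  by rewrite mulr_ge0//= mulr_ile1.
- by apply: (compact_case _ 1) => // ?; rewrite normr1.
- rewrite (_ : (fun p => f p * chi p) = plane_cutoff f L%:R); first exact: compact_case fM.
  by apply/funext => p; rewrite chiE.
(* For [a] and [b] in [[0, 1]] one has [a b >= a + b - 1], so the two marginal tails can be bounded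
   separately. *)
- have i : \int[Q]_w (cutoff L%:R (X w).1 + cutoff L%:R (X w).2 - 1) <= \int[Q]_w chi (X w).
    apply: le_mean.
    + apply: bmeasB; last exact: bmeas_cst.
      by apply: bmeasD; apply: (@bmeas_comp _ _ _ _ _ _ (cutoff L%:R)) => //; exact: bmeas_cutoff.
    + exact: (@bmeas_comp _ _ _ _ _ X).
    + move=> w; rewrite chiE; have /andP[? ?] := cut1 (X w); have /andP[? ?] := cut2 (X w); nra.
  apply: le_trans i; rewrite meanB; last 2 first.
  + by apply: bmeasD; apply: (@bmeas_comp _ _ _ _ _ _ (cutoff L%:R)) => //; exact: bmeas_cutoff.
  + exact: bmeas_cst.
  rewrite mean_cst meanD; last 2 first.
  + by apply: (@bmeas_comp _ _ _ _ _ _ (cutoff L%:R)) => //; exact: bmeas_cutoff.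
  + by apply: (@bmeas_comp _ _ _ _ _ _ (cutoff L%:R)) => //; exact: bmeas_cutoff.
  move: hL1 hL2; rewrite !ler_norml; lra.
Qed.

End WeakConvergence.

Lemma cvg0_dom (R : realType) (u v : nat -> R) : (forall n, `|u n| <= v n) ->
  v n @[n --> \oo] --> (0 : R) -> u n @[n --> \oo] --> (0 : R).
Proof.
move=> uv /cvgrPdist_le v0; apply/cvgrPdist_le => e e0.
apply: filterS (v0 _ e0) => n; rewrite !sub0r !normrN => h.
by rewrite (le_trans (uv n))// (le_trans (ler_norm _)).
Qed.

(** * Integration against a density, and the improper fundamental theorem *)

Section Density.
Context d (T : measurableType d) (R : realType).
Variables (m1 m2 : {measure set T -> \bar R}) (p : T -> R).
Hypothesis mp : measurable_fun setT p.
Hypothesis p0 : forall x, 0 <= p x.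
Hypothesis m1E : forall A, measurable A -> m1 A = (\int[m2]_(x in A) (p x)%:E)%E.

Import HBNNSimple.

Let indic A : measurable A ->
  (\int[m1]_x (\1_A x)%:E = \int[m2]_x ((\1_A x)%:E * (p x)%:E))%E.
Proof.
move=> mA; rewrite integral_indic//= setIT m1E// integral_mkcond/=.
apply: eq_integral => x _; rewrite patchE indicE.
by case: ifP => _; rewrite ?mul1e ?mul0e.
Qed.

Let nnsfun_density (f : {nnsfun T >-> R}) :
  (\int[m1]_x (f x)%:E = \int[m2]_x ((f x)%:E * (p x)%:E))%E.
Proof.
under [LHS]eq_integral do rewrite fimfunE -fsumEFin//.
rewrite [LHS]ge0_integral_fsum//; last 2 first.
  - by move=> r; exact/measurable_EFinP/measurableT_comp.
  - by move=> n x _; rewrite EFinM nnfun_muleindic_ge0.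
under [RHS]eq_integral.
  move=> x xD; rewrite fimfunE -fsumEFin// muleC ge0_mule_fsumr; last first.
    by move=> r; rewrite EFinM nnfun_muleindic_ge0.
  over.
rewrite [RHS]ge0_integral_fsum//; last 2 first.
  - move=> r; apply: emeasurable_funM; first exact/measurable_EFinP.
    by apply/measurable_EFinP; exact/measurableT_comp.
  - move=> n x _; rewrite mule_ge0//; first by rewrite lee_fin.
    by rewrite EFinM nnfun_muleindic_ge0.
apply: eq_fsbigr => r _.
rewrite integralZl_indic_nnsfun//= indic//.
have [r0|r0] := ltP r 0.
  rewrite !integral0_eq ?mule0// => x _; rewrite preimage_nnfun0// indic0 ?mul0e//.
  by rewrite mulr0 mule0.
rewrite -ge0_integralZl//.
- by apply: eq_integral => x _; rewrite EFinM muleA muleC.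
- by apply: emeasurable_funM; exact/measurable_EFinP.
- by move=> x _; rewrite -EFinM lee_fin mulr_ge0.
Qed.

Lemma ge0_integral_density (f : T -> \bar R) :
  measurable_fun setT f -> (forall x, 0 <= f x)%E ->
  (\int[m1]_x f x = \int[m2]_x (f x * (p x)%:E))%E.
Proof.
move=> mf f0.
pose f_ := nnsfun_approx measurableT mf.
have nd x : {homo (fun n => (f_ n x)%:E) : a b / (a <= b)%N >-> (a <= b)%E}.
  by move=> a b ab; rewrite lee_fin; exact/lefP/nd_nnsfun_approx.
have cf x : (f_ n x)%:E @[n --> \oo] --> f x by exact: cvg_nnsfun_approx.
transitivity (limn (fun n => \int[m1]_x (f_ n x)%:E))%E.
  rewrite -monotone_convergence//=.
  - by apply: eq_integral => x _; exact/esym/cvg_lim.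
  - by move=> n; exact/measurable_EFinP/measurable_funTS.
  - by move=> n x _; rewrite lee_fin.
transitivity (limn (fun n => \int[m2]_x ((f_ n x)%:E * (p x)%:E)))%E.
  by congr (limn _); apply/funext => n; exact: nnsfun_density.
rewrite -monotone_convergence//=.
- apply: eq_integral => x _; apply/cvg_lim => //.
  apply: cvgeZr => //; exact: cf.
- by move=> n; apply: emeasurable_funM; exact/measurable_EFinP.
- by move=> n x _; rewrite -EFinM lee_fin mulr_ge0.
- by move=> x _ a b ab; apply: lee_wpmul2r; [rewrite lee_fin|exact: nd].
Qed.

Lemma integral_density (f : T -> R) : measurable_fun setT f ->
  (\int[m1]_x (f x)%:E = \int[m2]_x (f x * p x)%:E)%E.
Proof.
move=> mf; rewrite integralE [RHS]integralE; congr (_ - _)%E.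
- rewrite ge0_integral_density//; last exact/measurable_funepos/measurable_EFinP.
  apply: eq_integral => x _; rewrite !funeposE -!EFin_max -EFinM; congr (_%:E).
  by rewrite maxr_pMl// mul0r.
- rewrite ge0_integral_density//; last exact/measurable_funeneg/measurable_EFinP.
  apply: eq_integral => x _; rewrite !funenegE -!EFinN -!EFin_max -EFinM; congr (_%:E).
  by rewrite maxr_pMl// mul0r mulNr.
Qed.

Lemma integrable_density (f : T -> R) : measurable_fun setT f ->
  m2.-integrable setT (EFin \o (fun x => f x * p x)) -> m1.-integrable setT (EFin \o f).
Proof.
move=> mf /integrableP[_ fi]; apply/integrableP; split; first exact/measurable_EFinP.
have -> : (\int[m1]_x `|(EFin \o f) x| = \int[m1]_x (`|f x|%:E))%E by [].
rewrite integral_density; last exact: measurableT_comp.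
rewrite (_ : (\int[m2]_x _)%E = (\int[m2]_x `|(EFin \o (fun x => f x * p x)%R) x|)%E)//.
by apply: eq_integral => x _; rewrite /= normrM (ger0_norm (p0 x)).
Qed.

End Density.

Section ImproperFTC.
Context (R : realType).
Notation mu := lebesgue_measure.

(** The segments exhaust [D] and [|g|] dominates the truncated integrands, so the integral over [D]
    is the limit of the boundary differences. *)
Lemma improper_FTC2 (D : set R) (g F : R -> R) (a b : nat -> R) (l : R) :
  measurable D -> mu.-integrable D (EFin \o g) -> continuous g ->
  (forall x : R, is_derive x (1 : R) F (g x)) ->
  (forall n, a n < b n) -> (forall n, `[a n, b n]%classic `<=` D) ->
  (forall x, D x -> \forall n \near \oo, a n <= x <= b n) ->
  F (b n) - F (a n) @[n --> \oo] --> l ->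
  \int[mu]_(x in D) g x = l.
Proof.
move=> mD ig cg dF ab abD near_ab Fl.
have cF x : {for x, continuous F}.
  by apply: differentiable_continuous; apply/derivable1_diffP; case: (dF x).
have FTC n : \int[mu]_(x in `[a n, b n]) g x = F (b n) - F (a n).
  rewrite /Rintegral (@continuous_FTC2 _ g F)//.
  - by apply: continuous_subspaceT.
  - split.
    + by move=> x _; case: (dF x).
    + by apply: cvg_at_right_filter; exact: cF.
    + by apply: cvg_at_left_filter; exact: cF.
  - by move=> x _; rewrite derive1E; apply: derive_val.
have : \int[mu]_(x in `[a n, b n]) g x @[n --> \oo] --> \int[mu]_(x in D) g x.
  have e n : \int[mu]_(x in `[a n, b n]) g x = \int[mu]_(x in D) (g x * \1_(`[a n, b n]%classic) x).
    rewrite Rintegral_mkcond [RHS]Rintegral_mkcond; apply: eq_Rintegral => x _.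
    rewrite !patchE indicE.
    have [xab|xab] := boolP (x \in `[a n, b n]%classic).
      by rewrite (mem_set (abD _ _ (set_mem xab))) mulr1.
    by case: ifP => // _; rewrite mulr0.
  under eq_fun do rewrite e.
  have mind n : measurable_fun D (\1_(`[a n, b n]%classic) : R -> R).
    by apply: measurable_funTS; exact: measurable_indic.
  have mg : measurable_fun D g by apply: measurable_funTS; exact: continuous_measurable_fun.
  have [|||||i _ c] := @dominated_convergence _ _ _ mu D mD
    (fun n => EFin \o (fun x => g x * \1_(`[a n, b n]%classic) x)) (EFin \o g) (EFin \o (fun x => `|g x|)).
  - by move=> n; apply/measurable_EFinP; exact: measurable_funM.
  - exact/measurable_EFinP.
  - apply: aeW => x Dx; apply: cvg_EFin; first exact: nearW.
    apply: cvg_near_cst; near=> n => /=; rewrite indicE mem_set ?mulr1//=.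
    by rewrite in_itv/=; near: n; exact: near_ab.
  - exact: integrable_norm.
  - apply: aeW => x n Dx /=; rewrite lee_fin normrM indicE.
    by case: (_ \in _); rewrite ?normr1 ?normr0 ?mulr1 ?mulr0.
  - by apply: fine_cvg; rewrite fineK ?integrable_fin_num.
under eq_fun do rewrite FTC.
by move=> /cvg_unique/(_ Fl) ->.
Unshelve. all: by end_near. Qed.

End ImproperFTC.

(** * The standard exponential and normal laws and their moments *)

Section StandardLaws.
Context (R : realType).
Notation mu := lebesgue_measure.

Let expo : probability (measurableTypeR R) R :=
  exponential_distribution_exponential_prob__canonical__probability_measure_Probability
    (@ltr01 R).

Let norm : probability (measurableTypeR R) R := normal_prob 0 1.

(* The library puts these laws on [measurableTypeR R]; we move them to [R]
   itself, which carries the same sigma-algebra. *)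
Definition to_real : measurableTypeR R -> R := idfun.

Let measurable_to_real : measurable_fun setT to_real.
Proof. by move=> mT Y mY; rewrite setTI. Qed.

HB.instance Definition _ :=
  isMeasurableFun.Build _ _ _ _ to_real measurable_to_real.

Definition std_exponential : probability R R := distribution expo to_real.

Definition std_normal : probability R R := distribution norm to_real.

Lemma std_exponentialE A : std_exponential A = exponential_prob 1 A.
Proof. by []. Qed.

Lemma mean_std_exponential (f : R -> R) : measurable_fun setT f ->
  \int[std_exponential]_x f x = \int[mu]_(x in `[0, +oo[) (f x * expR (- x)).
Proof.
move=> mf; rewrite Rintegral_distribution// /Rintegral.
rewrite (@integral_density _ _ _ expo mu (exponential_pdf 1))//.
- rewrite [in RHS]integral_mkcond; congr fine; apply: eq_integral => x _.
  rewrite /exponential_pdf !patchE; case: ifP => _; last by rewrite mulr0.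
  by rewrite /= mul1r mulN1r.
- exact: measurable_exponential_pdf.
- by move=> x; exact: exponential_pdf_ge0.
Qed.

Lemma mean_std_normal (f : R -> R) : measurable_fun setT f ->
  \int[std_normal]_x f x = \int[mu]_x (f x * normal_pdf 0 1 x).
Proof.
move=> mf; rewrite Rintegral_distribution// /Rintegral.
rewrite (@integral_density _ _ _ norm mu (normal_pdf 0 1))//.
- exact: measurable_normal_pdf.
- by move=> x; exact: normal_pdf_ge0.
Qed.

(** Cubic growth, which third absolute moments involve, costs only half of the exponential decay:
    cube [1 + x <= 6 exp(x/6)]. *)
Let exp_cube : exists2 c : R, 0 <= c & forall x, 0 <= x -> (1 + x) ^+ 3 <= c * expR (x / 2).
Proof.
exists (6 ^+ 3) => [|x x0]; first exact: exprn_ge0.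
have h : 1 + x <= 6 * expR (x / 6).
  by have := expR_ge1Dx (x / 6); lra.
have -> : 6 ^+ 3 * expR (x / 2) = (6 * expR (x / 6)) ^+ 3.
  by rewrite exprMn -expRM_natl; congr (_ * expR _); field.
by rewrite lerXn2r// nnegrE; [rewrite addr_ge0|rewrite mulr_ge0 ?expR_ge0].
Qed.

Lemma integrable_exponential_density (f : R -> R) K : measurable_fun setT f ->
  (forall x, 0 <= x -> `|f x| <= K * (1 + x) ^+ 3) ->
  mu.-integrable setT (EFin \o (fun x => f x * exponential_pdf 1 x)).
Proof.
move=> mf fK.
have K0 : 0 <= K by have := fK 0 (lexx 0); rewrite addr0 expr1n mulr1; exact: le_trans.
have h2 : 0 < 2^-1 :> R by rewrite invr_gt0.
have [c c0 cube] := exp_cube.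
have Kc0 : 0 <= K * c * 2 by apply: mulr_ge0 => //; exact: mulr_ge0.
(* The majorant is the exponential density of rate 1/2; the factor 2 cancels its normalisation. *)
apply: (@le_integrable _ _ _ mu _ measurableT _
  (EFin \o (fun x => (K * c * 2) * exponential_pdf 2^-1 x))).
- by apply/measurable_EFinP/measurable_funM => //; exact: measurable_exponential_pdf.
- move=> x _ /=; rewrite lee_fin normrM (ger0_norm (exponential_pdf_ge0 _ _))//.
  rewrite [leRHS]ger0_norm; last first.
    by apply: mulr_ge0 => //; apply: exponential_pdf_ge0; exact: ltW.
  have [x0|x0] := ltP x 0; first by rewrite !lt0_exponential_pdf// !mulr0.
  rewrite !exponential_pdfE// mul1r mulN1r.
  have -> : expR (- 2^-1 * x) = expR (x / 2) * expR (- x).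
    by rewrite -expRD; congr expR; field.
  rewrite (_ : K * c * 2 * _ = K * (c * expR (x / 2)) * expR (- x)); last by field.
  rewrite ler_wpM2r ?expR_ge0// (le_trans (fK x x0))// ler_wpM2l//.
  exact: cube.
- have -> : EFin \o (fun x => K * c * 2 * exponential_pdf 2^-1 x) =
    (fun x => (K * c * 2)%:E * (exponential_pdf 2^-1 x)%:E)%E by [].
  by apply: integrableZl => //; exact: integrable_exponential_pdf.
Qed.

Lemma integrable_normal_density (f : R -> R) K : measurable_fun setT f ->
  (forall x, `|f x| <= K * (1 + `|x|) ^+ 3) ->
  mu.-integrable setT (EFin \o (fun x => f x * normal_pdf 0 1 x)).
Proof.
move=> mf fK.
have K0 : 0 <= K by have := fK 0; rewrite normr0 addr0 expr1n mulr1; exact: le_trans.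
pose r := Num.sqrt 2 : R; have r0 : r != 0 by rewrite gt_eqF// sqrtr_gt0.
have r2 : r ^+ 2 = 2 by rewrite sqr_sqrtr.
have [c c0 cube] := exp_cube.
(* The majorant is the normal density of variance 2, since [|x|/2 - x^2/2 <= 1 - x^2/4]; this costs
   the factor [expR 1] and the ratio of the peaks. *)
pose C := K * (c * expR 1) * (normal_peak 1 / normal_peak r).
have C0 : 0 <= C.
  apply: mulr_ge0; last by apply: divr_ge0; exact: normal_peak_ge0.
  by apply: mulr_ge0 => //; apply: mulr_ge0 => //; exact: expR_ge0.
apply: (@le_integrable _ _ _ mu _ measurableT _
  (EFin \o (fun x => C * normal_pdf 0 r x))).
- by apply/measurable_EFinP/measurable_funM => //; exact: measurable_normal_pdf.
- move=> x _ /=; rewrite lee_fin normrM (ger0_norm (normal_pdf_ge0 _ _ _)).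
  rewrite [leRHS]ger0_norm; last by apply: mulr_ge0 => //; exact: normal_pdf_ge0.
  rewrite !normal_pdfE ?oner_eq0// /normal_fun !subr0 r2 expr1n /C.
  rewrite (_ : K * _ * _ * _ = K * (c * (expR 1 * expR (- x ^+ 2 / (2 *+ 2)))) * normal_peak 1); last first.
    by field; rewrite gt_eqF// normal_peak_gt0.
  rewrite [X in _ * X <= _]mulrC [leLHS]mulrA; apply: ler_wpM2r; first exact: normal_peak_ge0.
  rewrite (le_trans (ler_wpM2r (expR_ge0 _) (fK x)))// -mulrA ler_wpM2l//.
  rewrite (le_trans (ler_wpM2r (expR_ge0 _) (cube _ (normr_ge0 x))))//.
  rewrite -mulrA ler_wpM2l// -!expRD ler_expR.
  have -> : x ^+ 2 = `|x| ^+ 2 by rewrite real_normK ?num_real.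
  have := sqr_ge0 (`|x| - 1); move: `|x| => y.
  rewrite (_ : (2 *+ 2 : R) = 4); last by rewrite -mulr_natr -natrM.
  by rewrite (_ : (1 *+ 2 : R) = 2)// => h; nra.
- have -> : EFin \o (fun x => C * normal_pdf 0 r x) =
    (fun x => C%:E * (normal_pdf 0 r x)%:E)%E by [].
  by apply: integrableZl => //; exact: integrable_normal_pdf.
Qed.

Lemma integrable_std_exponential (f : R -> R) K : measurable_fun setT f ->
  (forall x, 0 <= x -> `|f x| <= K * (1 + x) ^+ 3) ->
  std_exponential.-integrable setT (EFin \o f).
Proof.
move=> mf fK; apply: integrable_distribution => //.
apply: (@integrable_density _ _ _ expo mu (exponential_pdf 1)) => //.
- exact: measurable_exponential_pdf.
- by move=> x; exact: exponential_pdf_ge0.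
- exact: integrable_exponential_density fK.
Qed.

Lemma integrable_std_normal (f : R -> R) K : measurable_fun setT f ->
  (forall x, `|f x| <= K * (1 + `|x|) ^+ 3) ->
  std_normal.-integrable setT (EFin \o f).
Proof.
move=> mf fK; apply: integrable_distribution => //.
apply: (@integrable_density _ _ _ norm mu (normal_pdf 0 1)) => //.
- exact: measurable_normal_pdf.
- by move=> x; exact: normal_pdf_ge0.
- exact: integrable_normal_density fK.
Qed.

Lemma std_exponential_FTC (f F : R -> R) K : continuous f ->
  (forall x, 0 <= x -> `|f x| <= K * (1 + x) ^+ 3) ->
  (forall x : R, is_derive x (1 : R) F (f x * expR (- x))) ->
  F n.+1%:R @[n --> \oo] --> (0 : R) ->
  \int[std_exponential]_x f x = - F 0.
Proof.
move=> cf fK dF F0; have mf := continuous_measurable_fun cf.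
rewrite mean_std_exponential//.
have i1 := integrable_exponential_density mf fK.
apply: (@improper_FTC2 _ `[0, +oo[%classic _ F (fun=> 0) (fun n => n.+1%:R)) => //.
- have i2 := @integrableS _ _ _ mu _ _ _ measurableT (measurable_itv `[(0:R), +oo[) (@subsetT _ _) i1.
  apply: eq_integrable i2 => // x; rewrite inE/= in_itv/= andbT => x0.
  by rewrite exponential_pdfE// mul1r mulN1r.
- move=> x; apply: cvgM; first exact: cf.
  apply: (@continuous_comp _ _ _ (fun x : R => - x) expR); first exact: opp_continuous.
  exact: continuous_expR.
- by move=> n x /=; rewrite !in_itv/= => /andP[->].
- move=> x /=; rewrite in_itv/= andbT => x0; near=> n; rewrite x0/=.
  by rewrite (@le_trans _ _ n%:R) ?ler_nat//; near: n; exact: nbhs_infty_ger.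
- by rewrite -[X in _ --> X]add0r; apply: cvgB => //; exact: cvg_cst.
Unshelve. all: by end_near. Qed.

(** Moments are expressed by vanishing integrals, of [x] and [x^2 - 1], so only the boundary values
    matter and the normalising constant is never evaluated. *)
Lemma std_normal_FTC (f F : R -> R) K : continuous f ->
  (forall x, `|f x| <= K * (1 + `|x|) ^+ 3) ->
  (forall x : R, is_derive x (1 : R) F (f x * normal_pdf 0 1 x)) ->
  F n.+1%:R - F (- n.+1%:R) @[n --> \oo] --> (0 : R) ->
  \int[std_normal]_x f x = 0.
Proof.
move=> cf fK dF F0; have mf := continuous_measurable_fun cf.
rewrite mean_std_normal//.
have i1 := integrable_normal_density mf fK.
apply: (@improper_FTC2 _ setT _ F (fun n => - n.+1%:R) (fun n => n.+1%:R)) => //.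
- move=> x; apply: cvgM; first exact: cf.
  exact: continuous_normal_pdf.
- by move=> n; apply: (@lt_trans _ _ 0); rewrite ?oppr_lt0 ltr0n.
- move=> x _; near=> n; rewrite -ler_norml.
  by rewrite (@le_trans _ _ n%:R) ?ler_nat//; near: n; exact: nbhs_infty_ger.
Unshelve. all: by end_near. Qed.

Lemma cvg_poly_exp (F : R -> R) c : (forall x, 0 <= x -> `|F x| <= c * (1 + x) ^+ 2 * expR (- x)) ->
  F n.+1%:R @[n --> \oo] --> (0 : R).
Proof.
move=> Fc; have [k k0 cube] := exp_cube.
have c0 : 0 <= c.
  have := Fc 0 (lexx _); rewrite addr0 expr1n mulr1 oppr0 expR0 mulr1.
  exact: le_trans.
apply: (@cvg0_dom _ _ (fun n => c * k * 2 * harmonic n)).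
- move=> n; rewrite (le_trans (Fc _ (ler0n _ _)))//.
  set x : R := n.+1%:R; have x1 : 1 <= x by rewrite ler1n.
  have x0 : 0 < x by exact: lt_le_trans x1.
  rewrite /harmonic/= -/x -!mulrA ler_wpM2l//.
  have h : (1 + x) ^+ 2 * expR (- x) * x <= k * 2.
    have h1 : expR (x / 2) >= 0 by exact: expR_ge0.
    have h2 : expR (x / 2) * expR (- x) <= 1 by rewrite -expRD -[leRHS]expR0 ler_expR; lra.
    have h3 := cube x (ltW x0); have h4 := expR_ge0 (- x).
    have h5 : (1 + x) ^+ 2 * x <= (1 + x) ^+ 3.
      by rewrite [leRHS]exprSr ler_wpM2l ?sqr_ge0//; lra.
    rewrite mulrAC (le_trans (ler_wpM2r h4 (le_trans h5 h3)))// -mulrA.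
    by rewrite ler_wpM2l//; lra.
  by rewrite (_ : (1 + x) * _ = (1 + x) ^+ 2 * expR (- x)) ?mulrA ?ler_pdivlMr//; ring.
- rewrite -(mulr0 (c * k * 2)); apply: cvgM; [exact: cvg_cst|exact: cvg_harmonic].
Qed.

Lemma std_exponential_mean : \int[std_exponential]_x (x - 1) = 0.
Proof.
have dF (x : R) : is_derive x (1 : R) (fun x : R => - (x * expR (- x))) ((x - 1) * expR (- x)).
  by apply: is_derive_eq; rewrite /GRing.scale/=; ring.
have := @std_exponential_FTC (fun x => x - 1) _ 1 _ _ dF.
rewrite mul0r !oppr0; apply.
- by move=> x; apply: cvgB; [exact: cvg_id|exact: cvg_cst].
- by move=> x x0; rewrite mul1r ler_norml; apply/andP; split; nra.
- apply: (@cvg_poly_exp (fun x => - (x * expR (- x))) 1) => x x0.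
  rewrite normrN normrM !ger0_norm ?expR_ge0//.
  by rewrite mul1r ler_wpM2r ?expR_ge0//; nra.
Qed.

Lemma std_exponential_variance : \int[std_exponential]_x ((x - 1) ^+ 2 - 1) = 0.
Proof.
have dF (x : R) : is_derive x (1 : R) (fun x : R => - (x ^+ 2 * expR (- x)))
    (((x - 1) ^+ 2 - 1) * expR (- x)).
  by apply: is_derive_eq; rewrite /GRing.scale/=; ring.
have := @std_exponential_FTC (fun x => (x - 1) ^+ 2 - 1) _ 1 _ _ dF.
rewrite expr0n mul0r !oppr0; apply.
- move=> x; apply: cvgB; [|exact: cvg_cst].
  apply: (@continuous_comp _ _ _ (fun x : R => x - 1) (fun x => x ^+ 2)).
    by apply: cvgB; [exact: cvg_id|exact: cvg_cst].
  exact: exprn_continuous.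
- by move=> x x0; rewrite mul1r ler_norml; apply/andP; split; nra.
- apply: (@cvg_poly_exp (fun x => - (x ^+ 2 * expR (- x))) 1) => x x0.
  rewrite normrN normrM !ger0_norm ?expR_ge0// ?sqr_ge0//.
  by rewrite mul1r ler_wpM2r ?expR_ge0//; nra.
Qed.

Let pdfE x : normal_pdf 0 1 x = normal_peak 1 * expR (- (x ^+ 2 / 2)) :> R.
Proof. by rewrite normal_pdfE ?oner_eq0// /normal_fun subr0 expr1n mulNr. Qed.

Lemma std_normal_mean : \int[std_normal]_x x = 0.
Proof.
have dF (x : R) : is_derive x (1 : R) (fun x : R => - (normal_peak 1 * expR (- (x ^+ 2 / 2))))
    (x * normal_pdf 0 1 x).
  by apply: is_derive_eq; rewrite pdfE /GRing.scale/=; field.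
apply: (@std_normal_FTC id _ 1 _ _ dF).
- by move=> x; exact: cvg_id.
- by move=> x; have := normr_ge0 x; move: `|x| => y y0 /=; rewrite mul1r; nra.
- by apply: cvg_near_cst; apply: nearW => n; rewrite sqrrN subrr.
Qed.

Lemma std_normal_variance : \int[std_normal]_x (x ^+ 2 - 1) = 0.
Proof.
have dF (x : R) : is_derive x (1 : R) (fun x : R => - (x * (normal_peak 1 * expR (- (x ^+ 2 / 2)))))
    ((x ^+ 2 - 1) * normal_pdf 0 1 x).
  by apply: is_derive_eq; rewrite pdfE /GRing.scale/=; field.
apply: (@std_normal_FTC (fun x => x ^+ 2 - 1) _ 1 _ _ dF).
- by move=> x; apply: cvgB; [exact: exprn_continuous|exact: cvg_cst].
- move=> x; rewrite mul1r -(@real_normK _ x) ?num_real//; have := normr_ge0 x; move: `|x| => y y0 /=.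
  by rewrite ler_norml; apply/andP; split; nra.
- apply: (@cvg0_dom _ _ (fun n => normal_peak 1 * 4 * harmonic n)).
  + move=> n; rewrite sqrrN.
    set x : R := n.+1%:R; have x0 : 0 < x by rewrite ltr0n.
    have p0 : 0 <= normal_peak (1:R) by exact: normal_peak_ge0.
    rewrite /harmonic/= -/x (_ : _ - _ = - (normal_peak 1 * (2 * (x * expR (- (x ^+ 2 / 2)))))); last by field.
    rewrite normrN ger0_norm; last by rewrite !mulr_ge0 ?expR_ge0 ?(ltW x0).
    rewrite -mulrA ler_wpM2l// ler_pdivlMr// expRN.
    have := expR_ge1Dx (x ^+ 2 / 2); have e0 := expR_gt0 (x ^+ 2 / 2).
    rewrite (_ : _ * x = 2 * x ^+ 2 / expR (x ^+ 2 / 2)); last by field; rewrite gt_eqF.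
    by rewrite ler_pdivrMr//; lra.
  + rewrite -(mulr0 (normal_peak 1 * 4)); apply: cvgM; [exact: cvg_cst|exact: cvg_harmonic].
Qed.

End StandardLaws.

(** * Smoothing operators and the one-summand Lindeberg estimate *)

Section ParametricMean.
Context (R : realType) d (T : measurableType d) (P : probability T R).

Lemma continuous_mean (f : R -> T -> R) M :
  (forall l, measurable_fun setT (f l)) -> (forall l y, `|f l y| <= M) ->
  (forall y, continuous (f^~ y)) -> continuous (fun l => \int[P]_y f l y).
Proof.
move=> mf fM cf x.
apply: (@continuity_under_integral _ _ _ P f setT measurableT (x - 1) (x + 1) _ _ (fun=> M)).
- by move=> l _; apply: bmeas_integrable; split => //; exists M.
- by apply: aeW => y _ l _; exact: cf.
- exact: bmeas_integrable (bmeas_cst _ M).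
- by move=> l _; apply: aeW => y _.
- by rewrite inE/= in_itv/= ltrBlDr ltrDl ltr01.
Qed.
End ParametricMean.

Lemma continuous_sqrt_norm (R : realType) : continuous (fun t : R => Num.sqrt `|t|).
Proof.
move=> t; apply: (@continuous_comp _ _ _ (fun t : R => `|t|) Num.sqrt); first exact: norm_continuous.
exact: sqrt_continuous.
Qed.

Section Smoothing.
Context (R : realType) (m : probability R R).
Implicit Types (c x : R) (f : R -> R).

(** The operator of adding one independent summand [c Z], with [Z] of law [m]; its iterates add
    independent copies. *)
Definition smooth c f x : R := \int[m]_z f (x + c * z).

Let measurable_shift c x : measurable_fun setT (fun z : R => x + c * z).
Proof. by apply: measurable_funD => //; exact: measurable_funM. Qed.

Lemma bmeas_shift c x f : bmeas f -> bmeas (fun z => f (x + c * z)).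
Proof. exact: bmeas_comp. Qed.

Lemma smooth_norm_le c f M : bmeas f -> (forall x, `|f x| <= M) ->
  forall x, `|smooth c f x| <= M.
Proof. by move=> bf fM x; apply: norm_mean_le => //; exact: bmeas_shift. Qed.

Lemma bmeas_smooth c f : bmeas f -> bmeas (smooth c f).
Proof.
move=> bf; apply: (@bmeas_mean1 _ _ _ _ _ m m (fun p : R * R => f (p.1 + c * p.2))).
apply: (@bmeas_comp _ _ _ _ _ (fun p : R * R => p.1 + c * p.2)) => //.
by apply: measurable_funD => //; exact: measurable_funM.
Qed.

Lemma continuous_smooth c f M : continuous f -> (forall x, `|f x| <= M) ->
  continuous (smooth c f).
Proof.
move=> cf fM; apply: (@continuous_mean _ _ _ m (fun x z => f (x + c * z)) M) => //.
- move=> x; apply: measurableT_comp; last exact: measurable_shift.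
  exact: continuous_measurable_fun.
- move=> z x; apply: (@continuous_comp _ _ _ (fun x => x + c * z) f); last exact: cf.
  by apply: cvgD; [exact: cvg_id|exact: cvg_cst].
Qed.

Lemma smooth_dist c f g e : bmeas f -> bmeas g -> (forall x, `|f x - g x| <= e) ->
  forall x, `|smooth c f x - smooth c g x| <= e.
Proof. by move=> bf bg fg x; apply: mean_dist => //; exact: bmeas_shift. Qed.

Lemma smooth0 f x : smooth 0 f x = f x.
Proof.
by rewrite /smooth; under eq_Rintegral do rewrite mul0r addr0; rewrite mean_cst.
Qed.

Lemma smoothZ c a f x : bmeas f -> smooth c (fun y => a * f y) x = a * smooth c f x.
Proof. by move=> bf; rewrite /smooth meanZ//; exact: bmeas_shift. Qed.

End Smoothing.

Lemma smoothC (R : realType) (m1 m2 : probability R R) c1 c2 (f : R -> R) x :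
  bmeas f -> smooth m1 c1 (smooth m2 c2 f) x = smooth m2 c2 (smooth m1 c1 f) x.
Proof.
move=> bf; rewrite /smooth.
rewrite (@mean_swap _ _ _ _ _ m1 m2 (fun p : R * R => f (x + c1 * p.1 + c2 * p.2))); last first.
  apply: (@bmeas_comp _ _ _ _ _ (fun p : R * R => x + c1 * p.1 + c2 * p.2)) => //.
  by apply: measurable_funD => //; [apply: measurable_funD => //|]; exact: measurable_funM.
by apply: eq_Rintegral => z _; apply: eq_Rintegral => w _; rewrite addrAC.
Qed.

Section Taylor.
Context (R : realType).

(** The first derivative stays existential because it disappears once the summand is centred; the
    second one is what the two laws must share. *)
Definition cubic_taylor (C : R) (f f2 : R -> R) := exists f1 : R -> R,
  forall x h, `|f (x + h) - f x - h * f1 x - h ^+ 2 / 2 * f2 x| <= C * `|h| ^+ 3.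

(** The Taylor remainder is integrated: the centring kills the linear term, the unit variance turns
    the quadratic term into [c^2/2 f2], and the third absolute moment bounds what is left. *)
Lemma lindeberg_step (m : probability R R) K (C c : R) f f2 x : bmeas f -> 0 <= c ->
  m.-integrable setT (fun z => (`|z| ^+ 3)%:E) ->
  \int[m]_z z = 0 -> \int[m]_z (z ^+ 2 - 1) = 0 -> \int[m]_z `|z| ^+ 3 <= K ->
  0 <= C -> cubic_taylor C f f2 ->
  `|smooth m c f x - f x - c ^+ 2 / 2 * f2 x| <= C * K * c ^+ 3.
Proof.
move=> bf c0 i3 m1 m2 m3 C0 [f1 tf].
have mX n : measurable_fun setT (fun z : R => z ^+ n) by exact: measurable_funX.
have dom (g : R -> R) k : measurable_fun setT g ->
    (forall z, `|g z| <= k * (1 + `|z| ^+ 3)) -> m.-integrable setT (EFin \o g).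
  move=> mg gk; apply: (@le_integrable _ _ _ m _ measurableT _
      (EFin \o (fun z => k * (1 + `|z| ^+ 3)))).
  - exact/measurable_EFinP.
  - by move=> z _ /=; rewrite lee_fin (le_trans (gk z))// ler_norm.
  - have i13 : m.-integrable setT (EFin \o (fun z : R => 1 + `|z| ^+ 3)); last first.
      by apply: (integrableZl measurableT k i13).
    apply: (@integrableD _ _ _ m _ measurableT (EFin \o (fun _ : R => 1 : R)) (EFin \o (fun z : R => `|z| ^+ 3))) => //.
    exact: finite_measure_integrable_cst.
have cube1 (y : R) : 0 <= y -> y <= 1 + y ^+ 3 /\ y ^+ 2 <= 1 + y ^+ 3.
  move=> y0; have := sqr_ge0 (y - 1); rewrite (exprS y 2) => h; split; nra.
have i1 : m.-integrable setT (EFin \o (fun z : R => z)).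
  by apply: (dom _ 1) => // z; rewrite mul1r; exact: (cube1 _ (normr_ge0 z)).1.
have i2 : m.-integrable setT (EFin \o (fun z : R => z ^+ 2 - 1)).
  apply: (dom _ 2); first by apply: measurable_funB.
  move=> z; rewrite (le_trans (ler_normB _ _))// normrX normr1.
  have := (cube1 _ (normr_ge0 z)).2; have := exprn_ge0 3 (normr_ge0 z); lra.
pose r z := f (x + c * z) - f x - c * z * f1 x - (c * z) ^+ 2 / 2 * f2 x.
have ir : m.-integrable setT (EFin \o r).
  apply: (dom _ (C * c ^+ 3)).
    have mc : measurable_fun setT (fun z : R => c * z) by exact: measurable_funM.
    apply: measurable_funB; last first.
      by apply: measurable_funM => //; apply: measurable_funM => //; exact: measurable_funX.
    apply: measurable_funB; last exact: measurable_funM.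
    apply: measurable_funB => //; by case: (bmeas_shift c x bf).
  move=> z; rewrite (le_trans (tf x (c * z)))// normrM (ger0_norm c0) exprMn mulrA.
  by rewrite ler_wpM2l ?lerDr// mulr_ge0// exprn_ge0.
have -> : smooth m c f x - f x - c ^+ 2 / 2 * f2 x = \int[m]_z r z.
  have ib : m.-integrable setT (EFin \o (fun z => f (x + c * z) - f x)).
    by apply/bmeas_integrable/bmeasB; [exact: bmeas_shift|exact: bmeas_cst].
  have E : r = (fun z => (f (x + c * z) - f x - c ^+ 2 / 2 * f2 x) -
     ((c * f1 x) * z + (c ^+ 2 / 2 * f2 x) * (z ^+ 2 - 1))).
    by apply/funext => z; rewrite /r; ring.
  have i12 : m.-integrable setT (EFin \o (fun z => (c * f1 x) * z + (c ^+ 2 / 2 * f2 x) * (z ^+ 2 - 1))).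
    apply: (@integrableD _ _ _ m _ measurableT (EFin \o (fun z => (c * f1 x) * z))
       (EFin \o (fun z => (c ^+ 2 / 2 * f2 x) * (z ^+ 2 - 1)))).
      by apply: (integrableZl measurableT (c * f1 x) i1).
    by apply: (integrableZl measurableT (c ^+ 2 / 2 * f2 x) i2).
  have bs : bmeas (fun z => f (x + c * z) - f x) by apply: bmeasB; [exact: bmeas_shift|exact: bmeas_cst].
  rewrite E RintegralB//; last first.
    by apply/bmeas_integrable/bmeasB => //; exact: bmeas_cst.
  have -> : \int[m]_z ((c * f1 x) * z + (c ^+ 2 / 2 * f2 x) * (z ^+ 2 - 1)) = 0.
    rewrite RintegralD//; last 2 first.
      by apply: (integrableZl measurableT (c * f1 x) i1).
      by apply: (integrableZl measurableT (c ^+ 2 / 2 * f2 x) i2).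
    by rewrite RintegralZl// RintegralZl// m1 m2 !mulr0 addr0.
  rewrite subr0.
  rewrite meanB//; last exact: bmeas_cst.
  rewrite meanB//; [|exact: bmeas_shift|exact: bmeas_cst].
  by rewrite !mean_cst.
rewrite (le_trans (le_normr_Rintegral _ ir))//.
have -> : C * K * c ^+ 3 = C * c ^+ 3 * K by ring.
apply: (@le_trans _ _ (C * c ^+ 3 * \int[m]_z `|z| ^+ 3)); last first.
  by rewrite ler_wpM2l// mulr_ge0// exprn_ge0.
rewrite -RintegralZl//; apply: le_Rintegral => //.
- exact: integrable_norm.
- by apply: (integrableZl measurableT (C * c ^+ 3) i3).
- move=> z _; rewrite (le_trans (tf x (c * z)))// normrM (ger0_norm c0) exprMn.
  by rewrite mulrA.
Qed.

End Taylor.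

Section CentredLaws.
Context (R : realType).

Definition minus_one (x : R) : R := x - 1.

Let measurable_minus_one : measurable_fun setT minus_one.
Proof. exact: measurable_funB. Qed.

HB.instance Definition _ :=
  isMeasurableFun.Build _ _ _ _ minus_one measurable_minus_one.

Definition centred_exponential : probability R R :=
  distribution (std_exponential R) minus_one.

Let measurable_abs3 : measurable_fun setT (fun z : R => `|z| ^+ 3).
Proof. by apply: measurable_funX; apply: (@measurableT_comp _ _ _ _ _ _ (@Num.norm R R)). Qed.

Lemma integrable_centred_exponential3 :
  centred_exponential.-integrable setT (fun z => (`|z| ^+ 3)%:E).
Proof.
apply: (@integrable_distribution _ _ _ _ _ (std_exponential R) minus_one (fun z => `|z| ^+ 3)).
  exact: measurable_abs3.
apply: (@integrable_std_exponential _ (fun z => `|minus_one z| ^+ 3) 1).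
  by apply: (@measurableT_comp _ _ _ _ _ _ (fun z : R => `|z| ^+ 3)).
move=> x x0 /=; rewrite mul1r ger0_norm ?exprn_ge0// lerXn2r ?nnegrE ?addr_ge0//.
by rewrite /minus_one ler_norml; lra.
Qed.

Lemma centred_exponential_mean : \int[centred_exponential]_z z = 0.
Proof.
rewrite (@Rintegral_distribution _ _ _ _ _ (std_exponential R) minus_one (fun z => z))//.
exact: std_exponential_mean.
Qed.

Lemma centred_exponential_variance : \int[centred_exponential]_z (z ^+ 2 - 1) = 0.
Proof.
rewrite (@Rintegral_distribution _ _ _ _ _ (std_exponential R) minus_one (fun z => z ^+ 2 - 1)).
  exact: std_exponential_variance.
by apply: measurable_funB => //; exact: measurable_funX.
Qed.

Lemma integrable_std_normal3 : (std_normal R).-integrable setT (fun z => (`|z| ^+ 3)%:E).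
Proof.
apply: (@integrable_std_normal _ (fun z => `|z| ^+ 3) 1); first exact: measurable_abs3.
by move=> x; rewrite mul1r ger0_norm ?exprn_ge0// lerXn2r ?nnegrE ?addr_ge0// lerDr.
Qed.

End CentredLaws.

(** * The Gaussian semigroup *)

Section GaussianSemigroup.
Context (R : realType).
Notation mu := lebesgue_measure.
Implicit Types (s t x y : R) (f : R -> R).

(** The heat operator, indexed by the variance rather than the standard deviation so that the
    parameters add. *)
Definition gauss t f : R -> R := smooth (std_normal R) (Num.sqrt t) f.

Let Rintegral_ereal (g h : measurableTypeR R -> R) :
  (\int[mu]_y (g y)%:E = \int[mu]_y (h y)%:E)%E -> \int[mu]_y g y = \int[mu]_y h y.
Proof. by rewrite /Rintegral => ->. Qed.

Lemma affine_substitution (c b : R) (G : R -> R) : 0 < c -> continuous G ->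
  (forall x, 0 <= G x) ->
  (\int[mu]_x (G x)%:E = \int[mu]_x (G (c * x + b) * c)%:E)%E.
Proof.
move=> c0 cG G0; pose F (x : R) := c * x + b.
have dF (x : R) : is_derive x (1 : R) F c.
  by apply: is_derive_eq; rewrite /GRing.scale/=; ring.
have F'E : F^`()%classic = fun=> c.
  by apply/funext => x; rewrite derive1E; apply: derive_val.
rewrite (@increasing_ge0_integration_by_substitutionT _ F)//.
- by apply: eq_integral => x _; rewrite F'E.
- by move=> x y xy; rewrite /F ltrD2r ltr_pM2l.
- by rewrite F'E => x; exact: cvg_cst.
- by rewrite F'E; exact: is_cvg_cst.
- by rewrite F'E; exact: is_cvg_cst.
- apply/cvgrNyPle => A; exists ((A - b) / c); split; first exact: num_real.
  by move=> x xA; rewrite /F -lerBrDr mulrC -ler_pdivlMr// ltW.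
- apply/cvgryPge => A; exists ((A - b) / c); split; first exact: num_real.
  by move=> x xA; rewrite /F -lerBlDr mulrC -ler_pdivrMr// ltW.
Qed.

Let pdfE t y : 0 < t ->
  normal_pdf 0 (Num.sqrt t) y = (Num.sqrt (t * pi *+ 2))^-1 * expR (- y ^+ 2 / (t *+ 2)).
Proof.
by move=> t0; rewrite normal_pdfE ?gt_eqF ?sqrtr_gt0// /normal_fun /normal_peak subr0 sqr_sqrtr// ltW.
Qed.

Lemma gaussE t f x : 0 < t -> continuous f -> (forall y, 0 <= f y) ->
  gauss t f x = \int[mu]_y (f (x + y) * normal_pdf 0 (Num.sqrt t) y).
Proof.
move=> t0 cf f0; rewrite /gauss /smooth mean_std_normal; last first.
  apply: measurableT_comp; first exact: continuous_measurable_fun.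
  by apply: measurable_funD => //; exact: measurable_funM.
have c0 : 0 < Num.sqrt t by rewrite sqrtr_gt0.
apply: Rintegral_ereal.
rewrite (@affine_substitution (Num.sqrt t) 0 (fun y => f (x + y) * normal_pdf 0 (Num.sqrt t) y))//.
- apply: eq_integral => y _; rewrite addr0; congr (_%:E).
  rewrite -mulrA; congr (_ * _).
  rewrite pdfE// normal_pdfE ?oner_eq0// /normal_fun /normal_peak subr0 expr1n mul1r.
  rewrite mulrAC; congr (_ * _).
    by rewrite -mulrnAr sqrtrM ?(ltW t0)// invfM mulrAC mulVf ?mul1r// gt_eqF.
  congr expR; rewrite exprMn sqr_sqrtr ?(ltW t0)//; field.
  by rewrite gt_eqF.
- move=> y; apply: cvgM; last by apply: continuous_normal_pdf; rewrite gt_eqF.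
  apply: (@continuous_comp _ _ _ (fun y => x + y) f); last exact: cf.
  by apply: cvgD; [exact: cvg_cst|exact: cvg_id].
- by move=> y; rewrite mulr_ge0 ?normal_pdf_ge0.
Qed.

(* Completing the square in the product of two Gaussian densities. *)
Let pdf_product s t y z : 0 < s -> 0 < t ->
  normal_pdf 0 (Num.sqrt s) z * normal_pdf 0 (Num.sqrt t) (y - z) =
  normal_pdf 0 (Num.sqrt (s + t)) y *
  normal_pdf (s * y / (s + t)) (Num.sqrt (s * t / (s + t))) z.
Proof.
move=> s0 t0; have st0 : 0 < s + t by rewrite addr_gt0.
have r0 : 0 < s * t / (s + t) by rewrite divr_gt0 ?mulr_gt0.
rewrite !pdfE// normal_pdfE; last by rewrite gt_eqF// sqrtr_gt0.
rewrite /normal_fun /normal_peak sqr_sqrtr ?(ltW r0)//.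
rewrite [LHS]mulrACA [RHS]mulrACA -!invfM -!sqrtrM; last 2 first.
- by rewrite mulrn_wge0// mulr_ge0 ?pi_ge0// ltW.
- by rewrite mulrn_wge0// mulr_ge0 ?pi_ge0// ltW.
rewrite -!expRD; congr ((Num.sqrt _)^-1 * expR _).
  by field; rewrite gt_eqF.
by field; rewrite !gt_eqF.
Qed.

(** Both sides become Lebesgue integrals of densities. After Tonelli the completed square leaves, in
    the inner variable, a normal density of total mass one. *)
Lemma gauss_semigroup_ge0 s t f M x : 0 < s -> 0 < t -> continuous f ->
  (forall y, 0 <= f y <= M) -> gauss s (gauss t f) x = gauss (s + t) f x.
Proof.
move=> s0 t0 cf fM; have st0 : 0 < s + t by rewrite addr_gt0.
have f0 y : 0 <= f y by case/andP: (fM y).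
have fnM y : `|f y| <= M by rewrite ger0_norm//; case/andP: (fM y).
have bf : bmeas f by exact: bmeas_line cf fnM.
have g0 y : 0 <= gauss t f y by apply: Rintegral_ge0.
have cg : continuous (gauss t f) by exact: continuous_smooth cf fnM.
rewrite (gaussE x s0 cg g0).
rewrite (gaussE x st0 cf f0).
have cpdf r y : 0 < r -> {for y, continuous (normal_pdf 0 (Num.sqrt r))}.
  by move=> r0; apply: continuous_normal_pdf; rewrite gt_eqF ?sqrtr_gt0.
have p0 r y : 0 <= normal_pdf 0 r y :> R by exact: normal_pdf_ge0.
have cshift a : continuous (fun y => f (a + y)).
  move=> y; apply: (@continuous_comp _ _ _ (fun y => a + y) f); last exact: cf.
  by apply: cvgD; [exact: cvg_cst|exact: cvg_id].
have inner z : ((gauss t f (x + z))%:E =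
    \int[mu]_y (f (x + y) * normal_pdf 0 (Num.sqrt t) (y - z))%:E)%E.
  rewrite (gaussE _ t0 cf f0) /Rintegral fineK; last first.
    apply: integrable_fin_num => //.
    apply: (@le_integrable _ _ _ mu _ measurableT _
      (EFin \o (fun y => M * normal_pdf 0 (Num.sqrt t) y))).
    - apply/measurable_EFinP/measurable_funM; last exact: measurable_normal_pdf.
      by apply: continuous_measurable_fun; exact: cshift.
    - by move=> y _ /=; rewrite lee_fin !normrM ler_wpM2r// (le_trans (fnM _))// ler_norm.
    - by apply: (integrableZl measurableT M (integrable_normal_pdf 0 (Num.sqrt t))).
  rewrite (@affine_substitution 1 (- z) (fun y => f (x + z + y) * normal_pdf 0 (Num.sqrt t) y))//.
  - apply: eq_integral => y _; rewrite mul1r mulr1.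
    by rewrite (_ : x + z + (y - z) = x + y)//; ring.
  - by move=> y; apply: cvgM; [exact: cshift|exact: cpdf].
  - by move=> y; rewrite mulr_ge0.
apply: Rintegral_ereal.
under eq_integral do rewrite EFinM inner.
have mshift : measurable_fun setT (fun y : R => f (x + y)).
  by apply: continuous_measurable_fun; exact: cshift.
pose h (p : measurableTypeR R * measurableTypeR R) : \bar R :=
  (f (x + p.2) * (normal_pdf 0 (Num.sqrt s) p.1 * normal_pdf 0 (Num.sqrt t) (p.2 - p.1)))%:E.
have mh : measurable_fun setT h.
  apply/measurable_EFinP; apply: measurable_funM.
    by apply: (@measurableT_comp _ _ _ _ _ _ (fun y : R => f (x + y))).
  apply: measurable_funM.
    by apply: (@measurableT_comp _ _ _ _ _ _ (normal_pdf 0 (Num.sqrt s))) => //; exact: measurable_normal_pdf.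
  apply: (@measurableT_comp _ _ _ _ _ _ (normal_pdf 0 (Num.sqrt t))); first exact: measurable_normal_pdf.
  exact: measurable_funB.
transitivity (\int[mu]_z \int[mu]_y h (z, y))%E.
  apply: eq_integral => z _; rewrite muleC -ge0_integralZl//.
  - by apply: eq_integral => y _; rewrite -EFinM /h/=; congr (_%:E); ring.
  - apply/measurable_EFinP/measurable_funM => //.
    apply: (@measurableT_comp _ _ _ _ _ _ (normal_pdf 0 (Num.sqrt t))); first exact: measurable_normal_pdf.
    exact: measurable_funB.
  - by move=> y _; rewrite lee_fin mulr_ge0.
  - by rewrite lee_fin.
have h0 p : (0 <= h p)%E by rewrite lee_fin !mulr_ge0.
rewrite (@fubini_tonelli _ _ _ _ _ mu mu h mh h0).
apply: eq_integral => y _.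
rewrite /h/=; under eq_integral do rewrite pdf_product// mulrA EFinM.
rewrite ge0_integralZl//.
- by rewrite integral_normal_pdf mule1.
- by apply/measurable_EFinP; exact: measurable_normal_pdf.
- by move=> z _; rewrite lee_fin normal_pdf_ge0.
- by rewrite lee_fin mulr_ge0.
Qed.

(** Adding [M] makes [f] nonnegative and commutes with [gauss]; zero variances are split off because
    they have no density. *)
Lemma gauss_semigroup s t f M x : 0 <= s -> 0 <= t -> continuous f ->
  (forall y, `|f y| <= M) -> gauss s (gauss t f) x = gauss (s + t) f x.
Proof.
move=> s0 t0 cf fM; have bf : bmeas f by exact: bmeas_line cf fM.
have [->|s_neq0] := eqVneq s 0; first by rewrite add0r /gauss sqrtr0 smooth0.
have [->|t_neq0] := eqVneq t 0.
  rewrite addr0 /gauss sqrtr0; congr smooth; apply/funext => y; exact: smooth0.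
have {s_neq0}s0' : 0 < s by rewrite lt_neqAle eq_sym s_neq0.
have {t_neq0}t0' : 0 < t by rewrite lt_neqAle eq_sym t_neq0.
have shift r (g : R -> R) y : bmeas g -> gauss r (fun z => g z + M) y = gauss r g y + M.
  by move=> bg; rewrite /gauss /smooth meanD ?mean_cst//; [exact: bmeas_shift|exact: bmeas_cst].
have := @gauss_semigroup_ge0 s t (fun y => f y + M) (M + M) x s0' t0'.
rewrite shift// (_ : gauss t (fun y => f y + M) = fun y => gauss t f y + M); last first.
  by apply/funext => y; exact: shift.
rewrite shift; last exact: bmeas_smooth.
move=> h; apply: (addIr M); apply: h.
- by move=> y; apply: cvgD; [exact: cf|exact: cvg_cst].
- by move=> y; have := fM y; rewrite ler_norml => /andP[? ?]; apply/andP; split; lra.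
Qed.

End GaussianSemigroup.

(** * Taylor bounds for cosine and for powers of the logistic function *)

Section TaylorBounds.
Context (R : realType).
Implicit Types (f : R -> R) (x h y : R).

(** The derivative is bounded only within [|h|] of [x], so that a bound growing with the distance
    can be fed in again, one power at a time. *)
Lemma derive_bound f f' B x h : (forall y, is_derive (y : R) (1 : R) f (f' y)) ->
  (forall y, `|y - x| <= `|h| -> `|f' y| <= B) -> `|f (x + h) - f x| <= B * `|h|.
Proof.
move=> df fB.
have cf y : {for y, continuous f}.
  by apply: differentiable_continuous; apply/derivable1_diffP; case: (df y).
have mvt a b : a < b -> `|a - x| <= `|h| -> `|b - x| <= `|h| -> `|f b - f a| <= B * (b - a).
  move=> ab /ler_normlP[a1 a2] /ler_normlP[b1 b2].
  have [c] := @MVT R f f' a b ab (fun y _ => df y) (continuous_subspaceT (fun y => cf y)).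
  rewrite in_itv/= => /andP[ac cb] ->.
  rewrite normrM [X in _ * X]ger0_norm ?subr_ge0 ?(ltW ab)// ler_wpM2r ?subr_ge0 ?(ltW ab)//.
  by apply: fB; rewrite ler_norml; apply/andP; split; lra.
have [h0|h0|->] := ltgtP h 0.
- rewrite distrC (ltr0_norm h0); have := @mvt (x + h) x.
  rewrite (_ : x + h - x = h); last by ring.
  by rewrite (_ : x - (x + h) = - h); [apply; rewrite ?gtrDl// subrr normr0|ring].
- rewrite (gtr0_norm h0); have := @mvt x (x + h).
  rewrite (_ : x + h - x = h); last by ring.
  by apply; rewrite ?ltrDl// subrr normr0.
- by rewrite addr0 subrr normr0 mulr0.
Qed.

(** The mean value inequality is applied three times, each time after subtracting the Taylor
    polynomial; each use gains one power of the distance with the same constant [C]. *)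
Lemma cubic_taylor_derive f f1 f2 f3 C :
  (forall y, is_derive (y : R) (1 : R) f (f1 y)) ->
  (forall y, is_derive (y : R) (1 : R) f1 (f2 y)) ->
  (forall y, is_derive (y : R) (1 : R) f2 (f3 y)) ->
  (forall y, `|f3 y| <= C) -> cubic_taylor C f f2.
Proof.
move=> d0 d1 d2 f3C; exists f1 => x h.
have C0 : 0 <= C by exact: le_trans (f3C 0).
have s2 y : `|f2 y - f2 x| <= C * `|y - x|.
  have := @derive_bound f2 f3 C x (y - x) d2 (fun z _ => f3C z).
  by rewrite (_ : x + (y - x) = y)//; ring.
have s1 y : `|f1 y - f1 x - (y - x) * f2 x| <= C * `|y - x| ^+ 2.
  pose g z := f1 z - z * f2 x.
  have dg z : is_derive (z : R) (1 : R) g (f2 z - f2 x).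
    by apply: is_derive_eq; rewrite /GRing.scale/=; ring.
  have := @derive_bound g _ (C * `|y - x|) x (y - x) dg.
  rewrite /g (_ : x + (y - x) = y); last by ring.
  rewrite -mulrA -expr2 => hg.
  rewrite (_ : _ - _ - _ = f1 y - y * f2 x - (f1 x - x * f2 x)); last by ring.
  by apply: hg => z zy; rewrite (le_trans (s2 z))// ler_wpM2l.
pose g z := f z - z * (f1 x - x * f2 x) - z ^+ 2 / 2 * f2 x.
have dg z : is_derive (z : R) (1 : R) g (f1 z - f1 x - (z - x) * f2 x).
  by apply: is_derive_eq; rewrite /GRing.scale/=; field.
have := @derive_bound g _ (C * `|h| ^+ 2) x h dg.
rewrite /g (_ : C * `|h| ^+ 3 = C * `|h| ^+ 2 * `|h|); last by ring.
move=> hg.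
rewrite (_ : _ - _ - _ - _ = f (x + h) - (x + h) * (f1 x - x * f2 x) - (x + h) ^+ 2 / 2 * f2 x -
  (f x - x * (f1 x - x * f2 x) - x ^+ 2 / 2 * f2 x)); last by field.
apply: hg => y yx; rewrite (le_trans (s1 y))// ler_wpM2l//.
by rewrite lerXn2r ?nnegrE.
Qed.

Lemma cubic_taylor_cos : cubic_taylor 1 (@cos R) (fun x => - cos x).
Proof.
apply: (@cubic_taylor_derive _ (fun x => - sin x) _ (@sin R)).
- by move=> y; apply: is_derive_eq; rewrite opprK.
- by move=> y; rewrite ler_norml sin_geN1 sin_le1.
Qed.

(** With [D j = psi^j - psi^(j+1)], bounded by 1, the derivative of [psi^j] is [j D j] and that of
    [D j] is [j D j - (j+1) D (j+1)]. The system is closed, so three derivatives are bounded by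
    explicit integers. *)
Lemma logisticX_cubic_taylor k : exists C f2, 0 <= C /\
  cubic_taylor C (fun x : R => logistic x ^+ k) f2.
Proof.
pose D j (x : R) := logistic x ^+ j - logistic x ^+ j.+1.
have D01 j x : `|D j x| <= 1.
  have p0 := ltW (logistic_gt0 x); have p1 := ltW (logistic_lt1 x).
  have q0 : 0 <= logistic x ^+ j by exact: exprn_ge0.
  have q1 : logistic x ^+ j <= 1 by rewrite exprn_ile1.
  by rewrite /D exprS ler_norml; apply/andP; split; nra.
have dX j (x : R) : is_derive (x : R) (1 : R) (fun x : R => logistic x ^+ j) (j%:R * D j x).
  have e0 : 1 + expR (- x) != 0 by rewrite gt_eqF// addr_gt0 ?expR_gt0.
  have dl : is_derive (x : R) (1 : R) (@logistic R) (D 1%N x).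
    rewrite /logistic; apply: is_derive_eq.
    by rewrite /D /logistic /GRing.scale/=; field.
  have -> : (fun x => logistic x ^+ j) = (@logistic R) ^+ j.
    by apply/funext => y; rewrite exprfctE.
  apply: (is_derive_eq (is_deriveX j dl)); rewrite /D /GRing.scale/=.
  case: j => [|j]; first by rewrite !mul0r.
  by rewrite /= !exprS; ring.
have dD j (x : R) : is_derive (x : R) (1 : R) (D j) (j%:R * D j x - j.+1%:R * D j.+1 x).
  by rewrite /D; apply: is_derive_eq.
pose f1 x := k%:R * D k x.
pose f2 x := k%:R * (k%:R * D k x - k.+1%:R * D k.+1 x).
pose f3 x := k%:R * (k%:R * (k%:R * D k x - k.+1%:R * D k.+1 x) -
   k.+1%:R * (k.+1%:R * D k.+1 x - k.+2%:R * D k.+2 x)).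
pose C : R := k%:R * (k%:R * (k%:R + k.+1%:R) + k.+1%:R * (k.+1%:R + k.+2%:R)).
exists C, f2; split; first by apply: mulr_ge0 => //; apply: addr_ge0; apply: mulr_ge0 => //; exact: addr_ge0.
apply: (@cubic_taylor_derive _ f1 f2 f3) => y; rewrite /f3 /C.
  have b (a b : R) (i j : nat) : `|a| <= i%:R -> `|b| <= j%:R -> `|a - b| <= i%:R + j%:R.
    by move=> ai bj; rewrite (le_trans (ler_normB _ _))// lerD.
  have z (a c : R) (i : nat) : `|a| <= c -> `|i%:R * a| <= i%:R * c.
    by move=> ac; rewrite normrM normr_nat ler_wpM2l.
  have zD i : `|i%:R * D i y| <= i%:R by rewrite -[leRHS]mulr1; exact: z.
  apply: (z); rewrite (le_trans (ler_normB _ _))//; apply: lerD; apply: (z).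
    exact: b.
  exact: b.
Qed.

End TaylorBounds.

(** * Lindeberg replacement, and the Gaussian mean of cosine *)

Section GaussianApproximation.
Context (R : realType).

(** The sum of the two third absolute moments, so that one constant serves both the normal and the
    exponential step. *)
Let K : R := \int[std_normal R]_z `|z| ^+ 3 + \int[centred_exponential R]_z `|z| ^+ 3.

Let abs3_ge0 (m : probability R R) : 0 <= \int[m]_z `|z| ^+ 3.
Proof. by apply: Rintegral_ge0 => z _; exact: exprn_ge0. Qed.

Let K0 : 0 <= K. Proof. exact: addr_ge0. Qed.

Lemma gauss_step (C c : R) f f2 x : bmeas f -> 0 <= c -> 0 <= C -> cubic_taylor C f f2 ->
  `|gauss (c ^+ 2) f x - f x - c ^+ 2 / 2 * f2 x| <= C * K * c ^+ 3.
Proof.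
move=> bf c0 C0 tf; rewrite /gauss sqrtr_sqr (ger0_norm c0).
apply: lindeberg_step => //.
- exact: integrable_std_normal3.
- exact: std_normal_mean.
- exact: std_normal_variance.
- by rewrite /K lerDl.
Qed.

Lemma exponential_step (C c : R) f f2 x : bmeas f -> 0 <= c -> 0 <= C -> cubic_taylor C f f2 ->
  `|smooth (centred_exponential R) c f x - f x - c ^+ 2 / 2 * f2 x| <= C * K * c ^+ 3.
Proof.
move=> bf c0 C0 tf; apply: lindeberg_step => //.
- exact: integrable_centred_exponential3.
- exact: centred_exponential_mean.
- exact: centred_exponential_variance.
- by rewrite /K lerDr.
Qed.

(* Lindeberg replacement, one summand at a time; all the operators commute. *)
Lemma exponential_gauss (C c M : R) f f2 n x : 0 <= c -> 0 <= C ->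
  continuous f -> (forall x, `|f x| <= M) -> cubic_taylor C f f2 ->
  `|iter n (smooth (centred_exponential R) c) f x - gauss (n%:R * c ^+ 2) f x| <=
  n%:R * (2 * C * K * c ^+ 3).
Proof.
move=> c0 C0 cf fM tf; have bf := bmeas_line cf fM.
have biter k : bmeas (iter k (smooth (centred_exponential R) c) f).
  by elim: k => [//|k ih]; exact: bmeas_smooth.
elim: n x => [|n ih] x.
  by rewrite !mul0r /gauss sqrtr0 smooth0 subrr normr0.
set A := smooth _ c in ih biter *; set e := 2 * C * K * c ^+ 3 in ih *.
have bg t : bmeas (gauss t f) by exact: bmeas_smooth.
rewrite -natr1 !mulrDl !mul1r -(gauss_semigroup _ _ _ cf fM) ?mulr_ge0 ?sqr_ge0//.
rewrite /= -(subrKA (A (gauss (n%:R * c ^+ 2) f) x)) (le_trans (ler_normD _ _))//.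
apply: lerD; first exact: smooth_dist.
(* With the heat operator moved outside, the one-step comparison concerns [f] itself, whose Taylor
   bound is known; the common terms [f] and [c^2/2 f2] cancel. *)
rewrite /A /gauss smoothC// -!/(gauss _ _).
apply: smooth_dist; [exact: bmeas_smooth|exact: bg|] => y.
have := gauss_step y bf c0 C0 tf; have := exponential_step y bf c0 C0 tf.
rewrite /e !ler_norml; lra.
Qed.

Let expN_taylor (y : R) : 0 <= y -> `|expR (- y) - 1 + y| <= y ^+ 2.
Proof.
move=> y0; have h1 := expR_ge1Dx (- y); have h2 := expR_ge1Dx y.
have e0 := expR_gt0 (- y).
have h3 : expR (- y) * (1 + y) <= 1.
  have : expR (- y) * expR y = 1 by rewrite -expRD addNr expR0.
  nra.
rewrite ler_norml; apply/andP; split; nra.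
Qed.

(** Since [cos'' = - cos], a step of variance [c^2] multiplies cosine by [exp(-c^2/2)] up to
    [O(c^3)]. Over [n] steps with [n c^2 = t] the semigroup makes the errors add up to
    [O(n^(-1/2))], which tends to 0. *)
Lemma gauss_cos t x : 0 <= t -> gauss t cos x = expR (- (t / 2)) * cos x :> R.
Proof.
move=> t0.
have ccos : continuous (@cos R) by exact: continuous_cos.
have cosM (y : R) : `|cos y| <= 1 by rewrite ler_norml cos_geN1 cos_le1.
have bcos := bmeas_line ccos cosM.
have step c y : 0 <= c -> c <= 1 -> `|gauss (c ^+ 2) cos y - expR (- (c ^+ 2 / 2)) * cos y| <=
    (K + 1) * c ^+ 3.
  move=> c0 c1; have := gauss_step y bcos c0 ler01 (cubic_taylor_cos R); rewrite mul1r => h1.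
  have h2 := @expN_taylor (c ^+ 2 / 2) ltac:(by rewrite divr_ge0// sqr_ge0).
  have h3 : `|(expR (- (c ^+ 2 / 2)) - 1 + c ^+ 2 / 2) * cos y| <= c ^+ 3.
    rewrite normrM -[leRHS]mulr1; apply: ler_pM => //; rewrite (le_trans h2)//.
    have : c ^+ 4 <= c ^+ 3 by rewrite [leLHS]exprS ler_piMl// exprn_ge0.
    rewrite (_ : (c ^+ 2 / 2) ^+ 2 = c ^+ 4 / 4); last by field.
    have := exprn_ge0 3 c0; lra.
  rewrite (_ : _ - _ = (gauss (c ^+ 2) cos y - cos y - c ^+ 2 / 2 * - cos y) -
     (expR (- (c ^+ 2 / 2)) - 1 + c ^+ 2 / 2) * cos y); last by ring.
  by rewrite (le_trans (ler_normB _ _))// [leRHS]mulrDl mul1r lerD.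
have iterate c n y : 0 <= c -> c <= 1 ->
    `|gauss (n%:R * c ^+ 2) cos y - expR (- (n%:R * c ^+ 2 / 2)) * cos y| <=
    n%:R * ((K + 1) * c ^+ 3).
  move=> c0 c1; elim: n y => [|n ih] y.
    by rewrite !mul0r oppr0 expR0 mul1r /gauss sqrtr0 smooth0 subrr normr0.
  have E : n.+1%:R * c ^+ 2 = c ^+ 2 + n%:R * c ^+ 2 by rewrite -natr1; ring.
  rewrite E -(gauss_semigroup _ _ _ ccos cosM) ?mulr_ge0 ?sqr_ge0//.
  set q := expR (- (n%:R * c ^+ 2 / 2)).
  have -> : expR (- ((c ^+ 2 + n%:R * c ^+ 2) / 2)) = q * expR (- (c ^+ 2 / 2)).
    by rewrite /q -expRD; congr expR; field.
  rewrite -(subrKA (gauss (c ^+ 2) (fun z => q * cos z) y)) (le_trans (ler_normD _ _))//.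
  rewrite -[n.+1%:R]natr1 [leRHS]mulrDl mul1r; apply: lerD.
    apply: smooth_dist => //; first exact: bmeas_smooth.
    by apply: bmeasM => //; exact: bmeas_cst.
  rewrite /gauss smoothZ// -/(gauss _ _) -mulrA -mulrBr normrM.
  rewrite -[leRHS]mul1r ler_pM// ?step// ger0_norm ?expR_ge0//.
  by rewrite /q -[leRHS]expR0 ler_expR oppr_le0 divr_ge0// mulr_ge0// sqr_ge0.
apply/eqP; rewrite -subr_eq0 -normr_le0; apply/ler_addgt0Pl => e e0; rewrite addr0.
have L0 : 0 < Num.sqrt t * t * (K + 1) + 1 by rewrite ltr_wpDl// !mulr_ge0 ?sqrtr_ge0// addr_ge0.
(* With [c^2 = t/n] the error is [t (sqrt t) (K + 1) / sqrt n]: [n >= r^2] brings it below [e], and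
   [n >= t] gives [c <= 1]. *)
pose r := (Num.sqrt t * t * (K + 1) + 1) / e.
pose n := (Num.truncn (r ^+ 2 + t)).+1.
have n0 : 0 < n%:R :> R by rewrite ltr0n.
have nr : r ^+ 2 + t < n%:R by exact: truncnS_gt.
pose c := Num.sqrt (t / n%:R).
have c2 : c ^+ 2 = t / n%:R by rewrite sqr_sqrtr// divr_ge0// ltW.
have c1 : c <= 1.
  rewrite -(@ler_pXn2r _ 2)// ?nnegrE ?sqrtr_ge0// c2 expr1n ler_pdivrMr// mul1r.
  by rewrite (le_trans _ (ltW nr))// lerDr sqr_ge0.
have := iterate c n x (sqrtr_ge0 _) c1.
rewrite c2 (_ : n%:R * (t / n%:R) = t); last by field; rewrite gt_eqF.
move/le_trans; apply.
have r0 : 0 < r by rewrite divr_gt0.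
have rs : r <= Num.sqrt n%:R.
  rewrite -(@ler_pXn2r _ 2)// ?nnegrE ?sqrtr_ge0 ?(ltW r0)// sqr_sqrtr ?(ltW n0)//.
  by rewrite (le_trans _ (ltW nr))// lerDl.
have s0 : 0 < Num.sqrt n%:R :> R by rewrite sqrtr_gt0.
rewrite (_ : n%:R * _ = Num.sqrt t * t * (K + 1) / Num.sqrt n%:R); last first.
  rewrite exprS c2 /c sqrtrM// sqrtrV ?(ltW n0)//.
  by field; rewrite !gt_eqF.
rewrite ler_pdivrMr//.
apply: (@le_trans _ _ (e * r)); last by rewrite ler_pM2l.
by rewrite [e * r]mulrC /r divfK ?gt_eqF// lerDl.
Qed.

End GaussianApproximation.

(** * Difference quotients and their primitives *)

Section SlopePrimitive.
Context (R : realType).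
Notation mu := lebesgue_measure.
Implicit Types (h g : R -> R) (x v : R).

(** The derivative [d0] fills the gap at 0, so that the quotient is continuous through the
    singularity. *)
Definition slope h (d0 : R) v : R := if v == 0 then d0 else (h v - h 0) / v.

Lemma continuous_slope h d0 : continuous h -> is_derive (0 : R) (1 : R) h d0 ->
  continuous (slope h d0).
Proof.
move=> ch dh v; have [->|v0] := eqVneq v 0.
  apply/continuous_withinNx; rewrite {2}/slope eqxx.
  have := @ex_derive _ _ _ _ _ _ _ dh; rewrite /derivable => cdh.
  have ld := @derive_val _ _ _ _ _ _ _ dh; rewrite /derive in ld.
  rewrite -[X in _ --> X]ld; apply: cvg_trans cdh.
  apply: near_eq_cvg; near=> y; rewrite /slope ifF; last first.
    by apply/negbTE; near: y; exact: nbhs_dnbhs_neq.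
  by rewrite /= addr0 /GRing.scale/= mulr1 mulrC.
have h2 : {for v, continuous (fun v => (h v - h 0) / v)}.
  apply: cvgM; first by apply: cvgB; [exact: ch|exact: cvg_cst].
  by apply: cvgV => //; exact: cvg_id.
have e : slope h d0 v = (h v - h 0) / v by rewrite /slope (negbTE v0).
rewrite /continuous_at e; apply: cvg_trans h2; apply: near_eq_cvg.
near=> y; rewrite /slope ifF//; apply/negbTE; near: y.
have nz : nbhs v [set y | y != 0] by apply: open_nbhs_nbhs; split => //; exact: open_neq.
exact: nz.
Unshelve. all: by end_near. Qed.

(** Normalised at 0 but integrated from -1, so that 0 is an interior point with a two-sided
    derivative. *)
Definition primitive g x : R :=
  \int[mu]_(t in `[-1, x]) g t - \int[mu]_(t in `[-1, 0]) g t.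

Lemma primitive_derive g x : continuous g -> -1 < x ->
  is_derive (x : R) (1 : R) (primitive g) (g x).
Proof.
move=> cg x1.
have ig a b : mu.-integrable `[a, b] (EFin \o g).
  by apply: continuous_compact_integrable; [exact: segment_compact|exact: continuous_subspaceT].
have xx : x < x + 1 by rewrite ltrDl.
have [|dF F'] := @continuous_FTC1 _ g (BLeft (-1)) x (x + 1) xx (ig _ _) _ (cg x).
  by rewrite /= lte_fin.
have dG : is_derive x 1 (fun x0 : R => \int[mu]_(t in `[-1, x0]) g t) (g x).
  by apply: DeriveDef; [exact: dF|rewrite -derive1E].
have := @is_deriveB _ _ _ _ _ _ _ _ _ dG (@is_derive_cst _ _ _ (\int[mu]_(t in `[-1, 0]) g t) x (1:R)).
by rewrite subr0.
Qed.

Lemma primitive0 g : primitive g 0 = 0.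
Proof. exact: subrr. Qed.

Lemma primitiveE g x : continuous g -> 0 <= x -> primitive g x = \int[mu]_(t in `[0, x]) g t.
Proof.
move=> cg x0; have ig a b : mu.-integrable `[a, b] (EFin \o g).
  by apply: continuous_compact_integrable; [exact: segment_compact|exact: continuous_subspaceT].
rewrite /primitive (@Rintegral_itvB _ g (BLeft (-1)) (BRight x) 0)//.
  rewrite (@Rintegral_itv_obnd_cbnd _ 0 (BRight x))//.
  by apply: (@integrableS _ _ _ mu `[0, x]) => //; apply: subset_itvr; rewrite bnd_simp.
by rewrite bnd_simp lerN10.
Qed.

End SlopePrimitive.

(** * The exponent and a harmonic function for the Dickman recursion *)

Section CharacteristicExponent.
Context (R : realType) (a u theta c0 : R).
Hypothesis a0 : 0 <= a.
Hypothesis theta0 : 0 < theta.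

(* Real and imaginary parts of (e^(-sv) - 1) / v for s = a - iu. *)
Definition expo_re : R -> R := slope (fun v => expR (- (a * v)) * cos (u * v)) (- a).
Definition expo_im : R -> R := slope (fun v => expR (- (a * v)) * sin (u * v)) u.

Lemma continuous_expo_re : continuous expo_re.
Proof.
have d (x : R) : is_derive (x : R) (1 : R) (fun v : R => expR (- (a * v)) * cos (u * v))
    (- a * expR (- (a * x)) * cos (u * x) - u * expR (- (a * x)) * sin (u * x)).
  by apply: is_derive_eq; rewrite /GRing.scale/=; ring.
apply: continuous_slope.
  by move=> x; apply: differentiable_continuous; apply/derivable1_diffP; case: (d x).
apply: (is_derive_eq (d 0)); rewrite !mulr0 oppr0 expR0 cos0 sin0; ring.
Qed.

Lemma continuous_expo_im : continuous expo_im.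
Proof.
have d (x : R) : is_derive (x : R) (1 : R) (fun v : R => expR (- (a * v)) * sin (u * v))
    (- a * expR (- (a * x)) * sin (u * x) + u * expR (- (a * x)) * cos (u * x)).
  by apply: is_derive_eq; rewrite /GRing.scale/=; ring.
apply: continuous_slope.
  by move=> x; apply: differentiable_continuous; apply/derivable1_diffP; case: (d x).
apply: (is_derive_eq (d 0)); rewrite !mulr0 oppr0 expR0 cos0 sin0; ring.
Qed.

Lemma expo_reE v : v * expo_re v = expR (- (a * v)) * cos (u * v) - 1.
Proof.
rewrite /expo_re /slope; have [->|v0] := eqVneq v 0.
  by rewrite !mulr0 mul0r oppr0 expR0 cos0 mulr1 subrr.
by rewrite mulrC divfK// !mulr0 oppr0 expR0 cos0 mulr1.
Qed.

Lemma expo_imE v : v * expo_im v = expR (- (a * v)) * sin (u * v).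
Proof.
rewrite /expo_im /slope; have [->|v0] := eqVneq v 0.
  by rewrite !mulr0 sin0 mulr0 mul0r.
by rewrite mulrC divfK// !mulr0 oppr0 expR0 sin0 mulr0 subr0.
Qed.

Lemma expo_re_le0 v : 0 <= v -> expo_re v <= 0.
Proof.
rewrite le_eqVlt => /predU1P[<-|v0]; first by rewrite /expo_re /slope eqxx oppr_le0.
rewrite -(pmulr_rle0 _ v0) expo_reE subr_le0.
rewrite (le_trans (ler_norm _))// normrM mulr_ile1//.
  by rewrite ger0_norm ?expR_ge0// -[leRHS]expR0 ler_expR oppr_le0 mulr_ge0// ltW.
by rewrite ler_norml cos_geN1 cos_le1.
Qed.

Let p := primitive expo_re.
Let q := primitive expo_im.

Let p_le0 x : 0 <= x -> p x <= 0.
Proof.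
move=> x0; rewrite /p primitiveE//; last exact: continuous_expo_re.
rewrite -oppr_ge0 -mulN1r -RintegralZl//; last first.
  apply: continuous_compact_integrable; first exact: segment_compact.
  apply: continuous_subspaceT; exact: continuous_expo_re.
apply: Rintegral_ge0 => y; rewrite /= in_itv/= => /andP[y0 _].
by rewrite mulN1r oppr_ge0 expo_re_le0.
Qed.

(* e^(-sw) exp(theta * int_0^p (e^(-sv) - 1)/v dv), real part after a rotation
   by the angle c0. *)
Definition dickman_fun (w x : R) : R :=
  expR (- (a * w) + theta * p x) * cos (u * w + theta * q x + c0).

(** The imaginary part of the same complex quantity, into which shifts and derivatives of
    [dickman_fun] rotate. *)
Let dickman_conj (w x : R) : R :=
  expR (- (a * w) + theta * p x) * sin (u * w + theta * q x + c0).

Lemma dickman_fun_norm w x : 0 <= w -> 0 <= x -> `|dickman_fun w x| <= 1.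
Proof.
move=> w0 x0; rewrite normrM mulr_ile1//.
  rewrite ger0_norm ?expR_ge0// -[leRHS]expR0 ler_expR.
  have := mulr_ge0_le0 (ltW theta0) (p_le0 x0); have := mulr_ge0 a0 w0; lra.
by rewrite ler_norml cos_geN1 cos_le1.
Qed.

(** Real part of [e^(-s(w + x)) = e^(-sw) (1 + x (e^(-sx) - 1)/x)] times the common factor. The
    correction is [x / theta] times the derivative of [dickman_fun w] at [x], which is why
    [dickman_harmonic] closes up. *)
Let dickman_shift w x : dickman_fun (w + x) x =
  dickman_fun w x + (x * expo_re x) * dickman_fun w x - (x * expo_im x) * dickman_conj w x.
Proof.
rewrite /dickman_fun /dickman_conj expo_reE expo_imE.
rewrite (_ : - (a * (w + x)) + theta * p x = - (a * x) + (- (a * w) + theta * p x)); last by ring.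
rewrite (_ : u * (w + x) + theta * q x + c0 = u * x + (u * w + theta * q x + c0)); last by ring.
rewrite expRD cosD; ring.
Qed.

Lemma continuous_dickman_comp (U : topologicalType) (f g : U -> R) : continuous f -> continuous g ->
  (forall x, -1 < g x) -> continuous (fun x => dickman_fun (f x) (g x)).
Proof.
move=> cf cg g1 x.
have cp : {for g x, continuous p}.
  have d := primitive_derive continuous_expo_re (g1 x).
  by apply: differentiable_continuous; apply/derivable1_diffP; case: d.
have cq : {for g x, continuous q}.
  have d := primitive_derive continuous_expo_im (g1 x).
  by apply: differentiable_continuous; apply/derivable1_diffP; case: d.
have cpg : {for x, continuous (p \o g)} by apply: continuous_comp => //; exact: cg.
have cqg : {for x, continuous (q \o g)} by apply: continuous_comp => //; exact: cg.
apply: cvgM.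
  apply: (@continuous_comp _ _ _ (fun x : U => - (a * f x) + theta * p (g x)) expR); last exact: continuous_expR.
  apply: cvgD; last by apply: cvgM; [exact: cvg_cst|exact: cpg].
  by apply: cvgN; apply: cvgM; [exact: cvg_cst|exact: cf].
apply: (@continuous_comp _ _ _ (fun x : U => u * f x + theta * q (g x) + c0) cos); last exact: continuous_cos.
apply: cvgD; last exact: cvg_cst.
apply: cvgD; first by apply: cvgM; [exact: cvg_cst|exact: cf].
by apply: cvgM; [exact: cvg_cst|exact: cqg].
Qed.

(* The fixed-point equation of the Dickman transform: with rho = e^(-E/theta)
   for E exponential, the function is harmonic for (w, x) -> (w + x rho, x rho),
   because -e^(-y) dickman_fun w (x e^(-y/theta)) is an antiderivative. *)
Lemma dickman_harmonic w x : 0 <= w -> 0 <= x ->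
  \int[std_exponential R]_y
    dickman_fun (w + x * expR (- (y / theta))) (x * expR (- (y / theta))) = dickman_fun w x.
Proof.
move=> w0 x0; pose z (y : R) := x * expR (- (y / theta)).
have z0 y : 0 <= z y by rewrite mulr_ge0 ?expR_ge0.
have z1 y : -1 < z y by rewrite (lt_le_trans _ (z0 y))// ltrN10.
have dz (y : R) : is_derive (y : R) (1 : R) z (- (z y / theta)).
  by apply: is_derive_eq; rewrite /GRing.scale/= /z; ring.
have cz : continuous z.
  by move=> y; apply: differentiable_continuous; apply/derivable1_diffP; case: (dz y).
have dF (y : R) : is_derive (y : R) (1 : R) (fun y => - (expR (- y) * dickman_fun w (z y)))
    (dickman_fun (w + z y) (z y) * expR (- y)).
  have dp : is_derive (y : R) (1 : R) (fun y => p (z y)) (expo_re (z y) * - (z y / theta)).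
    apply: (@is_derive1_comp _ p z y).
    exact: (primitive_derive continuous_expo_re (z1 y)).
  have dq : is_derive (y : R) (1 : R) (fun y => q (z y)) (expo_im (z y) * - (z y / theta)).
    apply: (@is_derive1_comp _ q z y).
    exact: (primitive_derive continuous_expo_im (z1 y)).
  rewrite dickman_shift /dickman_fun /dickman_conj.
  apply: is_derive_eq; rewrite /GRing.scale/=; field.
  by rewrite gt_eqF.
have := @std_exponential_FTC _ (fun y => dickman_fun (w + z y) (z y)) _ 1 _ _ dF.
have zz : z 0 = x by rewrite /z mul0r oppr0 expR0 mulr1.
rewrite zz oppr0 expR0 mul1r opprK; apply.
- apply: continuous_dickman_comp => // y.
  by apply: cvgD; [exact: cvg_cst|exact: cz].
- move=> y y0; rewrite mul1r (le_trans (dickman_fun_norm _ _))//; first by rewrite addr_ge0.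
  by rewrite exprn_ege1// lerDl.
- apply: (@cvg_poly_exp _ (fun y => - (expR (- y) * dickman_fun w (z y))) 1) => y y0.
  rewrite mul1r normrN normrM mulrC (ger0_norm (expR_ge0 _)).
  rewrite ler_wpM2r ?expR_ge0// (le_trans (dickman_fun_norm _ _))//.
  by rewrite exprn_ege1// lerDl.
Qed.

End CharacteristicExponent.

(** * The Dickman series and its transform *)

Section DickmanSeries.
Context (R : realType) (T : Type) (E_ : nat -> T -> R) (theta : R).

(** For positive [theta] the absolute value keeps the factor in []0, 1]] everywhere, although an
    exponential variable is nonnegative only almost surely. *)
Definition dickman_factor (x : R) : R := expR (- (`|x| / theta)).

Fixpoint dickman_prod n (w : T) : R :=
  if n is m.+1 then dickman_prod m w * dickman_factor (E_ m w) else 1.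

Fixpoint dickman_sum n (w : T) : R :=
  if n is m.+1 then dickman_sum m w + dickman_prod m.+1 w else 0.

End DickmanSeries.

Section MeasurableDickman.
Context (R : realType) d (T : measurableType d) (E_ : nat -> T -> R) (theta : R).

Lemma continuous_dickman_factor : continuous (@dickman_factor R theta).
Proof.
move=> x; apply: (@continuous_comp _ _ _ (fun x => - (`|x| / theta)) expR); last exact: continuous_expR.
apply: cvgN; apply: cvgM; [exact: norm_continuous|exact: cvg_cst].
Qed.

Lemma measurable_dickman_prod n : (forall k, (k < n)%N -> measurable_fun setT (E_ k)) ->
  measurable_fun setT (dickman_prod E_ theta n).
Proof.
elim: n => [_|n ih mE]; first exact: measurable_cst.
apply: measurable_funM; first by apply: ih => k kn; apply: mE; rewrite ltnS ltnW.
apply: (@measurableT_comp _ _ _ _ _ _ (@dickman_factor R theta)); last exact: mE.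
exact: continuous_measurable_fun continuous_dickman_factor.
Qed.

Lemma measurable_dickman_sum n : (forall k, (k < n)%N -> measurable_fun setT (E_ k)) ->
  measurable_fun setT (dickman_sum E_ theta n).
Proof.
elim: n => [_|n ih mE]; first exact: measurable_cst.
apply: measurable_funD; first by apply: ih => k kn; apply: mE; rewrite ltnS ltnW.
exact: measurable_dickman_prod.
Qed.

End MeasurableDickman.

Section DickmanVariable.
Context (R : realType) d (T : measurableType d) (P : probability T R).
Variables (E_ : nat -> T -> R) (theta : R).
Hypothesis theta0 : 0 < theta.
Hypothesis mE : forall n, measurable_fun setT (E_ n).

Local Notation dickman_factor := (@dickman_factor R theta).
Local Notation dickman_prod := (dickman_prod E_ theta).
Local Notation dickman_sum := (dickman_sum E_ theta).

Hypothesis lawE : forall n (f : R -> R), bmeas f ->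
  \int[P]_w f (E_ n w) = \int[std_exponential R]_x f x.
Hypothesis indE : forall n (f : (R * R) * R -> R), bmeas f ->
  \int[P]_w f ((dickman_sum n w, dickman_prod n w), E_ n w) =
  \int[P]_w \int[P]_v f ((dickman_sum n w, dickman_prod n w), E_ n v).

Let factor01 x : 0 <= dickman_factor x <= 1.
Proof.
rewrite /dickman_factor expR_ge0/= -[leRHS]expR0 ler_expR oppr_le0.
by rewrite divr_ge0// ltW.
Qed.

Let continuous_factor : continuous dickman_factor := @continuous_dickman_factor R theta.

Let measurable_prod n : measurable_fun setT (dickman_prod n).
Proof. by apply: measurable_dickman_prod => k _; exact: mE. Qed.

Let prod01 n w : 0 <= dickman_prod n w <= 1.
Proof.
elim: n => [|n /andP[h0 h1]]; first by rewrite ler01 lexx.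
have /andP[k0 k1] := factor01 (E_ n w).
by rewrite /= mulr_ge0//= mulr_ile1.
Qed.

Let bprod n : bmeas (dickman_prod n).
Proof.
by split => //; exists 1 => w; have /andP[? ?] := prod01 n w; rewrite ger0_norm.
Qed.

Let sum_ge0 n w : 0 <= dickman_sum n w.
Proof.
elim: n => [//|n ih]; apply: addr_ge0 => //.
by have /andP[] := prod01 n.+1 w.
Qed.

Let sum_nd w : {homo dickman_sum^~ w : m n / (m <= n)%N >-> m <= n}.
Proof.
apply/nondecreasing_seqP => n /=; rewrite lerDl.
by have /andP[] := prod01 n.+1 w.
Qed.

Let bsum n : bmeas (dickman_sum n).
Proof.
elim: n => [|n ih]; first exact: bmeas_cst.
by apply: bmeasD => //; exact: (bprod n.+1).
Qed.

Let rate : R := (1 + theta^-1)^-1.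

Let continuous_exp_scaled : continuous (fun x : R => expR (- (x / theta)) : R).
Proof.
move=> x; apply: (@continuous_comp _ _ _ (fun x : R => - (x / theta)) expR); last exact: continuous_expR.
by apply: cvgN; apply: cvgM; [exact: cvg_id|exact: cvg_cst].
Qed.

Let mean_factor : \int[std_exponential R]_x dickman_factor x = rate.
Proof.
have k0 : 0 < 1 + theta^-1 by rewrite addr_gt0 ?invr_gt0.
have -> : \int[std_exponential R]_x dickman_factor x =
    \int[std_exponential R]_x expR (- (x / theta)).
  rewrite !mean_std_exponential; last 2 first.
  - exact: (continuous_measurable_fun continuous_exp_scaled).
  - exact: continuous_measurable_fun.
  apply: eq_Rintegral => x; rewrite inE/= in_itv/= andbT => x0.
  by rewrite /dickman_factor ger0_norm.
have dF (x : R) : is_derive (x : R) (1 : R) (fun x : R => - (rate * expR (- ((1 + theta^-1) * x))))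
    (expR (- (x / theta)) * expR (- x)).
  apply: is_derive_eq; rewrite /GRing.scale/= -expRD.
  rewrite (_ : - (x / theta) + - x = - ((1 + theta^-1) * x)); last by ring.
  by rewrite /rate; field; rewrite !gt_eqF// addr_gt0.
have := @std_exponential_FTC _ (fun x => expR (- (x / theta))) _ 1 _ _ dF.
rewrite mulr0 oppr0 expR0 mulr1 opprK; apply.
- exact: continuous_exp_scaled.
- move=> x x0; rewrite mul1r ger0_norm ?expR_ge0// (@le_trans _ _ 1)//.
    by rewrite -[leRHS]expR0 ler_expR oppr_le0 divr_ge0// ltW.
  by rewrite exprn_ege1// lerDl.
- apply: (@cvg_poly_exp _ (fun x => - (rate * expR (- ((1 + theta^-1) * x)))) 1) => x x0.
  rewrite mul1r normrN ger0_norm; last by rewrite mulr_ge0 ?expR_ge0// invr_ge0 ltW.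
  apply: ler_pM => //; [by rewrite invr_ge0 ltW| |].
    rewrite (@le_trans _ _ 1)//; first by rewrite /rate invf_le1// lerDl invr_ge0 ltW.
    by rewrite exprn_ege1// lerDl.
  by rewrite ler_expR lerN2 ler_peMl// lerDl invr_ge0 ltW.
Qed.

Let mean_prod n : \int[P]_w dickman_prod n w = rate ^+ n.
Proof.
elim: n => [|n ih]; first by rewrite expr0 mean_cst.
(* Independence is available for bounded test functions; clipping provides one and does not change
   products in [[0, 1]]. *)
pose clip (x : R) : R := Num.min `|x| 1.
have clip01 x : 0 <= clip x <= 1 by rewrite /clip le_min normr_ge0 ler01 ge_min lexx orbT.
have clipE n' w : clip (dickman_prod n' w) = dickman_prod n' w.
  by have /andP[h0 h1] := prod01 n' w; rewrite /clip ger0_norm// min_l.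
pose f (z : (R * R) * R) : R := clip z.1.2 * dickman_factor z.2.
have cclip : continuous clip.
  move=> x; apply: (@continuous_min _ _ (fun x : R => `|x|) (fun=> 1)); [exact: norm_continuous|exact: cvg_cst].
have bf : bmeas f.
  apply: bmeasM.
    apply: (@bmeas_comp _ _ _ _ _ (fun z : (R * R) * R => z.1.2) clip) => //.
      exact: (measurableT_comp measurable_snd measurable_fst).
    apply: (bmeas_line (M := 1)) => // x.
    by have /andP[? ?] := clip01 x; rewrite ger0_norm.
  apply: (@bmeas_comp _ _ _ _ _ (fun z : (R * R) * R => z.2) dickman_factor) => //; first exact: measurable_snd.
  apply: (bmeas_line (M := 1)) => // x.
  by have /andP[? ?] := factor01 x; rewrite ger0_norm.
have bfac : bmeas dickman_factor.
  apply: (bmeas_line (M := 1)) => // x.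
  by have /andP[? ?] := factor01 x; rewrite ger0_norm.
transitivity (\int[P]_w f ((dickman_sum n w, dickman_prod n w), E_ n w)).
  by apply: eq_Rintegral => w _; rewrite /f/= clipE.
rewrite indE// exprSr -ih.
transitivity (\int[P]_w (rate * dickman_prod n w)).
  apply: eq_Rintegral => w _; rewrite /f/= clipE meanZ; last exact: bmeas_comp.
  by rewrite lawE// mean_factor mulrC.
by rewrite meanZ// mulrC.
Qed.

Let rate01 : 0 < rate < 1.
Proof.
have k0 : 0 < 1 + theta^-1 by rewrite addr_gt0 ?invr_gt0.
by rewrite invr_gt0 k0/= invf_lt1// ltrDl invr_gt0.
Qed.

Let mean_sum n : \int[P]_w dickman_sum n w <= (1 - rate)^-1.
Proof.
have /andP[r0 r1] := rate01; have r10 : 0 < 1 - rate by rewrite subr_gt0.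
suff : (1 - rate) * \int[P]_w dickman_sum n w = rate - rate ^+ n.+1.
  move=> h; rewrite -[leRHS]mulr1 -ler_pdivrMl ?invr_gt0// invrK h.
  by rewrite lerBlDr ler_wpDr ?exprn_ge0// ltW.
elim: n => [|n ih]; first by rewrite mean_cst mulr0 expr1 subrr.
rewrite [X in _ * X](meanD P (bsum n) (bprod n.+1)) mulrDr ih mean_prod.
by rewrite [rate ^+ n.+2]exprS; ring.
Qed.

(** In the extended reals the monotone partial sums always converge, which makes the variable total
    and measurable. On the null event of divergence [fine] returns 0. *)
Definition dickman (w : T) : R := fine (limn (fun n => (dickman_sum n w)%:E)).

Let cvg_sumE w : (dickman_sum n w)%:E @[n --> \oo] --> limn (fun n => (dickman_sum n w)%:E).
Proof.
by apply: ereal_nondecreasing_is_cvgn => m n mn; rewrite lee_fin; exact: sum_nd.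
Qed.

Lemma measurable_dickman : measurable_fun setT dickman.
Proof.
apply: measurableT_comp => //.
apply: (emeasurable_fun_cvg (fun n w => (dickman_sum n w)%:E)) => [n|w _]; last exact: cvg_sumE.
by apply/measurable_EFinP; case: (bsum n).
Qed.

Lemma dickman_ge0 w : 0 <= dickman w.
Proof.
apply/fine_ge0/lime_ge; first by apply: cvgP; exact: cvg_sumE.
by apply: nearW => n; rewrite lee_fin.
Qed.

(** The means of the partial sums are dominated by a geometric series of ratio [rate < 1], so the
    extended limit is integrable by monotone convergence, hence finite almost everywhere. *)
Let ae_cvg : {ae P, forall w, dickman_sum n w @[n --> \oo] --> dickman w}.
Proof.
have mlim : measurable_fun setT (fun w => limn (fun n => (dickman_sum n w)%:E)).
  apply: (emeasurable_fun_cvg (fun n w => (dickman_sum n w)%:E)) => [n|w _]; last exact: cvg_sumE.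
  by apply/measurable_EFinP; case: (bsum n).
have lim0 w : (0 <= limn (fun n => (dickman_sum n w)%:E))%E.
  apply: lime_ge; first by apply: cvgP; exact: cvg_sumE.
  by apply: nearW => n; rewrite lee_fin.
have int_lim : P.-integrable setT (fun w => limn (fun n => (dickman_sum n w)%:E)).
  apply/integrableP; split => //.
  under eq_integral do rewrite gee0_abs//.
  rewrite (@monotone_convergence _ _ _ P setT measurableT (fun n w => (dickman_sum n w)%:E)).
  - apply: (@le_lt_trans _ _ ((1 - rate)^-1)%:E); last exact: ltry.
    apply: lime_le.
      apply: ereal_nondecreasing_is_cvgn => m n mn; apply: ge0_le_integral => //.
      + by move=> w _; rewrite lee_fin.
      + by apply/measurable_EFinP; case: (bsum m).
      + by apply/measurable_EFinP; case: (bsum n).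
      + by move=> w _; rewrite lee_fin; exact: sum_nd.
    by apply: nearW => n; rewrite -meanE// lee_fin.
  - by move=> n; apply/measurable_EFinP; case: (bsum n).
  - by move=> n w _; rewrite lee_fin.
  - by move=> w _ m n mn; rewrite lee_fin; exact: sum_nd.
apply: filterS (integrable_ae measurableT int_lim) => w /(_ Logic.I) lfin.
apply: (@fine_cvg _ _ _ _ (fun n => (dickman_sum n w)%:E)).
by rewrite /dickman fineK//; exact: cvg_sumE.
Qed.

Let prod_cvg0 w : cvgn (dickman_sum^~ w) -> dickman_prod n w @[n --> \oo] --> (0 : R).
Proof.
move=> cs; rewrite -(cvg_shiftS (dickman_prod^~ w)).
have -> : (fun n => dickman_prod n.+1 w) = (fun n => dickman_sum n.+1 w - dickman_sum n w).
  by apply/funext => n /=; rewrite addrC addKr.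
suff : dickman_sum n.+1 w - dickman_sum n w @[n --> \oo] -->
    limn (dickman_sum^~ w) - limn (dickman_sum^~ w) by rewrite subrr.
apply: cvgB => //.
by rewrite (cvg_shiftS (dickman_sum^~ w)).
Qed.

(** By harmonicity and independence the mean of [Phi] at [(dickman_sum n, dickman_prod n)] keeps its
    value [Phi 0 1] from [n = 0]. Where the series converges the products tend to 0, so bounded
    convergence gives the mean of [Phi] at [(dickman, 0)], where both primitives vanish. *)
Lemma dickman_transform a u c0 : 0 <= a ->
  \int[P]_w (expR (- (a * dickman w)) * cos (u * dickman w + c0)) =
  expR (theta * primitive (expo_re a u) 1) * cos (theta * primitive (expo_im a u) 1 + c0).
Proof.
move=> a0; pose Phi := dickman_fun a u theta c0.
have Phi1 w x : 0 <= w -> 0 <= x -> `|Phi w x| <= 1 by exact: dickman_fun_norm.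
(* Absolute values extend [Phi] from the quadrant, where it is bounded by 1, to a bounded continuous
   function on the plane. *)
have cPhi : continuous (fun z : R * R => Phi `|z.1| `|z.2|).
  apply: continuous_dickman_comp => [z|z|z].
  - by apply: (@continuous_comp _ _ _ fst (fun x : R => `|x|)); [exact: cvg_fst|exact: norm_continuous].
  - by apply: (@continuous_comp _ _ _ snd (fun x : R => `|x|)); [exact: cvg_snd|exact: norm_continuous].
  - by rewrite (lt_le_trans _ (normr_ge0 _))// ltrN10.
have bPhi : bmeas (fun z : R * R => Phi `|z.1| `|z.2|).
  by apply: (bmeas_plane (M := 1)) => // z; exact: Phi1.
have step n : \int[P]_w Phi (dickman_sum n w) (dickman_prod n w) = Phi 0 1.
  elim: n => [|n <-]; first exact: (mean_cst P (Phi 0 1)).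
  pose f (z : (R * R) * R) : R :=
    Phi `|z.1.1 + z.1.2 * dickman_factor z.2| `|z.1.2 * dickman_factor z.2|.
  have bf : bmeas f.
    apply: (@bmeas_comp _ _ _ _ _ (fun z : (R * R) * R =>
      (z.1.1 + z.1.2 * dickman_factor z.2, z.1.2 * dickman_factor z.2)) _ _ bPhi).
    have m2 : measurable_fun setT (fun z : (R * R) * R => z.1.2 * dickman_factor z.2).
      apply: measurable_funM; first exact: (measurableT_comp measurable_snd measurable_fst).
      apply: (@measurableT_comp _ _ _ _ _ _ dickman_factor) => //.
      exact: continuous_measurable_fun.
    apply: measurable_fun_pair => //; apply: measurable_funD => //.
    exact: (measurableT_comp measurable_fst measurable_fst).
  transitivity (\int[P]_w f ((dickman_sum n w, dickman_prod n w), E_ n w)).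
    apply: eq_Rintegral => w _; rewrite /f/= !ger0_norm//.
    - by have /andP[] := prod01 n.+1 w.
    - exact: (sum_ge0 n.+1 w).
  rewrite indE//; apply: eq_Rintegral => w _.
  have /andP[p0 _] := prod01 n w.
  rewrite -[RHS](@dickman_harmonic _ a u theta c0 a0 theta0)//.
  rewrite (lawE n (f := fun x => f (dickman_sum n w, dickman_prod n w, x))); last exact: bmeas_pair1.
  rewrite !mean_std_exponential.
  - apply: eq_Rintegral => x; rewrite inE/= in_itv/= andbT => x0.
    rewrite /f/= /dickman_factor (ger0_norm x0) !ger0_norm//.
      by rewrite mulr_ge0 ?expR_ge0.
    by rewrite addr_ge0// mulr_ge0 ?expR_ge0.
  - apply: continuous_measurable_fun; apply: continuous_dickman_comp => [y|y|y].
    + apply: cvgD; [exact: cvg_cst|apply: cvgM; [exact: cvg_cst|]].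
      exact: continuous_exp_scaled.
    + by apply: cvgM; [exact: cvg_cst|exact: continuous_exp_scaled].
    + by rewrite (@lt_le_trans _ _ 0)// ?ltrN10// mulr_ge0// expR_ge0.
  - by case: (bmeas_pair1 bf (dickman_sum n w, dickman_prod n w)).
have lim : \int[P]_w Phi (dickman_sum n w) (dickman_prod n w) @[n --> \oo] -->
    \int[P]_w Phi (dickman w) 0.
  apply: (@mean_cvg _ _ _ _ _ _ 1).
  - move=> n; rewrite (_ : (fun w => _) =
      (fun w => (fun z : R * R => Phi `|z.1| `|z.2|) (dickman_sum n w, dickman_prod n w))).
      apply: (@measurableT_comp _ _ _ _ _ _ (fun z : R * R => Phi `|z.1| `|z.2|) _
        (fun w => (dickman_sum n w, dickman_prod n w))); first by case: bPhi.
      by apply: measurable_fun_pair => //; case: (bsum n).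
    apply/funext => w /=; have /andP[p0 _] := prod01 n w.
    by rewrite !ger0_norm.
  - rewrite (_ : (fun w => _) =
      (fun w => (fun z : R * R => Phi `|z.1| `|z.2|) (dickman w, 0))).
      apply: (@measurableT_comp _ _ _ _ _ _ (fun z : R * R => Phi `|z.1| `|z.2|) _
        (fun w => (dickman w, 0))); first by case: bPhi.
      by apply: measurable_fun_pair => //; exact: measurable_dickman.
    by apply/funext => w /=; rewrite !ger0_norm// dickman_ge0.
  - by move=> n w; apply: Phi1 => //; have /andP[] := prod01 n w.
  - apply: filterS ae_cvg => w cw.
    have pw := prod_cvg0 (cvgP _ cw).
    have := @continuous_cvg _ _ _ _ _ (fun n => (dickman_sum n w, dickman_prod n w)) _ (dickman w, 0)
      (cPhi (dickman w, 0)).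
    have cwp : (dickman_sum n w, dickman_prod n w) @[n --> \oo] --> (dickman w, 0 : R).
      by apply: (cvg_pair (G := nbhs (dickman w)) (H := nbhs (0 : R))).
    move=> /(_ _ _ cwp) /=.
    rewrite normr0 (ger0_norm (dickman_ge0 w)).
    apply: cvg_trans; apply: near_eq_cvg; apply: nearW => n /=.
    by have /andP[p0 _] := prod01 n w; rewrite !ger0_norm.
transitivity (\int[P]_w Phi (dickman w) 0).
  apply: eq_Rintegral => w _.
  by rewrite /Phi /dickman_fun !primitive0 !mulr0 !addr0.
have e : (fun n => \int[P]_w Phi (dickman_sum n w) (dickman_prod n w)) = fun=> Phi 0 1.
  by apply/funext.
move: lim; rewrite e => /cvg_lim <-//.
by rewrite lim_cst// /Phi /dickman_fun !mulr0 oppr0 !add0r.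
Qed.

End DickmanVariable.

(** * Sums over independent families *)

Section SigmaOf.
Context d (T : measurableType d) d' (T' : measurableType d') (X : T -> T').

Lemma sigma_of_preimage B : measurable B -> sigma_of X (X @^-1` B).
Proof. by move=> mB; exists B => //; rewrite setTI. Qed.

Lemma sigma_of_measurable : measurable_fun setT X -> sigma_of X `<=` measurable.
Proof. by move=> mX _ [B mB <-]; exact: mX. Qed.

Lemma sigma_ofT : sigma_of X setT.
Proof. by exists setT => //; rewrite setIT. Qed.

Lemma sigma_ofI : setI_closed (sigma_of X).
Proof.
move=> _ _ [B mB <-] [C mC <-]; exists (B `&` C); first exact: measurableI.
by rewrite !setTI.
Qed.

End SigmaOf.

Section IndependentSequences.
Context (R : realType) d (T : measurableType d) (P : probability T R).
Variables (I : choiceType) (D : set I) (F : I -> set (set T)).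
Hypothesis Fm : forall i, F i `<=` measurable.
Hypothesis FT : forall i, F i setT.
Hypothesis FI : forall i, setI_closed (F i).
Hypothesis indF : mutually_independent P D F.

(** The same points with the sigma-algebra of a block: depending only on the block becomes ordinary
    measurability, with all its closure properties. *)
Definition generated_by (J : set I) : Type := g_sigma_algebraType (\bigcup_(i in J) F i).

HB.instance Definition _ J := Measurable.on (generated_by J).

Lemma generated_preimage J d' (U : measurableType d') (X : T -> U) :
  measurable_fun (setT : set (generated_by J)) X ->
  forall A, measurable A -> generated F J (X @^-1` A).
Proof. by move=> mX A mA; have := mX measurableT A mA; rewrite setTI. Qed.

Lemma measurable_generated_by J i d' (U : measurableType d') (X : T -> U) :
  J i -> (forall A, measurable A -> F i (X @^-1` A)) ->
  measurable_fun (setT : set (generated_by J)) X.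
Proof.
move=> Ji FX _ A mA; rewrite setTI; apply: sub_sigma_algebra.
by exists i => //; exact: FX.
Qed.

Lemma generated_sum (t : seq I) (Z : I -> T -> R) :
  (forall i, i \in t -> forall A, measurable A -> F i (Z i @^-1` A)) ->
  forall A, measurable A -> generated F [set` t] ((fun w => \sum_(i <- t) Z i w) @^-1` A).
Proof.
move=> FZ; apply: generated_preimage.
have -> : (fun w => \sum_(i <- t) Z i w) =
    (fun w => \sum_(i <- t) (if i \in t then Z i w else 0)).
  by apply/funext => w; apply: eq_big_seq => i ->.
apply: (@measurable_sum _ (generated_by [set` t])) => i.
have [it|_] := boolP (i \in t); last exact: measurable_cst.
by apply: (@measurable_generated_by [set` t] i) => // A mA; exact: FZ.
Qed.

Variable s : seq I.
Hypothesis us : uniq s.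
Hypothesis sD : forall i, i \in s -> D i.

(** Adding [Z i] counts as [a i] smoothing steps, so summands of different sizes compose into one
    iterate. The induction peels off a summand, independent of the sum of the others. *)
Lemma mean_smooth_sum (m : probability R R) c (Z : I -> T -> R) (a : I -> nat) (f : R -> R) x :
  (forall i, i \in s -> forall A, measurable A -> F i (Z i @^-1` A)) ->
  (forall i, i \in s -> forall g y, bmeas g ->
     \int[P]_w g (y + c * Z i w) = iter (a i) (smooth m c) g y) ->
  bmeas f ->
  \int[P]_w f (x + c * \sum_(i <- s) Z i w) = iter (\sum_(i <- s) a i) (smooth m c) f x.
Proof.
elim: s us sD f => [_ _ f _ _ bf|k t ih /= /andP[kt ut] tD f FZ EZ bf].
  by rewrite big_nil; under eq_Rintegral do rewrite big_nil mulr0 addr0; exact: mean_cst.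
have bs n g : bmeas g -> bmeas (iter n (smooth m c) g).
  by move=> bg; elim: n => // n; exact: bmeas_smooth.
have tD' i : i \in t -> D i by move=> it; apply: tD; rewrite inE it orbT.
pose h (z : R * R) : R := f (x + c * z.1 + c * z.2).
have bh : bmeas h.
  apply: (@bmeas_comp _ _ _ _ _ (fun z : R * R => x + c * z.1 + c * z.2)) => //.
  by apply: measurable_funD => //; [apply: measurable_funD => //|]; exact: measurable_funM.
transitivity (\int[P]_w h (\sum_(i <- t) Z i w, Z k w)).
  by apply: eq_Rintegral => w _; rewrite big_cons /h/= mulrDr addrCA addrC.
rewrite (@mean_decouple _ _ _ P _ D F [set` t] [set k])//.
- transitivity (\int[P]_w (iter (a k) (smooth m c) f) (x + c * \sum_(i <- t) Z i w)).
    apply: eq_Rintegral => w _; rewrite /h/=; apply: EZ => //; exact: mem_head.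
  rewrite big_cons addnC iterD; apply: ih => //; [| |exact: bs].
    by move=> i it; apply: FZ; rewrite inE it orbT.
  by move=> i it; apply: EZ; rewrite inE it orbT.
- by move=> _ ->; apply: tD; exact: mem_head.
- by apply/disj_setPS => i [/= it ik]; move: kt; rewrite -ik it.
- by apply: generated_sum => i it; apply: FZ; rewrite inE it orbT.
- apply: generated_preimage; apply: (@measurable_generated_by [set k] k) => //.
  by apply: FZ; exact: mem_head.
Qed.

Lemma mean_exp_sum (Z : I -> T -> R) :
  (forall i, i \in s -> forall A, measurable A -> F i (Z i @^-1` A)) ->
  (forall i w, 0 <= Z i w) ->
  \int[P]_w expR (- \sum_(i <- s) Z i w) = \prod_(i <- s) \int[P]_w expR (- Z i w).
Proof.
elim: s us sD => [_ _ _ _|k t ih /= /andP[kt ut] tD FZ Z0].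
  rewrite big_nil; under eq_Rintegral do rewrite big_nil oppr0 expR0.
  exact: mean_cst.
have tD' i : i \in t -> D i by move=> it; apply: tD; rewrite inE it orbT.
(* Absolute values make the test function bounded on the plane and disappear on nonnegative sums. *)
have bexp : bmeas (fun x : R => expR (- `|x|) : R) by exact: bmeas_expN.
pose h (z : R * R) : R := expR (- `|z.1|) * expR (- `|z.2|).
have bh : bmeas h.
  apply: bmeasM.
    exact: (@bmeas_comp _ _ _ _ _ (fun z : R * R => z.1) _ measurable_fst bexp).
  exact: (@bmeas_comp _ _ _ _ _ (fun z : R * R => z.2) _ measurable_snd bexp).
have bZ : bmeas (fun w => expR (- `|Z k w|)).
  apply: (@bmeas_comp _ _ _ _ _ (Z k) _ _ bexp) => _ A mA; rewrite setTI.
  by apply: (Fm (i := k)); apply: FZ => //; exact: mem_head.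
transitivity (\int[P]_w h (\sum_(i <- t) Z i w, Z k w)).
  apply: eq_Rintegral => w _; rewrite big_cons /h/= -expRD !ger0_norm ?sumr_ge0//.
  by rewrite opprD addrC.
rewrite (@mean_decouple _ _ _ P _ D F [set` t] [set k])//.
- rewrite big_cons -ih//; last by move=> i it; apply: FZ; rewrite inE it orbT.
  rewrite -meanZ.
    apply: eq_Rintegral => w _; rewrite /h/= meanZ// mulrC ger0_norm ?sumr_ge0//.
    by congr (_ * _); apply: eq_Rintegral => v _; rewrite ger0_norm.
  have -> : (fun w => expR (- \sum_(i <- t) Z i w)) = (fun w => expR (- `|\sum_(i <- t) Z i w|)).
    by apply/funext => w; rewrite ger0_norm ?sumr_ge0.
  apply: (@bmeas_comp _ _ _ _ _ _ _ _ bexp) => _ A mA; rewrite setTI.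
  by apply: (generated_measurable Fm (J := [set` t])); apply: generated_sum => // i it; apply: FZ; rewrite inE it orbT.
- by move=> _ ->; apply: tD; exact: mem_head.
- by apply/disj_setPS => i [/= it ik]; move: kt; rewrite -ik it.
- by apply: generated_sum => i it; apply: FZ; rewrite inE it orbT.
- apply: generated_preimage; apply: (@measurable_generated_by [set k] k) => //.
  by apply: FZ; exact: mem_head.
Qed.

End IndependentSequences.

(** * Gamma and Poisson variables *)

Section Laws.
Context (R : realType) d (T : measurableType d) (P : probability T R).

Lemma eq_measure_mean d' (T' : measurableType d') (m1 m2 : {measure set T' -> \bar R}) (f : T' -> R) :
  (forall A, measurable A -> m1 A = m2 A) -> \int[m1]_x f x = \int[m2]_x f x.
Proof.
move=> m12; rewrite /Rintegral; f_equal.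
by apply: eq_measure_integral => A mA _; exact: m12.
Qed.

Lemma has_law_mean d' (T' : measurableType d') (X : {RV P >-> T'}) (m : probability T' R) f :
  has_law P X m -> bmeas f -> \int[P]_w f (X w) = \int[m]_x f x.
Proof.
by move=> lX bf; rewrite -(mean_distribution X bf); apply: eq_measure_mean => A /lX.
Qed.

End Laws.

Section GammaPoisson.
Context (R : realType) d (T : measurableType d) (P : probability T R).

(** A centred Gamma variable is a sum of [j] centred exponentials. Equality of laws moves the
    computation to the auxiliary space where these exist, and each of them is one smoothing step. *)
Lemma gamma_smooth j (X : {RV P >-> R}) c f x : is_gamma1 j (distribution P X) -> bmeas f ->
  \int[P]_w f (x + c * (X w - j%:R)) = iter j (smooth (centred_exponential R) c) f x.
Proof.
move=> [d' [T' [P' [E [[indE lawE] XE]]]]] bf.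
have bs (y a : R) (g : R -> R) : bmeas g -> bmeas (fun z : R => g (y + c * (z - a))).
  move=> bg; apply: (@bmeas_comp _ _ _ _ _ (fun z : R => y + c * (z - a)) _ _ bg).
  by apply: measurable_funD => //; apply: measurable_funM => //; exact: measurable_funB.
have mS : measurable_fun setT (fun w => \sum_(i < j) E i w) by exact: measurable_sum.
pose S : {mfun T' >-> R} := HB.pack (fun w => \sum_(i < j) E i w)
  (isMeasurableFun.Build _ _ _ _ (fun w => \sum_(i < j) E i w) mS).
transitivity (\int[distribution P X]_y f (x + c * (y - j%:R))).
  by rewrite (mean_distribution X (bs x j%:R f bf)).
transitivity (\int[distribution P' S]_y f (x + c * (y - j%:R))).
  by apply: eq_measure_mean => A mA; exact: (XE A mA).
rewrite (mean_distribution S (bs x j%:R f bf)).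
transitivity (\int[P']_w f (x + c * \sum_(i <- index_enum 'I_j) (E i w - 1))).
  apply: eq_Rintegral => w _; do 3 f_equal.
  by rewrite sumrB/= sumr_const card_ord.
rewrite (@mean_smooth_sum _ _ _ P' _ _ (fun i => sigma_of (E i)) _ _ _ indE _ _ _
  (centred_exponential R) c (fun i w => E i w - 1) (fun=> 1%N))//.
- by rewrite sum1_card card_ord.
- by move=> i; exact: sigma_of_measurable.
- by move=> i; exact: sigma_ofT.
- by move=> i; exact: sigma_ofI.
- exact: index_enum_uniq.
- move=> i _ A mA; rewrite (_ : _ @^-1` A = E i @^-1` (@minus_one R @^-1` A))//.
  by apply: sigma_of_preimage; rewrite -[X in measurable X]setTI; exact: measurable_funPT.
- move=> i _ g y bg /=.
  have lE : has_law P' (E i) (std_exponential R).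
    by move=> A mA; rewrite lawE// std_exponentialE.
  rewrite (has_law_mean lE (bs y 1 g bg)) /smooth.
  by rewrite (@mean_distribution _ _ _ (std_exponential R) _ _ (@minus_one R) _ (bmeas_shift c y bg)).
Qed.

(** The truncations [f n] of [z^k] are finite sums of indicators, whose means are [exp(-l)] times
    the partial sums of the series of [exp(l z)]; bounded convergence removes the truncation. *)
Lemma poisson_exp (X : {RV P >-> nat}) (l t : R) : 0 < l -> 0 <= t ->
  has_law P X (poisson_prob l 0) ->
  \int[P]_w expR (- (t * (X w)%:R)) = expR (l * (expR (- t) - 1)).
Proof.
move=> l0 t0 lX; pose z := expR (- t).
have z0 : 0 <= z by exact: expR_ge0.
have z1 : z <= 1 by rewrite -[leRHS]expR0 ler_expR oppr_le0.
pose f n k : R := \sum_(i < n) z ^+ i * \1_[set (i : nat)] k.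
have fE n k : f n k = if (k < n)%N then z ^+ k else 0.
  rewrite /f; case: ifPn => kn.
    rewrite (bigD1 (Ordinal kn))//= indicE mem_set// mulr1 big1 ?addr0// => i ik.
    rewrite indicE memNset ?mulr0//= => ki; move: ik; rewrite -val_eqE/= ki eqxx//.
  rewrite big1// => i _; rewrite indicE memNset ?mulr0//= => ki.
  by move: kn; rewrite ki ltn_ord.
have mf (g : nat -> R) : measurable_fun setT (fun w => g (X w)).
  by apply: measurableT_comp.
have step n : \int[P]_w f n (X w) = expR (- l) * series (exp_coeff (l * z)) n.
  have bf i : bmeas (fun k : nat => z ^+ i * \1_[set i] k : R).
    by apply: bmeasM; [exact: bmeas_cst|exact: bmeas_indic].
  rewrite (has_law_mean (m := poisson_prob l 0) lX (f := f n)); last first.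
    by apply: bmeas_sum => i; exact: bf.
  rewrite mean_sum; last by move=> i; exact: bf.
  rewrite /series/= big_mkord mulr_sumr; apply: eq_bigr => i _.
  rewrite meanZ; last exact: bmeas_indic.
  have pE : poisson_prob l 0 [set (i : nat)] = (poisson_pmf l i)%:E.
    by rewrite /poisson_prob l0 esum_set1// lee_fin poisson_pmf_ge0.
  rewrite /Rintegral integral_indic// setIT [X in fine X]pE /=.
  by rewrite /poisson_pmf l0 /exp_coeff/= exprMn; ring.
have lim : \int[P]_w f n (X w) @[n --> \oo] --> \int[P]_w expR (- (t * (X w)%:R)).
  apply: (@mean_cvg _ _ _ _ _ _ 1) => //.
  - exact: (mf (fun k => expR (- (t * k%:R)))).
  - move=> n w; rewrite fE; case: ifP => _; last by rewrite normr0.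
    by rewrite ger0_norm ?exprn_ge0// exprn_ile1.
  - apply: aeW => w; apply: cvg_near_cst; near=> n; rewrite fE ifT.
      by rewrite /z -expRM_natr mulNr.
    by near: n; exact: nbhs_infty_gt.
move: lim; rewrite (_ : (fun n => _) = (fun n => expR (- l) * series (exp_coeff (l * z)) n)); last first.
  by apply/funext.
have /cvg_lim c : expR (- l) * series (exp_coeff (l * z)) n @[n --> \oo] --> expR (- l) * expR (l * z).
  by apply: cvgMr; exact: is_cvg_series_exp_coeff.
by move=> /cvg_lim <-//; rewrite c// -expRD; rewrite /z; congr expR; rewrite mulrBr mulr1 addrC.
Unshelve. all: by end_near. Qed.

End GammaPoisson.

(** * Convergence of Riemann sums, and measurability of random sums *)

Section RiemannSum.
Context (R : realType).

(** [primitive g 1] telescopes over the cells, the mean value theorem turns each increment into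
    [g c / n], and uniform continuity compares [g c] with the value at the right end. *)
Lemma riemann_sum_cvg (g : R -> R) : continuous g ->
  \sum_(1 <= j < n.+1) g (j%:R / n%:R) / n%:R @[n --> \oo] --> primitive g 1.
Proof.
move=> cg; apply/cvgrPdist_le => e e0.
have cf : continuous (fun z : R * R => g z.1).
  by move=> z; apply: (@continuous_comp _ _ _ fst g); [exact: cvg_fst|exact: cg].
have cK : compact ((`[0, 1] : set R) `*` (`[0, 1] : set R)).
  by apply: compact_setX; exact: segment_compact.
have [dl dl0 unif] := compact_unif_first cf cK e0.
near=> n.
have n0 : (0 < n)%N by near: n; exact: nbhs_infty_gt.
have n0' : 0 < n%:R :> R by rewrite ltr0n.
have ndl : n%:R^-1 < dl.
  rewrite invf_plt ?posrE//; near: n; exact: nbhs_infty_gtr.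
have -> : primitive g 1 = \sum_(1 <= j < n.+1) (primitive g (j%:R / n%:R) - primitive g (j.-1%:R / n%:R)).
  rewrite big_add1/= (telescope_sumr (fun j => primitive g (j%:R / n%:R)))//.
  by rewrite mul0r primitive0 subr0 divff ?gt_eqF.
rewrite -sumrB (le_trans (ler_norm_sum _ _ _))//.
rewrite (@le_trans _ _ (\sum_(1 <= j < n.+1) e / n%:R))//; last first.
  by rewrite sumr_const_nat subn1/= -[X in X <= _]mulr_natr divfK ?gt_eqF.
rewrite big_nat [leRHS]big_nat; apply: ler_sum => -[//|j] /andP[_ jn].
have x0 k : 0 <= k%:R / n%:R :> R by rewrite divr_ge0.
have jj : j%:R / n%:R <= j.+1%:R / n%:R :> R by rewrite ler_pM2r ?invr_gt0// ler_nat.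
have j1 : j.+1%:R / n%:R <= 1 :> R by rewrite ler_pdivrMr// mul1r ler_nat.
have dp (x : R) : x \in `]j%:R / n%:R, j.+1%:R / n%:R[%R -> is_derive (x : R) (1 : R) (primitive g) (g x).
  rewrite in_itv/= => /andP[xj _]; apply: primitive_derive => //.
  by rewrite (lt_trans _ (le_lt_trans (x0 j) xj))// ltrN10.
have [|c cj ->] := MVT_segment jj dp.
  apply: continuous_in_subspaceT => x; rewrite inE/= in_itv/= => /andP[xj _].
  apply: differentiable_continuous; apply/derivable1_diffP.
  by case: (primitive_derive cg (lt_le_trans (ltrN10 R) (le_trans (x0 j) xj))).
move: cj; rewrite in_itv/= => /andP[cj1 cj2].
have sub : j.+1%:R / n%:R - j%:R / n%:R = n%:R^-1 :> R.
  by rewrite -mulrBl -natr1 addrAC subrr add0r mul1r.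
rewrite sub -mulrBl normrM (ger0_norm (ltW (_ : 0 < n%:R^-1))) ?invr_gt0//.
rewrite ler_pM2r ?invr_gt0//; apply: (unif c 0).
- split; rewrite /= in_itv/= ?lexx ?ler01// (le_trans (x0 j))//=.
  exact: le_trans j1.
- apply: le_lt_trans ndl; rewrite ler0_norm ?subr_le0// opprB.
  by apply: (@le_trans _ _ (j.+1%:R / n%:R - j%:R / n%:R)); [exact: lerB|rewrite sub].
Unshelve. all: by end_near. Qed.

End RiemannSum.

(** Measurability for a block is known for positive indices only, hence the restriction to [a <= i];
    terms below [a] do not enter the sum and may be set to 0. *)
Lemma measurable_sum_nat (R : realType) d (U : measurableType d) a b (Y : nat -> U -> R) :
  (forall i, (a <= i)%N -> measurable_fun setT (Y i)) ->
  measurable_fun setT (fun z => \sum_(a <= i < b) Y i z).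
Proof.
move=> mY; have -> : (fun z => \sum_(a <= i < b) Y i z) =
    (fun z => \sum_(a <= i < b) if (a <= i)%N then Y i z else 0).
  by apply/funext => z; apply: eq_big_nat => i /andP[-> _].
apply: measurable_sum => i.
by have [ai|_] := boolP (a <= i)%N; [exact: mY|exact: measurable_cst].
Qed.

Lemma measurable_random_index_sum (R : realType) d (U : measurableType d)
    (N : U -> nat) (Y : nat -> U -> R) :
  measurable_fun setT N -> (forall i, (1 <= i)%N -> measurable_fun setT (Y i)) ->
  measurable_fun setT (fun z => \sum_(1 <= i < (N z).+1) Y i z).
Proof.
move=> mN mY _ A mA; rewrite setTI.
pose s k z : R := \sum_(1 <= i < k.+1) Y i z.
rewrite (_ : _ @^-1` A = \bigcup_k (N @^-1` [set k] `&` s k @^-1` A)).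
  apply: bigcup_measurable => k _; apply: measurableI.
    by rewrite -[X in measurable X]setTI; exact: mN.
  rewrite -[X in measurable X]setTI; suff : measurable_fun setT (s k) by apply.
  by apply: measurable_sum_nat => i; exact: mY.
by apply/seteqP; split => [w Aw|w [k _ [/= <-]]//]; exists (N w).
Qed.

Lemma measurable_natmul_inv (R : realType) d (U : measurableType d) (X : U -> nat) :
  measurable_fun setT (fun z => (X z)%:R : R) -> measurable_fun setT X.
Proof.
move=> mX _ A _; rewrite setTI.
rewrite (_ : X @^-1` A = \bigcup_(k in A) ((fun z => (X z)%:R : R) @^-1` [set k%:R])).
  apply: bigcup_measurable => k _; rewrite -[X in measurable X]setTI.
  by apply: mX => //; exact: measurable_set1.
apply/seteqP; split => [z Az|z [k Ak /= /eqP]]; first by exists (X z).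
by rewrite eqr_nat => /eqP ->.
Qed.

(** * The pair [(V_n, W_n)] *)

Section PoissonGamma.
Context (R : realType) d (T : measurableType d) (P : probability T R).
Variables (N : nat -> {RV P >-> nat}) (S : nat -> nat -> {RV P >-> R}).

Definition poisson_gamma_index : set (nat + nat * nat) :=
  [set k : nat + nat * nat |
    match k with
    | inl j => (1 <= j)%N
    | inr (j, i) => (1 <= j)%N && (1 <= i)%N
    end].

Definition poisson_gamma_events (k : nat + nat * nat) : set (set T) :=
  match k with
  | inl j => sigma_of (N j)
  | inr (j, i) => sigma_of (S j i)
  end.

Local Notation D := poisson_gamma_index.
Local Notation F := poisson_gamma_events.

Hypothesis hN : forall j : nat, (1 <= j)%N -> has_law P (N j) (poisson_prob (j%:R^-1) 0).
Hypothesis hS : forall j i : nat, (1 <= j)%N -> (1 <= i)%N ->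
  is_gamma1 j (distribution P (S j i)).
Hypothesis hind : mutually_independent P D F.

Let Fm k : F k `<=` measurable.
Proof. by case: k => [j|[j i]]; exact: sigma_of_measurable. Qed.

Let FT k : F k setT.
Proof. by case: k => [j|[j i]]; exact: sigma_ofT. Qed.

Let FI k : setI_closed (F k).
Proof. by case: k => [j|[j i]]; exact: sigma_ofI. Qed.

Definition exponential_copy n : T -> R := S 1 n.+1.
Local Notation E := exponential_copy.

Lemma exponential_copy_law n (f : R -> R) : bmeas f ->
  \int[P]_w f (E n w) = \int[std_exponential R]_x f x.
Proof.
move=> bf; have := gamma_smooth 1 1 (hS (isT : (1 <= 1)%N) (ltn0Sn n)) bf.
rewrite /= /smooth (@mean_distribution _ _ _ (std_exponential R) _ _ (@minus_one R) _ (bmeas_shift 1 1 bf)).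
under eq_Rintegral do rewrite mul1r addrC subrK.
move=> ->; apply: eq_Rintegral => x _.
by rewrite mul1r /minus_one addrC subrK.
Qed.

(** The first [n] partial terms use the keys [(1, 1)] to [(1, n)], while [E n] has key
    [(1, n + 1)]. *)
Lemma exponential_copy_indep theta n (f : (R * R) * R -> R) : bmeas f ->
  \int[P]_w f ((dickman_sum E theta n w, dickman_prod E theta n w), E n w) =
  \int[P]_w \int[P]_v f ((dickman_sum E theta n w, dickman_prod E theta n w), E n v).
Proof.
pose J1 : set (nat + nat * nat) := [set inr (1%N, k.+1) | k in [set k | (k < n)%N]].
pose J2 : set (nat + nat * nat) := [set inr (1%N, n.+1)].
apply: (@mean_decouple _ _ _ P _ D F J1 J2) => //.
- by move=> _ [k _ <-].
- by move=> _ ->.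
- by apply/disj_setPS => _ [[k /= kn <-]] [kk]; move: kn; rewrite kk ltnn.
- apply: generated_preimage; have mE k : (k < n)%N ->
      measurable_fun (setT : set (generated_by F J1)) (E k).
    move=> kn; apply: (@measurable_generated_by _ _ _ F J1 (inr (1%N, k.+1))); first by exists k.
    by move=> A mA; exact: sigma_of_preimage.
  apply: measurable_fun_pair.
    exact: (@measurable_dickman_sum _ _ (generated_by F J1)).
  exact: (@measurable_dickman_prod _ _ (generated_by F J1)).
- move=> A mA; apply: sub_sigma_algebra; exists (inr (1%N, n.+1)) => //.
  exact: sigma_of_preimage.
Qed.

(** The Poisson exponent [(1/j) (e^(-m j/n) - 1)] is [1/n] times the value of [(e^(-m v) - 1) / v]
    at [v = j/n]: the means [1/j] are what produces a Riemann sum of mesh [1/n]. *)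
Lemma Wn_laplace (m n : nat) : (0 < n)%N ->
  \int[P]_w expR (- (m%:R * Wn N n w)) =
  expR (\sum_(1 <= j < n.+1) expo_re m%:R 0 (j%:R / n%:R) / n%:R).
Proof.
move=> n0; have n0' : 0 < n%:R :> R by rewrite ltr0n.
pose t j : R := m%:R * j%:R / n%:R.
have t0 j : 0 <= t j by rewrite /t divr_ge0// mulr_ge0.
pose Z (k : nat + nat * nat) (w : T) : R := if k is inl j then t j * (N j w)%:R else 0.
pose s : seq (nat + nat * nat) := [seq inl j | j <- index_iota 1 n.+1].
transitivity (\int[P]_w expR (- \sum_(k <- s) Z k w)).
  apply: eq_Rintegral => w _; rewrite /s big_map/= /Wn /Tsum mulr_suml mulr_sumr.
  congr (expR (- _)); apply: eq_bigr => j _; rewrite natrM /t; ring.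
rewrite (@mean_exp_sum _ _ _ P _ D F)//.
- rewrite /s big_map expR_sum big_nat [RHS]big_nat; apply: eq_bigr => j /andP[j1 jn] /=.
  have j0 : 0 < j%:R :> R by rewrite ltr0n.
  rewrite (@poisson_exp _ _ _ _ (N j) j%:R^-1) ?invr_gt0//; last exact: hN.
  congr expR; have := expo_reE m%:R 0 (j%:R / n%:R : R).
  rewrite mul0r cos0 mulr1 mulrA -/(t j) => <-.
  by field; rewrite !gt_eqF.
- by rewrite /s map_inj_uniq ?iota_uniq// => ? ? [].
- by move=> k /mapP[j]; rewrite mem_index_iota => /andP[j1 _] ->.
- move=> k /mapP[j _ ->] A mA.
  rewrite (_ : _ @^-1` A = N j @^-1` ((fun k : nat => t j * k%:R) @^-1` A))//.
  exact: sigma_of_preimage.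
- by move=> [j|//] w; rewrite mulr_ge0.
Qed.

Let mE n : measurable_fun setT (E n) := @measurable_funPT _ _ _ _ (S 1 n.+1).

Definition dickman_limit : T -> R := dickman E 1.
Local Notation W := dickman_limit.

Lemma dickman_laplace theta (k : R) : 0 < theta -> 0 <= k ->
  \int[P]_w expR (- (k * dickman E theta w)) = expR (theta * primitive (expo_re k 0) 1).
Proof.
move=> th0 k0.
have := dickman_transform th0 mE exponential_copy_law (exponential_copy_indep theta) 0 0 k0.
rewrite (_ : expo_im k 0 = fun=> 0); last first.
  by apply/funext => v; rewrite /expo_im /slope !mul0r sin0 !mulr0 subrr mul0r if_same.
rewrite (_ : primitive (fun=> 0) 1 = 0); last first.
  rewrite primitiveE//; last by move=> x; exact: cst_continuous.
  by rewrite /Rintegral integral0.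
rewrite mulr0 add0r cos0 mulr1 => <-.
by apply: eq_Rintegral => w _; rewrite mul0r add0r cos0 mulr1.
Qed.

Lemma Wn_ge0 n w : 0 <= Wn N n w.
Proof. by rewrite /Wn divr_ge0// sumr_ge0. Qed.

Lemma cvg_mean_Wn (f : R -> R) M : continuous f -> (forall x, `|f x| <= M) ->
  cvg_mean P P (Wn N) W f.
Proof.
move=> cf fM; apply: laplace_weak_cvg cf fM => //.
- exact: measurable_dickman.
- exact: Wn_ge0.
- exact: dickman_ge0.
- move=> m; rewrite /dickman_limit (dickman_laplace ltr01 (ler0n R m)) mul1r.
  have c : expR (\sum_(1 <= j < n.+1) expo_re m%:R 0 (j%:R / n%:R) / n%:R : R) @[n --> \oo] -->
      expR (primitive (expo_re m%:R 0) 1).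
    apply: cvg_comp (riemann_sum_cvg (@continuous_expo_re _ m%:R 0)) _.
    exact: continuous_expR.
  apply: cvg_trans c; apply: near_eq_cvg; near=> n.
  by rewrite Wn_laplace//; near: n; exact: nbhs_infty_gt.
Unshelve. all: by end_near. Qed.

(** The counts and the gammas form disjoint blocks. With the counts frozen, [V_n] is a scaled sum of
    independent centred gammas, that is, of [T_n] centred exponentials. *)
Lemma Vn_decouple n (f g : R -> R) Mf Mg : continuous f -> continuous g ->
  (forall x, `|f x| <= Mf) -> (forall x, `|g x| <= Mg) ->
  \int[P]_w (f (Vn N S n w) * g (Wn N n w)) =
  \int[P]_w (iter (\sum_(1 <= j < n.+1) j * N j w)%N
    (smooth (centred_exponential R) (Num.sqrt n%:R)^-1) f 0 * g (Wn N n w)).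
Proof.
move=> cf cg fM gM; set c := (Num.sqrt n%:R)^-1.
have bf : bmeas f by apply: (bmeas_line (M := Mf)).
have bg : bmeas g by apply: (bmeas_line (M := Mg)).
pose J1 : set (nat + nat * nat) := [set inl j | j in [set j | (1 <= j)%N]].
pose J2 : set (nat + nat * nat) := [set inr p | p in [set p : nat * nat | (1 <= p.1)%N && (1 <= p.2)%N]].
(* [T1] and [T2] are two copies of the sample space, one for each block; [h] reads the counts from
   the first and the gammas from the second. *)
pose T1 : measurableType _ := generated_by F J1.
pose T2 : measurableType _ := generated_by F J2.
have mN j : (1 <= j)%N -> measurable_fun (setT : set T1) (N j).
  move=> j1; apply: (@measurable_generated_by _ _ _ F J1 (inl j)); first by exists j.
  by move=> A mA; exact: sigma_of_preimage.
have mS j i : (1 <= j)%N -> (1 <= i)%N -> measurable_fun (setT : set T2) (S j i).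
  move=> j1 i1; apply: (@measurable_generated_by _ _ _ F J2 (inr (j, i))).
    by exists (j, i) => //=; rewrite j1 i1.
  by move=> A mA; exact: sigma_of_preimage.
pose V (z : T1 * T2) : R :=
  c * \sum_(1 <= j < n.+1) \sum_(1 <= i < (N j z.1).+1) (S j i z.2 - j%:R).
pose h (z : T1 * T2) : R := f (V z) * g (Wn N n z.1).
have mV : measurable_fun setT V.
  apply: measurable_funM => //; apply: measurable_sum_nat => j j1.
  apply: (measurable_random_index_sum (N := fun z : T1 * T2 => N j z.1)
    (Y := fun i (z : T1 * T2) => S j i z.2 - j%:R)).
    exact: (measurableT_comp (mN j j1) measurable_fst).
  move=> i i1; apply: measurable_funB => //.
  exact: (measurableT_comp (mS j i j1 i1) measurable_snd).
have mW : measurable_fun setT (fun z : T1 * T2 => Wn N n z.1).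
  apply: measurable_funM => //; apply: measurable_sum_nat => j j1.
  apply: (@measurableT_comp _ _ _ _ _ _ (fun k : nat => (j * k)%:R : R) _ (fun z : T1 * T2 => N j z.1)) => //.
  exact: (measurableT_comp (mN j j1) measurable_fst).
have bh : bmeas h by apply: bmeasM; [exact: (bmeas_comp mV)|exact: (bmeas_comp mW)].
transitivity (\int[P]_w h (w, w)).
  apply: eq_Rintegral => w _; rewrite /h /V /Vn /= /Ssum /Tsum -sumrB.
  congr (f (_ * _) * _); apply: eq_bigr => j _.
  by rewrite sumrB sumr_const_nat subn1/= natrM mulr_natr.
rewrite (@mean_decouple _ _ _ P _ D F J1 J2 _ _ T1 T2 id id h)//.
- apply: eq_Rintegral => w _.
  (* For frozen counts, the keys of the gammas present in the sum; the key [(j, i)] accounts for [j]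
     exponential steps. *)
  pose s : seq (nat + nat * nat) :=
    [seq inr (j, i) | j <- index_iota 1 n.+1, i <- index_iota 1 (N j w).+1].
  pose Z (k : nat + nat * nat) (v : T) : R := if k is inr (j, i) then S j i v - j%:R else 0.
  pose a (k : nat + nat * nat) : nat := if k is inr (j, i) then j else 0%N.
  have sP k : k \in s -> exists j i, [/\ k = inr (j, i), (1 <= j)%N & (1 <= i)%N].
    move=> /allpairsPdep[j [i [+ + ->]]]; rewrite !mem_index_iota.
    by move=> /andP[? _] /andP[? _]; exists j, i.
  have us : uniq s.
    apply: allpairs_uniq_dep => [|j _|[j1 i1] [j2 i2] _ _ /= [-> ->]//]; exact: iota_uniq.
  have := @mean_smooth_sum _ _ _ P _ D F Fm FT FI hind s us _ (centred_exponential R) c Z a f 0.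
  have -> : (\sum_(1 <= j < n.+1) j * N j w)%N = (\sum_(k <- s) a k)%N.
    rewrite big_allpairs_dep/=; apply: eq_bigr => j _.
    by rewrite sum_nat_const_nat subn1 mulnC.
  move=> <-//.
  - transitivity (\int[P]_v (g (Wn N n w) * f (V (w, v)))).
      by apply: eq_Rintegral => v _; rewrite mulrC.
    rewrite meanZ; last first.
      apply: (@bmeas_comp _ _ _ _ _ (fun v : T => V (w, v)) f _ bf).
      apply: measurable_funM => //; apply: measurable_sum => j /=.
      by apply: measurable_sum => i; exact: measurable_funB.
    rewrite mulrC; congr (_ * _); apply: eq_Rintegral => v _.
    by rewrite /V/= add0r big_allpairs_dep.
  - by move=> k /sP[j [i [-> j1 i1]]]; rewrite /D/= j1 i1.
  - move=> k /sP[j [i [-> j1 i1]]] A mA.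
    rewrite (_ : _ @^-1` A = S j i @^-1` ((fun x : R => x - j%:R) @^-1` A))//.
    apply: sigma_of_preimage; rewrite -[X in measurable X]setTI.
    by apply: (@measurable_funB _ _ R setT id (fun=> j%:R)).
  - by move=> k /sP[j [i [-> j1 i1]]] g' y bg'; apply: gamma_smooth => //; exact: hS.
- by move=> _ [j j1 <-].
- by move=> _ [[j i] ji <-].
- by apply/disj_setPS => _ [[j _ <-]] [].
Qed.

(** Replacement turns the conditional mean into [G (W_n)] up to [B W_n / sqrt n], and [G g] is a
    bounded continuous function of [W_n]. The error is capped at 2 and, for large [n], dominated by
    [h l (W_n)] with a fixed small [l]; the mean of the latter converges as well. *)
Lemma cvg_mean_pair k (g : R -> R) Mg : continuous g -> (forall x, `|g x| <= Mg) ->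
  \int[P]_w (logistic (Vn N S n w) ^+ k * g (Wn N n w)) @[n --> \oo] -->
  \int[P]_w (gauss (W w) (fun v => logistic v ^+ k) 0 * g (W w)).
Proof.
move=> cg gM; pose f (v : R) := logistic v ^+ k.
have [C [f2 [C0 tf]]] := logisticX_cubic_taylor R k.
have cf : continuous f.
  move=> x; apply: (@continuous_comp _ _ _ (@logistic R) (fun y : R => y ^+ k)).
    exact: continuous_logistic.
  exact: exprn_continuous.
have f1 x : `|f x| <= 1.
  have p0 := ltW (logistic_gt0 x); have p1 := ltW (logistic_lt1 x).
  by rewrite ger0_norm ?exprn_ge0// exprn_ile1.
have bf : bmeas f by apply: (bmeas_line (M := 1)).
have bg : bmeas g by apply: (bmeas_line (M := Mg)).
pose G (v : R) : R := gauss `|v| f 0.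
have cG : continuous G.
  apply: (@continuous_mean _ _ _ (std_normal R) (fun v z => f (0 + Num.sqrt `|v| * z)) 1) => //.
  - move=> v; apply: (@measurableT_comp _ _ _ _ _ _ f); first by case: bf.
    by apply: measurable_funD => //; exact: measurable_funM.
  - move=> z v; apply: (@continuous_comp _ _ _ (fun v : R => 0 + Num.sqrt `|v| * z) f); last exact: cf.
    by apply: cvgD; [exact: cvg_cst|apply: cvgM; [exact: continuous_sqrt_norm|exact: cvg_cst]].
have G1 v : `|G v| <= 1 by apply: smooth_norm_le.
have bG : bmeas G by apply: (bmeas_line (M := 1)).
have Mg0 : 0 <= Mg by exact: le_trans (gM 0).
have W0 : forall w, 0 <= W w by exact: dickman_ge0.
have mW : measurable_fun setT W by exact: measurable_dickman.
have [B [B0 hB]] : exists B, 0 <= B /\ forall n x c, 0 <= c ->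
    `|iter n (smooth (centred_exponential R) c) f x - gauss (n%:R * c ^+ 2) f x| <= n%:R * (B * c ^+ 3).
  eexists; split; last by move=> n x c c0; exact: (exponential_gauss _ _ c0 C0 cf f1 tf).
  by rewrite mulr_ge0// ?mulr_ge0// addr_ge0//; apply: Rintegral_ge0 => z _; rewrite exprn_ge0.
have lim : \int[P]_w (G (Wn N n w) * g (Wn N n w)) @[n --> \oo] -->
    \int[P]_w (G (W w) * g (W w)).
  apply: (@cvg_mean_Wn (fun v => G v * g v) Mg).
    by move=> x; apply: cvgM; [exact: cG|exact: cg].
  by move=> x; rewrite normrM -[leRHS]mul1r ler_pM.
have -> : \int[P]_w (gauss (W w) f 0 * g (W w)) = \int[P]_w (G (W w) * g (W w)).
  by apply: eq_Rintegral => w _; rewrite /G ger0_norm.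
pose I n w : R := iter (\sum_(1 <= j < n.+1) j * N j w)%N
    (smooth (centred_exponential R) (Num.sqrt n%:R)^-1) f 0.
have it1 n x c : `|iter n (smooth (centred_exponential R) c) f x| <= 1 /\
    bmeas (iter n (smooth (centred_exponential R) c) f).
  elim: n x => [//|n ih] x; split; last by apply: bmeas_smooth; case: (ih x).
  by apply: smooth_norm_le => [|y]; [case: (ih x)|case: (ih y)].
have I1 n w : `|I n w| <= 1 by case: (it1 (\sum_(1 <= j < n.+1) j * N j w)%N 0 (Num.sqrt n%:R)^-1).
have KE n w : (\sum_(1 <= j < n.+1) j * N j w)%N%:R = Tsum N n w :> R.
  by rewrite /Tsum natr_sum.
have bI n : bmeas (I n).
  split; last by exists 1 => w; exact: I1.
  apply: (@measurableT_comp _ _ _ _ _ _ (fun m : nat => iter m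
    (smooth (centred_exponential R) (Num.sqrt n%:R)^-1) f 0 : R) _
    (fun w => \sum_(1 <= j < n.+1) j * N j w)%N) => //.
  apply: (@measurable_natmul_inv R); under eq_fun do rewrite KE.
  exact: measurable_Tsum.
pose h (l v : R) : R := Num.min 2 (l * `|v|).
have h0 l v : 0 <= l -> 0 <= h l v by move=> l0; rewrite le_min ler0n/= mulr_ge0.
have h2 l v : 0 <= l -> `|h l v| <= 2.
  by move=> l0; rewrite ger0_norm ?h0// ge_min lexx.
have ch l : continuous (h l).
  move=> x; apply: (@continuous_min _ _ (fun=> 2) (fun v : R => l * `|v|)); first exact: cst_continuous.
  by apply: cvgM; [exact: cvg_cst|exact: norm_continuous].
have IG n w : (0 < n)%N -> `|I n w - G (Wn N n w)| <= h (B * (Num.sqrt n%:R)^-1) (Wn N n w).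
  move=> n0; have n0' : 0 < n%:R :> R by rewrite ltr0n.
  rewrite /h le_min; apply/andP; split.
    by rewrite (le_trans (ler_normB _ _))// -[2]/(1 + 1)%:R natrD lerD.
  set c := (Num.sqrt n%:R)^-1; have c2 : c ^+ 2 = n%:R^-1 by rewrite exprVn sqr_sqrtr.
  have := hB (\sum_(1 <= j < n.+1) j * N j w)%N 0 c.
  rewrite invr_ge0 sqrtr_ge0 => /(_ isT); rewrite c2 KE -/(Wn N n w).
  rewrite /G (ger0_norm (Wn_ge0 n w)) => /le_trans; apply.
  by rewrite exprS c2 /Wn le_eqVlt; apply/orP; left; apply/eqP; ring.
apply/cvgrPdist_le => e e0.
have Mg1 : 0 < Mg + 1 by rewrite ltr_wpDl.
pose e' := e / 4 / (Mg + 1); have e'0 : 0 < e' by rewrite !divr_gt0.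
have Me' : Mg * e' <= e / 4.
  by rewrite /e' mulrCA ler_piMr ?divr_ge0 ?(ltW e0)// ler_pdivrMr// mul1r lerDl.
(* As [l] tends to 0, [h l (W)] tends to 0 while staying below 2, so its mean becomes small without
   any moment of [W]. *)
have [l l0 hl] : exists2 l, 0 < l & \int[P]_w h l (W w) <= e'.
  have c : \int[P]_w h m.+1%:R^-1 (W w) @[m --> \oo] --> \int[P]_w (0 : R).
    apply: (@mean_cvg _ _ _ _ _ _ 2) => //.
    - move=> m; apply: (@measurableT_comp _ _ _ _ _ _ (h m.+1%:R^-1)) => //.
      exact: continuous_measurable_fun.
    - by move=> m w; apply: h2; rewrite invr_ge0.
    - apply: aeW => w.
      have cw : m.+1%:R^-1 * `|W w| @[m --> \oo] --> (0 : R).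
        rewrite -[X in _ --> X](mul0r `|W w|); apply: cvgM; [exact: cvg_harmonic|exact: cvg_cst].
      apply: (@squeeze_cvgr _ _ _ _ (fun=> 0) (fun m => m.+1%:R^-1 * `|W w|)) => //.
        apply: nearW => m; rewrite h0 ?invr_ge0//=.
        by rewrite /h ge_min lexx orbT.
      exact: cvg_cst.
  move: c; rewrite mean_cst => /cvgrPdist_le/(_ _ e'0)[m _ /(_ m (leqnn m))].
  rewrite sub0r normrN => hm; exists m.+1%:R^-1 => //.
  exact: le_trans (ler_norm _) hm.
have bh : bmeas (h l) by apply: (bmeas_line (M := 2)) => // v; exact: h2 (ltW l0).
have lim2 : \int[P]_w h l (Wn N n w) @[n --> \oo] --> \int[P]_w h l (W w).
  by apply: (@cvg_mean_Wn (h l) 2) => // v; exact: h2 (ltW l0).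
have e4 : 0 < e / 4 by rewrite divr_gt0.
move/cvgrPdist_le : lim => /(_ _ e4) lim.
move/cvgrPdist_le : lim2 => /(_ _ e'0) lim2.
near=> n.
have n0 : (0 < n)%N by near: n; exact: nbhs_infty_gt.
have Bl : B * (Num.sqrt n%:R)^-1 <= l.
  rewrite ler_pdivrMr ?sqrtr_gt0 ?ltr0n// mulrC -ler_pdivrMr//.
  rewrite -[leLHS]ger0_norm ?divr_ge0 ?(ltW l0)// -sqrtr_sqr ler_sqrt ?ler0n//.
  by near: n; exact: nbhs_infty_ger.
have bWn q : bmeas q -> bmeas (fun w => q (Wn N n w)) by apply: bmeas_comp; exact: measurable_funPT.
rewrite (Vn_decouple n cf cg f1 gM) -/(I n).
rewrite -(subrKA (\int[P]_w (G (Wn N n w) * g (Wn N n w)))) (le_trans (ler_normD _ _))//.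
apply: (@le_trans _ _ (e / 4 + (e / 4 + e / 4))); last lra.
apply: lerD; first by near: n; exact: lim.
have bGg : bmeas (fun w => G (Wn N n w) * g (Wn N n w)) by apply: bmeasM; exact: bWn.
have bIg : bmeas (fun w => I n w * g (Wn N n w)) by apply: bmeasM; [exact: bI|exact: bWn].
have bMh : bmeas (fun w => Mg * h l (Wn N n w)) by apply: bmeasM; [exact: bmeas_cst|exact: bWn].
rewrite distrC -meanB//.
apply: (@le_trans _ _ (\int[P]_w (Mg * h l (Wn N n w)))).
  rewrite (le_trans (mean_norm _ (bmeasB bIg bGg)))//.
  apply: le_mean => //; first exact: bmeas_norm (bmeasB bIg bGg).
  move=> w; rewrite -mulrBl normrM mulrC ler_pM// (le_trans (IG n w n0))//.
  by rewrite /h le_min !ge_min lexx/= ler_wpM2r// orbT.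
rewrite meanZ; last exact: bWn.
rewrite (@le_trans _ _ (Mg * (e' + e')))//; last by rewrite mulrDr lerD.
rewrite ler_wpM2l// -[leLHS](subrK (\int[P]_w h l (W w))) lerD//.
rewrite (le_trans (ler_norm _))// distrC; near: n.
exact: lim2.
Unshelve. all: by end_near. Qed.

End PoissonGamma.

(** * The limit as a normal mixture *)

Section NormalMixture.
Context (R : realType) d (T : measurableType d) (P : probability T R) (W : {mfun T >-> R}).

Definition mixture_V (z : T * R) : R := Num.sqrt (W z.1) * z.2.
Definition mixture_W (z : T * R) : R := W z.1.

Let measurable_mixture_W : measurable_fun setT mixture_W.
Proof. exact: (measurableT_comp (@measurable_funPT _ _ _ _ W) measurable_fst). Qed.

Let measurable_mixture_V : measurable_fun setT mixture_V.
Proof.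
apply: measurable_funM; last exact: measurable_snd.
apply: (@measurableT_comp _ _ _ _ _ _ (@Num.sqrt R)); last exact: measurable_mixture_W.
by apply: continuous_measurable_fun; exact: sqrt_continuous.
Qed.

HB.instance Definition _ := isMeasurableFun.Build _ _ _ _ mixture_V measurable_mixture_V.
HB.instance Definition _ := isMeasurableFun.Build _ _ _ _ mixture_W measurable_mixture_W.

Definition mixture_law : probability (R * R)%type R :=
  distribution (P \x std_normal R)%E (pairRV mixture_V mixture_W).

Lemma mean_mixture (f : R * R -> R) : bmeas f ->
  \int[(P \x std_normal R)%E]_z f (mixture_V z, mixture_W z) =
  \int[P]_w gauss (W w) (fun v => f (v, W w)) 0.
Proof.
move=> bf; rewrite mean_prod1; last first.
  apply: (@bmeas_comp _ _ _ _ _ (fun z => (mixture_V z, mixture_W z)) _ _ bf).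
  by apply: measurable_fun_pair; [exact: measurable_mixture_V|exact: measurable_mixture_W].
apply: eq_Rintegral => w _; rewrite /gauss /smooth.
by apply: eq_Rintegral => x _; rewrite add0r.
Qed.

End NormalMixture.

Lemma expectationE (R : realType) d (T : measurableType d) (P : probability T R) (X : T -> R) :
  bmeas X -> ('E_P[X] = (\int[P]_w X w)%R%:E)%E.
Proof. by move=> bX; rewrite unlock meanE. Qed.

Section LimitLaw.
Context (R : realType) d (T : measurableType d) (P : probability T R).
Variables (N : nat -> {RV P >-> nat}) (S : nat -> nat -> {RV P >-> R}).
Hypothesis hN : forall j : nat, (1 <= j)%N -> has_law P (N j) (poisson_prob (j%:R^-1) 0).
Hypothesis hS : forall j i : nat, (1 <= j)%N -> (1 <= i)%N ->
  is_gamma1 j (distribution P (S j i)).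
Hypothesis hind : mutually_independent P poisson_gamma_index (poisson_gamma_events N S).

Let mE n : measurable_fun setT (exponential_copy S n) := @measurable_funPT _ _ _ _ (S 1 n.+1).

Definition dickman_rv theta (theta0 : 0 < theta) : {mfun T >-> R} :=
  HB.pack (dickman (exponential_copy S) theta) (isMeasurableFun.Build _ _ _ _
    (dickman (exponential_copy S) theta) (measurable_dickman theta0 mE)).

Local Notation Q := (P \x std_normal R)%E.
Local Notation W1 := (dickman_rv ltr01).

Lemma pair_cvg_in_distribution :
  cvg_in_distribution P Q (fun n => pairRV (Vn N S n) (Wn N n))
    (pairRV (mixture_V W1) (mixture_W W1)).
Proof.
move=> f cf [M fM]; have bf : bmeas f by exact: bmeas_plane cf fM.
have bP (X : {RV P >-> (R * R)%type}) : bmeas (f \o X) by apply: bmeas_comp.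
rewrite expectationE; last by apply: bmeas_comp.
rewrite (_ : (fun n => _) = (fun n => (\int[P]_w f (Vn N S n w, Wn N n w))%R%:E)); last first.
  by apply/funext => n; rewrite expectationE.
apply: cvg_EFin; first exact: nearW.
apply: (@logistic_weak_cvg _ _ _ P _ _ Q (fun n => pairRV (Vn N S n) (Wn N n))
  (pairRV (mixture_V W1) (mixture_W W1)) _ _ _ f M) => //.
move=> m g K cg gK; rewrite /cvg_mean /=.
have bl : bmeas (@logistic R).
  apply: (bmeas_line (M := 1)); first exact: continuous_logistic.
  by move=> x; rewrite ger0_norm ltW ?logistic_gt0 ?logistic_lt1.
have bg : bmeas (fun p : R * R => logistic p.1 ^+ m * g p.2).
  apply: bmeasM; first exact: (bmeas_comp measurable_fst (bmeasX m bl)).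
  exact: (bmeas_comp measurable_snd (bmeas_line cg gK)).
rewrite (mean_mixture P W1 bg).
have := @cvg_mean_pair _ _ _ _ N S hN hS hind m g K cg gK.
suff -> : \int[P]_w gauss (W1 w) (fun v => logistic v ^+ m * g (W1 w)) 0 =
    \int[P]_w (gauss (W1 w) (fun v => logistic v ^+ m) 0 * g (W1 w)) by [].
apply: eq_Rintegral => w _; rewrite mulrC /gauss -smoothZ; last exact: bmeasX.
by rewrite /smooth; apply: eq_Rintegral => x _; rewrite mulrC.
Qed.

End LimitLaw.

(** * Independent copies and convolution powers *)

Section IidCopies.
Context (R : realType) d (U : measurableType d) (nu : probability U R).

(** Subfamilies are reached by putting the whole space at the missing indices; a single nontrivial
    factor gives the law of each variable. *)
Lemma mutually_independent_full d' (T : measurableType d') (P : probability T R) m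
    (X : 'I_m -> {RV P >-> U}) :
  (forall B : 'I_m -> set U, (forall i, measurable (B i)) ->
    P (\bigcap_i (X i @^-1` B i)) = (\prod_(i < m) nu (B i))%E) -> iid P X nu.
Proof.
move=> h.
have lawX i : has_law P (X i) nu.
  move=> A mA; have := h (fun j => if j == i then A else setT) _.
  rewrite (bigD1 i)//= eqxx big1 ?mule1 => [|j /negbTE ->]; last by rewrite probability_setT.
  move=> <- => [|j]; last by case: ifP.
  congr (P _); apply/seteqP; split => [w Aw j _|w /(_ i Logic.I)]; last by rewrite eqxx.
  by rewrite /preimage/=; case: eqP => // ->.
split => // J A _ AX.
have /choice[B hB] : forall i : 'I_m, exists B : set U, measurable B /\
    (if i \in J then A i = X i @^-1` B else B = setT).
  move=> i; have [iJ|iJ] := boolP (i \in J); last by exists setT.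
  by have [B mB <-] := AX i iJ; exists B; rewrite setTI.
have -> : \bigcap_(i in [set` J]) A i = \bigcap_i (X i @^-1` B i).
  apply/seteqP; split => w Aw i /=.
    move=> _; change ((X i @^-1` B i) w); have [_] := hB i.
    by have [iJ <-|_ ->//] := boolP (i \in J); exact: Aw.
  by move=> iJ; have [_] := hB i; rewrite iJ => ->; exact: Aw.
rewrite h; last by move=> i; case: (hB i).
have AB i : i \in J -> P (A i) = nu (B i).
  by move=> iJ; have [mB] := hB i; rewrite iJ => ->; exact: lawX.
rewrite (bigID (fun i => i \in J))/= [X in (_ * X)%E]big1 ?mule1 => [|i iJ].
  by rewrite big_uniq ?fset_uniq//=; apply: eq_bigr => i iJ; rewrite AB.
by have [_] := hB i; rewrite (negbTE iJ) => ->; exact: probability_setT.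
Qed.

End IidCopies.

Section ConvolutionPowers.
Context (R : realType).
Implicit Types (nu : probability (R * R)%type R) (f : R * R -> R) (p : R * R).

Definition convolve nu f p : R := \int[nu]_q f (p + q).

Lemma measurable_plane_add d (T : measurableType d) (X Y : T -> R * R) :
  measurable_fun setT X -> measurable_fun setT Y -> measurable_fun setT (fun w => X w + Y w).
Proof.
move=> mX mY; apply: (@measurable_fun_pair _ _ _ _ _ _ (fun w => (X w).1 + (Y w).1)
    (fun w => (X w).2 + (Y w).2)); apply: measurable_funD.
- exact: (measurableT_comp measurable_fst mX).
- exact: (measurableT_comp measurable_fst mY).
- exact: (measurableT_comp measurable_snd mX).
- exact: (measurableT_comp measurable_snd mY).
Qed.

Lemma measurable_plane_sum d (T : measurableType d) m (X : 'I_m -> T -> R * R) :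
  (forall i, measurable_fun setT (X i)) -> measurable_fun setT (fun w => \sum_(i < m) X i w).
Proof.
move=> mX; elim: (index_enum _) => [|i s ih].
  by under eq_fun do rewrite big_nil; exact: measurable_cst.
by under eq_fun do rewrite big_cons; exact: measurable_plane_add.
Qed.

(** The space grows by one factor at a time. The induction carries the product formula over all
    indices, which product measures give directly; [iid] is deduced at the end. *)
Lemma iid_copies_exist nu m : exists d (T : measurableType d) (P : probability T R)
  (X : 'I_m -> {RV P >-> (R * R)%type}), iid P X nu /\ forall f p, bmeas f ->
    \int[P]_w f (p + \sum_(i < m) X i w) = iter m (convolve nu) f p.
Proof.
suff : exists d (T : measurableType d) (P : probability T R) (X : 'I_m -> {RV P >-> (R * R)%type}),
    (forall B : 'I_m -> set (R * R), (forall i, measurable (B i)) ->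
      P (\bigcap_i (X i @^-1` B i)) = (\prod_(i < m) nu (B i))%E) /\ forall f p, bmeas f ->
    \int[P]_w f (p + \sum_(i < m) X i w) = iter m (convolve nu) f p.
  move=> [d [T [P [X [XB Xf]]]]]; exists d, T, P, X; split => //.
  exact: mutually_independent_full.
elim: m => [|m [d [T [P [X [XB Xf]]]]]].
  pose X0 : {mfun (R * R)%type >-> (R * R)%type} := HB.pack (@id (R * R)%type)
    (isMeasurableFun.Build _ _ _ _ (@id (R * R)%type) (@measurable_id _ _ setT)).
  exists _, (R * R)%type, nu, (fun=> X0); split => [B mB|f p bf].
    rewrite big_ord0 (_ : \bigcap_i _ = setT) ?probability_setT//.
    by apply/seteqP; split => // w _ [].
  by under eq_Rintegral do rewrite big_ord0 addr0; exact: mean_cst.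
pose X0 : {mfun ((R * R) * T)%type >-> (R * R)%type} := HB.pack (@fst (R * R)%type T)
  (isMeasurableFun.Build _ _ _ _ (@fst (R * R)%type T) measurable_fst).
have mS i : measurable_fun setT (X i \o @snd (R * R)%type T).
  by apply: measurableT_comp => //; exact: measurable_snd.
pose XS i : {mfun ((R * R) * T)%type >-> (R * R)%type} := HB.pack (X i \o @snd (R * R)%type T)
  (isMeasurableFun.Build _ _ _ _ _ (mS i)).
exists _, ((R * R) * T)%type, (nu \x P)%E, (fun i => if unlift ord0 i is Some j then XS j else X0).
split=> [B mB|f p bf].
  rewrite (_ : \bigcap_i _ = B ord0 `*` \bigcap_i (X i @^-1` B (lift ord0 i))).
    rewrite big_ord_recl -XB//; apply: product_measure1E => //.
    apply: fin_bigcap_measurable => [|i _]; first exact: finite_finset.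
    by rewrite -[X in measurable X]setTI; exact: measurable_funPT.
  apply/seteqP; split => [[u w] /= Bw|[u w] [/= Bu Bw] i _].
    split; first by have := Bw ord0 Logic.I; rewrite unlift_none.
    by move=> i _; have := Bw (lift ord0 i) Logic.I; rewrite liftK.
  case: unliftP => [j ->|->] //; exact: (Bw j).
pose h (z : (R * R) * T) : R := f (p + z.1 + \sum_(i < m) X i z.2).
have bh : bmeas h.
  apply: (@bmeas_comp _ _ _ _ _ (fun z : (R * R) * T => p + z.1 + \sum_(i < m) X i z.2) _ _ bf).
  apply: measurable_plane_add; first by apply: measurable_plane_add => //; exact: measurable_fst.
  by apply: measurable_plane_sum => i; exact: mS.
transitivity (\int[(nu \x P)%E]_z h z).
  apply: eq_Rintegral => z _; rewrite /h big_ord_recl unlift_none addrA.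
  by congr (f (_ + _)); apply: eq_bigr => i _; rewrite liftK.
rewrite mean_prod1//; apply: eq_Rintegral => q _; exact: Xf.
Qed.

End ConvolutionPowers.

(** * Laws on the plane are determined by continuous functions *)

Section MeasureDetermination.
Context (R : realType).

Let quadrant (a b : R) : set (R * R) := `]a, +oo[%classic `*` `]b, +oo[%classic.

Let quadrants : set (set (R * R)) := [set A | exists a b, A = quadrant a b].

Let measurable_quadrant a b : measurable (quadrant a b).
Proof. exact: measurableX. Qed.

Let neg_truncnS_lt (x M : R) : `|x| <= M -> - (Num.truncn M).+1%:R < x.
Proof.
move=> xM; rewrite ltrNl (le_lt_trans (ler_norm _))// normrN (le_lt_trans xM)//.
exact: truncnS_gt.
Qed.

(** A half-plane is a countable union of quadrants, so both projections are measurable for the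
    generated sigma-algebra, which therefore contains all measurable rectangles. *)
Let quadrants_generate (A : set (R * R)) : measurable A -> <<s quadrants >> A.
Proof.
pose T := g_sigma_algebraType quadrants.
have cover : \bigcup_n `]- n%:R, +oo[%classic = [set: R].
  apply/seteqP; split => // x _; exists (Num.truncn `|x|).+1 => //=.
  by rewrite in_itv/= andbT neg_truncnS_lt.
have mfst : measurable_fun (setT : set T) (@fst R R).
  apply: (@measurability _ _ T R setT (@fst R R) (@RGenOInfty.G R)); first exact: RGenOInfty.measurableE.
  move=> _ [_ [a ->] <-]; rewrite setTI.
  rewrite (_ : _ @^-1` _ = \bigcup_n quadrant a (- n%:R)); last first.
    apply/seteqP; split => [[x y] /= xa|[x y] [n _ []//]].
    have [n _ yn] : (\bigcup_n `]- n%:R, +oo[%classic) y by rewrite cover.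
    by exists n.
  apply: bigcup_measurable => n _; apply: sub_sigma_algebra.
  by exists a, (- n%:R).
have msnd : measurable_fun (setT : set T) (@snd R R).
  apply: (@measurability _ _ T R setT (@snd R R) (@RGenOInfty.G R)); first exact: RGenOInfty.measurableE.
  move=> _ [_ [a ->] <-]; rewrite setTI.
  rewrite (_ : _ @^-1` _ = \bigcup_n quadrant (- n%:R) a); last first.
    apply/seteqP; split => [[x y] /= xa|[x y] [n _ []//]].
    have [n _ yn] : (\bigcup_n `]- n%:R, +oo[%classic) x by rewrite cover.
    by exists n.
  apply: bigcup_measurable => n _; apply: sub_sigma_algebra.
  by exists (- n%:R), a.
rewrite measurable_prod_measurableType; apply: smallest_sub; first exact: smallest_sigma_algebra.
move=> _ [B mB [C mC <-]].
have -> : B `*` C = (@fst R R @^-1` B) `&` (@snd R R @^-1` C) by [].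
apply: (@measurableI _ T).
  by rewrite -[X in measurable X]setTI; exact: mfst.
by rewrite -[X in measurable X]setTI; exact: msnd.
Qed.

Let ray (a : R) (n : nat) (x : R) : R := Num.min 1 (n%:R * Num.max 0 (x - a)).

Let ray01 a n x : 0 <= ray a n x <= 1.
Proof. by rewrite /ray le_min ler01 ge_min lexx/= andbT mulr_ge0// le_max lexx. Qed.

Let continuous_ray a n : continuous (ray a n).
Proof.
move=> x; apply: (@continuous_min _ _ (fun=> 1) (fun x : R => n%:R * Num.max 0 (x - a))).
  exact: cst_continuous.
apply: cvgM; first exact: cvg_cst.
apply: (@continuous_max _ _ (fun=> 0) (fun x : R => x - a)); first exact: cst_continuous.
by apply: cvgB; [exact: cvg_id|exact: cvg_cst].
Qed.

Let cvg_ray a x : ray a n x @[n --> \oo] --> (\1_(`]a, +oo[%classic : set R) x : R).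
Proof.
rewrite indicE; have [xa|xa] := ltP a x; last first.
  rewrite memNset/= ?in_itv/= ?andbT; last by apply/negP; rewrite -leNgt.
  apply: cvg_near_cst; apply: nearW => n; rewrite /ray max_l ?subr_le0// mulr0.
  by rewrite min_r.
rewrite mem_set/= ?in_itv/= ?andbT//; apply: cvg_near_cst; near=> n.
rewrite /ray max_r ?subr_ge0 ?ltW// min_l// -ler_pdivrMr ?subr_gt0// mul1r.
by near: n; exact: nbhs_infty_ger.
Unshelve. all: by end_near. Qed.

(** The indicator of an open quadrant is a bounded limit of products of continuous ramps, and open
    quadrants form a generating pi-system. *)
Lemma eq_measure_continuous (m1 m2 : probability (R * R)%type R) :
  (forall (f : R * R -> R) M, continuous f -> (forall p, `|f p| <= M) ->
    \int[m1]_p f p = \int[m2]_p f p) ->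
  forall A, measurable A -> m1 A = m2 A.
Proof.
move=> m12 A mA.
pose F a b n (p : R * R) : R := ray a n p.1 * ray b n p.2.
have F1 a b n p : `|F a b n p| <= 1.
  have /andP[r0 r1] := ray01 a n p.1; have /andP[s0 s1] := ray01 b n p.2.
  by rewrite ger0_norm ?mulr_ge0// mulr_ile1.
have cF a b n : continuous (F a b n).
  move=> p; apply: cvgM.
    by apply: (@continuous_comp _ _ _ fst (ray a n)); [exact: cvg_fst|exact: continuous_ray].
  by apply: (@continuous_comp _ _ _ snd (ray b n)); [exact: cvg_snd|exact: continuous_ray].
have lim (m : probability (R * R)%type R) a b :
    \int[m]_p F a b n p @[n --> \oo] --> fine (m (quadrant a b)).
  have -> : fine (m (quadrant a b)) = \int[m]_p \1_(quadrant a b) p.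
    by rewrite /Rintegral integral_indic// setIT.
  apply: (@mean_cvg _ _ _ _ _ _ 1) => //.
  - by move=> n; case: (bmeas_plane (cF a b n) (F1 a b n)).
  - apply: aeW => -[x y]; rewrite /F/= (_ : \1_(quadrant a b) (x, y) =
      \1_(`]a, +oo[%classic : set R) x * \1_(`]b, +oo[%classic : set R) y :> R).
      by apply: cvgM; exact: cvg_ray.
    by rewrite !indicE in_setX; case: (_ \in _); case: (_ \in _); rewrite ?mulr1 ?mulr0 ?mul0r.
apply: (@g_sigma_algebra_measure_unique _ _ _ quadrants _ (fun n => quadrant (- n%:R) (- n%:R)) _ _ m1 m2).
- by move=> _ [a [b ->]].
- by move=> n; exists (- n%:R), (- n%:R).
- apply/seteqP; split => // -[x y] _.
  exists (Num.truncn (Num.max `|x| `|y|)).+1 => //=.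
  by rewrite /quadrant/= !in_itv/= !andbT; split; apply: neg_truncnS_lt; rewrite le_max lexx ?orbT.
- move=> _ _ [a [b ->]] [a' [b' ->]]; exists (Num.max a a'), (Num.max b b').
  apply/seteqP; split => [[x y]|[x y]]; rewrite /quadrant/= !in_itv/= !andbT !gt_max.
    by move=> [[-> ->] [-> ->]].
  by move=> [/andP[-> ->] /andP[-> ->]].
- move=> _ [a [b ->]]; rewrite -[LHS]fineK ?fin_num_measure// -[RHS]fineK ?fin_num_measure//.
  congr EFin; have l1 := lim m1 a b; have := lim m2 a b.
  have <- : (fun n => \int[m1]_p F a b n p) = (fun n => \int[m2]_p F a b n p).
    by apply/funext => n; exact: (m12 _ 1).
  by move=> l2; exact: (cvg_unique _ l1 l2).
- by move=> n; rewrite ltey_eq fin_num_measure.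
- exact: quadrants_generate.
Qed.

End MeasureDetermination.

(** * Convolution of mixtures, and the exponent as a complex integral *)

Section MixtureConvolution.
Context (R : realType) d (T : measurableType d) (P : probability T R).
Implicit Types (W : {mfun T >-> R}) (f : R * R -> R) (p : R * R).

Lemma convolve_mixture W f p : bmeas f ->
  convolve (mixture_law P W) f p =
  \int[P]_w gauss (W w) (fun v => f (v, p.2 + W w)) p.1.
Proof.
move=> bf.
have bp : bmeas (fun q => f (p + q)).
  by apply: (@bmeas_comp _ _ _ _ _ (fun q => p + q) _ _ bf); exact: measurable_plane_add.
rewrite /convolve /mixture_law (@mean_distribution _ _ _ _ _ _ _ _ bp).
rewrite (mean_mixture P W bp); apply: eq_Rintegral => w _.
by rewrite /gauss /smooth; apply: eq_Rintegral => x _; rewrite add0r; case: p bp.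
Qed.

(* Given the mixing variables, the two Gaussian parts add up by the heat
   semigroup; what is left only involves the sum of the mixing variables. *)
Lemma convolve_mixtureD (Wa Wb Wc : {mfun T >-> R}) f M p :
  (forall w, 0 <= Wa w) -> (forall w, 0 <= Wb w) -> (forall w, 0 <= Wc w) ->
  (forall (h : R -> R) K, continuous h -> (forall x, `|h x| <= K) ->
    \int[P]_w \int[P]_u h (Wa w + Wb u) = \int[P]_w h (Wc w)) ->
  continuous f -> (forall q, `|f q| <= M) ->
  convolve (mixture_law P Wa) (convolve (mixture_law P Wb) f) p =
  convolve (mixture_law P Wc) f p.
Proof.
move=> a0 b0 c0 Wabc cf fM; have bf := bmeas_plane cf fM.
have mW (W : {mfun T >-> R}) : measurable_fun setT W by exact: measurable_funPT.
have mS (W : {mfun T >-> R}) : measurable_fun setT (fun w => Num.sqrt (W w)).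
  apply: (@measurableT_comp _ _ _ _ _ _ (@Num.sqrt R)) => //.
  by apply: continuous_measurable_fun; exact: sqrt_continuous.
have bc : bmeas (convolve (mixture_law P Wb) f).
  apply: (@bmeas_mean1 _ _ _ _ _ (mixture_law P Wb) (mixture_law P Wb)
    (fun z : (R * R) * (R * R) => f (z.1 + z.2))).
  apply: (@bmeas_comp _ _ _ _ _ (fun z : (R * R) * (R * R) => z.1 + z.2) _ _ bf).
  by apply: measurable_plane_add; [exact: measurable_fst|exact: measurable_snd].
have cline (y : R) : continuous (fun v : R => f (v, y)).
  move=> v; apply: (@continuous_comp _ _ _ (fun v : R => (v, y)) f); last exact: cf.
  by apply: (cvg_pair (G := nbhs v) (H := nbhs y)); [exact: cvg_id|exact: cvg_cst].
pose h (s : R) : R := gauss `|s| (fun v => f (v, p.2 + s)) p.1.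
have hM s : `|h s| <= M.
  by apply: smooth_norm_le => //; apply: bmeas_line (cline _) _.
have ch : continuous h.
  apply: (@continuous_mean _ _ _ (std_normal R) (fun s z => f (p.1 + Num.sqrt `|s| * z, p.2 + s)) M) => //.
  - move=> s; apply: (@measurableT_comp _ _ _ _ _ _ (fun v : R => f (v, p.2 + s))).
      by case: (bmeas_line (cline (p.2 + s)) (fun v => fM _)).
    by apply: measurable_funD => //; exact: measurable_funM.
  - move=> z s; apply: (@continuous_comp _ _ _ (fun s : R => (p.1 + Num.sqrt `|s| * z, p.2 + s)) f); last exact: cf.
    apply: (cvg_pair (G := nbhs (p.1 + Num.sqrt `|s| * z)) (H := nbhs (p.2 + s))).
      by apply: cvgD; [exact: cvg_cst|apply: cvgM; [exact: continuous_sqrt_norm|exact: cvg_cst]].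
    by apply: cvgD; [exact: cvg_cst|exact: cvg_id].
rewrite (convolve_mixture Wa p bc) (convolve_mixture Wc p bf).
transitivity (\int[P]_w h (Wc w)); last first.
  by apply: eq_Rintegral => w _; rewrite /h ger0_norm.
rewrite -(Wabc h M ch hM); apply: eq_Rintegral => w _; rewrite /gauss /smooth.
transitivity (\int[std_normal R]_z \int[P]_u
    gauss (Wb u) (fun v => f (v, p.2 + Wa w + Wb u)) (p.1 + Num.sqrt (Wa w) * z)).
  by apply: eq_Rintegral => z _; rewrite convolve_mixture.
rewrite (@mean_swap _ _ _ _ _ (std_normal R) P (fun q : R * T =>
  gauss (Wb q.2) (fun v => f (v, p.2 + Wa w + Wb q.2)) (p.1 + Num.sqrt (Wa w) * q.1))).
  apply: eq_Rintegral => u _.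
  rewrite -[LHS]/(gauss (Wa w) (gauss (Wb u) (fun v => f (v, p.2 + Wa w + Wb u))) p.1).
  rewrite (gauss_semigroup (M := M))//.
  by rewrite /h ger0_norm ?addr_ge0// addrA.
rewrite /gauss /smooth.
apply: (@bmeas_mean1 _ _ _ _ _ (std_normal R \x P)%E (std_normal R) (fun z : (R * T) * R =>
  f (p.1 + Num.sqrt (Wa w) * z.1.1 + Num.sqrt (Wb z.1.2) * z.2, p.2 + Wa w + Wb z.1.2))).
apply: (@bmeas_comp _ _ _ _ _ (fun z : (R * T) * R =>
  (p.1 + Num.sqrt (Wa w) * z.1.1 + Num.sqrt (Wb z.1.2) * z.2, p.2 + Wa w + Wb z.1.2)) _ _ bf).
have m12 : measurable_fun setT (fun z : (R * T) * R => z.1.2).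
  exact: (measurableT_comp measurable_snd measurable_fst).
apply: measurable_fun_pair; apply: measurable_funD => //.
- apply: measurable_funD => //; apply: measurable_funM => //.
  exact: (measurableT_comp measurable_fst measurable_fst).
- apply: measurable_funM; last exact: measurable_snd.
  exact: (measurableT_comp (mS Wb) m12).
- exact: (measurableT_comp (mW Wb) m12).
Qed.

End MixtureConvolution.

(** Away from 0 the integrand is [expo_re + i expo_im] with [s = a - iu]; the point 0 is dropped by
    passing to []0, 1]], so that the continuous extension can be integrated instead. *)
Lemma characteristic_exponent (R : realType) (a u : R) :
  Cintegral lebesgue_measure `[0, 1]
    (fun y => (expC (- (a%:C%C - 'i%C * u%:C%C) * y%:C%C) - 1) / y%:C%C) =
  (primitive (expo_re a u) 1 +i* primitive (expo_im a u) 1)%C.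
Proof.
have integrandE y : y != 0 -> (expC (- (a%:C%C - 'i%C * u%:C%C) * y%:C%C) - 1) / y%:C%C =
    (expo_re a u y +i* expo_im a u y)%C.
  move=> y0; apply: (canLR (mulfK _)); first by rewrite eq_complex/= negb_and y0.
  have r := expo_reE a u y; have i := expo_imE a u y.
  apply/eqP; rewrite eq_complex /expC /=; apply/andP; split; apply/eqP.
    rewrite [RHS](_ : _ = y * expo_re a u y); last by ring.
    rewrite r; congr (expR _ * cos _ - 1); ring.
  rewrite [RHS](_ : _ = y * expo_im a u y); last by ring.
  rewrite i subr0; congr (expR _ * sin _); ring.
have part (g : R -> R) (h : R -> R) : continuous g -> (forall y, y != 0 -> h y = g y) ->
    \int[lebesgue_measure]_(y in `[0, 1]) h y = primitive g 1.
  move=> cg hg; rewrite primitiveE//.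
  have ig : lebesgue_measure.-integrable `]0, 1] (EFin \o g).
    apply: (@integrableS _ _ _ lebesgue_measure `[0, 1]) => //.
      by apply: subset_itvr; rewrite bnd_simp.
    by apply: continuous_compact_integrable; [exact: segment_compact|exact: continuous_subspaceT].
  have gh y : y \in `]0, 1]%classic -> g y = h y.
    by rewrite inE/= in_itv/= => /andP[y0 _]; rewrite hg// gt_eqF.
  have ih : lebesgue_measure.-integrable `]0, 1] (EFin \o h).
    by apply: eq_integrable ig => // y y01; rewrite /= gh.
  by rewrite -Rintegral_itv_obnd_cbnd// -[RHS]Rintegral_itv_obnd_cbnd//; apply: eq_Rintegral => y /gh.
rewrite /Cintegral; congr (_ +i* _)%C.
  by apply: part; [exact: continuous_expo_re|move=> y y0; rewrite integrandE].
by apply: part; [exact: continuous_expo_im|move=> y y0; rewrite integrandE].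
Qed.

(** * Infinite divisibility and the transform of the limit *)

Section LimitProperties.
Context (R : realType) d (T : measurableType d) (P : probability T R).
Variables (N : nat -> {RV P >-> nat}) (S : nat -> nat -> {RV P >-> R}).
Hypothesis hS : forall j i : nat, (1 <= j)%N -> (1 <= i)%N ->
  is_gamma1 j (distribution P (S j i)).
Hypothesis hind : mutually_independent P poisson_gamma_index (poisson_gamma_events N S).

Local Notation D t0 := (dickman_rv S t0).

(** Laplace transforms multiply on [P \x P], and the exponent is linear in [theta]. Uniqueness is
    obtained by applying [laplace_weak_cvg] to a constant sequence. *)
Lemma dickman_add a b c (a0 : 0 < a) (b0 : 0 < b) (c0 : 0 < c) (h : R -> R) K :
  c = a + b -> continuous h -> (forall x, `|h x| <= K) ->
  \int[P]_w \int[P]_u h (D a0 w + D b0 u) = \int[P]_w h (D c0 w).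
Proof.
move=> cab ch hK; have bh := bmeas_line ch hK.
have D0 t (t0 : 0 < t) w : 0 <= D t0 w by exact: dickman_ge0.
pose X (z : T * T) : R := D a0 z.1 + D b0 z.2.
have mX : measurable_fun setT X.
  apply: measurable_funD.
    exact: (measurableT_comp (@measurable_funPT _ _ _ _ (D a0)) measurable_fst).
  exact: (measurableT_comp (@measurable_funPT _ _ _ _ (D b0)) measurable_snd).
have bD t (t0 : 0 < t) (m : nat) : bmeas (fun w => expR (- (m%:R * D t0 w))).
  by apply: bmeas_expN => [|w]; [exact: measurable_funM|rewrite mulr_ge0].
have bX (m : nat) : bmeas (fun z => expR (- (m%:R * X z))).
  by apply: bmeas_expN => [|z]; [exact: measurable_funM|rewrite mulr_ge0// addr_ge0].
have lap (m : nat) : \int[(P \x P)%E]_z expR (- (m%:R * X z)) =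
    \int[P]_w expR (- (m%:R * D c0 w)).
  rewrite mean_prod1//.
  rewrite (dickman_laplace hS hind c0 (ler0n R m)) cab mulrDl expRD.
  rewrite -(dickman_laplace hS hind a0 (ler0n R m)) -(dickman_laplace hS hind b0 (ler0n R m)).
  rewrite mulrC -meanZ; last exact: bD.
  apply: eq_Rintegral => w _; rewrite mulrC -meanZ; last exact: bD.
  by apply: eq_Rintegral => v _; rewrite -expRD /X mulrDr opprD.
have := @laplace_weak_cvg _ _ _ (P \x P)%E _ _ P (fun _ => X) (D c0) _ _ _ _ _ h K ch hK.
rewrite /cvg_mean => lim.
have {}lim : (fun _ : nat => \int[(P \x P)%E]_z h (X z)) @ \oo --> \int[P]_w h (D c0 w).
  apply: lim => //.
  - by move=> _ z; rewrite addr_ge0.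
  - by move=> m; under eq_fun do rewrite lap; exact: cvg_cst.
have e : \int[(P \x P)%E]_z h (X z) = \int[P]_w h (D c0 w).
  exact: (cvg_unique _ (@cvg_cst _ _ _ _ _) lim).
by rewrite -e mean_prod1//; exact: bmeas_comp.
Qed.

Lemma convolve_power k t s (t0 : 0 < t) (s0 : 0 < s) f M p : s = k.+1%:R * t ->
  continuous f -> (forall q, `|f q| <= M) ->
  iter k.+1 (convolve (mixture_law P (D t0))) f p = convolve (mixture_law P (D s0)) f p.
Proof.
move=> + cf fM; elim: k s s0 p => [|k ih] s s0 p sk.
  have st : s = t by rewrite sk mul1r.
  by move: s0; rewrite st => s0; rewrite (bool_irrelevance s0 t0).
have r0 : 0 < k.+1%:R * t by rewrite mulr_gt0.
rewrite iterS (_ : iter _ _ _ = convolve (mixture_law P (D r0)) f); last first.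
  by apply/funext => q; exact: ih.
apply: convolve_mixtureD cf fM; try by move=> w; exact: dickman_ge0.
by move=> h K ch hK; apply: dickman_add ch hK; rewrite sk; ring.
Qed.

(** The [m]-th root is the mixture with [theta = 1/m]; the laws are compared on bounded continuous
    functions, where [m] convolutions collapse into one. *)
Lemma mixture_infinitely_divisible : infinitely_divisible (mixture_law P (D ltr01)).
Proof.
move=> [//|k] _; set m := k.+1; have t0 : 0 < m%:R^-1 :> R by rewrite invr_gt0 ltr0n.
exists (mixture_law P (D t0)).
have [d' [T' [P' [X [iidX Xf]]]]] := iid_copies_exist (mixture_law P (D t0)) m.
exists d', T', P', X; split => //.
have mS := measurable_plane_sum (fun i => @measurable_funPT _ _ _ _ (X i)).
pose Z : {mfun T' >-> (R * R)%type} := HB.pack (fun w => \sum_(i < m) X i w)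
  (isMeasurableFun.Build _ _ _ _ (fun w => \sum_(i < m) X i w) mS).
apply: (@eq_measure_continuous _ (mixture_law P (D ltr01)) (distribution P' Z)) => f M cf fM.
have bf := bmeas_plane cf fM.
rewrite (@mean_distribution _ _ _ P' _ _ Z f bf).
transitivity (convolve (mixture_law P (D ltr01)) f 0).
  by apply: eq_Rintegral => q _; rewrite add0r.
transitivity (iter m (convolve (mixture_law P (D t0))) f 0); last first.
  by rewrite -Xf//; apply: eq_Rintegral => w _; rewrite add0r.
by rewrite (@convolve_power k _ _ t0 ltr01 f M 0)// mulfV.
Qed.

(** Given [W], [gauss_cos] with variance [t^2 W] and starting point [u W + c0] produces the factor
    [exp(-t^2 W/2)], whence [a = t^2/2] in [dickman_transform]. *)
Lemma mixture_transform t u c0 :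
  \int[(P \x std_normal R)%E]_z
    cos (t * mixture_V (D ltr01) z + u * mixture_W (D ltr01) z + c0) =
  expR (primitive (expo_re (2^-1 * t ^+ 2) u) 1) *
  cos (primitive (expo_im (2^-1 * t ^+ 2) u) 1 + c0).
Proof.
pose f (q : R * R) : R := cos (t * q.1 + u * q.2 + c0).
have bf : bmeas f.
  split; last by exists 1 => q; rewrite ler_norml cos_geN1 cos_le1.
  apply: (@measurableT_comp _ _ _ _ _ _ (@cos R)).
    by apply: continuous_measurable_fun; exact: continuous_cos.
  by apply: measurable_funD => //; apply: measurable_funD; apply: measurable_funM.
rewrite (mean_mixture P (D ltr01) bf).
have a0 : 0 <= 2^-1 * t ^+ 2 by rewrite mulr_ge0 ?sqr_ge0.
have := dickman_transform ltr01 (fun n => @measurable_funPT _ _ _ _ (S 1 n.+1))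
  (exponential_copy_law hS) (exponential_copy_indep hind 1) u c0 a0.
rewrite !mul1r => <-; apply: eq_Rintegral => w _.
set W := D ltr01 w; have W0 : 0 <= W by exact: dickman_ge0.
have t2W : 0 <= t ^+ 2 * W by rewrite mulr_ge0 ?sqr_ge0.
have gc x := gauss_cos x t2W.
rewrite (_ : dickman _ _ w = W)// (_ : 2^-1 * t ^+ 2 * W = t ^+ 2 * W / 2); last by ring.
have sq : Num.sqrt (t ^+ 2 * W) = `|t| * Num.sqrt W.
  by rewrite sqrtrM ?sqr_ge0// sqrtr_sqr.
(* The standard deviation is [|t| sqrt W]; for negative [t] the sign is absorbed by the evenness of
   cosine. *)
have [t0|t0] := leP 0 t.
  rewrite -gc /gauss /smooth sq ger0_norm//; apply: eq_Rintegral => x _.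
  by rewrite /f/=; congr cos; ring.
rewrite -cosN -gc /gauss /smooth sq ltr0_norm//; apply: eq_Rintegral => x _.
by rewrite /f/= -cosN; congr cos; ring.
Qed.

End LimitProperties.

(* The second argument of poisson_prob is a dummy: the measure does not depend
   on it. *)
(* At y = 0 the integrand below takes the junk value 0 (a null set). *)
Theorem lemma3p1 (R : realType) (d : measure_display) (T : measurableType d)
    (P : probability T R)
    (N : nat -> {RV P >-> nat}) (S : nat -> nat -> {RV P >-> R})
    (hN : forall j : nat, (1 <= j)%N ->
       has_law P (N j) (poisson_prob (j%:R^-1) 0))
    (hS : forall j i : nat, (1 <= j)%N -> (1 <= i)%N ->
       is_gamma1 j (distribution P (S j i)))
    (hind : mutually_independent P
       [set k : nat + nat * nat |
          match k with
          | inl j => (1 <= j)%N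
          | inr (j, i) => (1 <= j)%N && (1 <= i)%N
          end]
       (fun k => match k with
                 | inl j => sigma_of (N j)
                 | inr (j, i) => sigma_of (S j i)
                 end)) :
  exists (d' : measure_display) (T' : measurableType d')
         (Q : probability T' R) (V W : {RV Q >-> R}),
    [/\ cvg_in_distribution P Q (fun n => pairRV (Vn N S n) (Wn N n)) (pairRV V W),
        infinitely_divisible (distribution Q (pairRV V W)) &
        forall t u : R,
          charfun2 Q V W t u =
          expC (Cintegral lebesgue_measure `[0, 1]
            (fun y => (expC (- ((2^-1 * t ^+ 2)%:C%C - 'i%C * u%:C%C) * y%:C%C) - 1)
                      / y%:C%C))].
Proof.
pose W := dickman_rv S (ltr01 : 0 < (1 : R)).
exists _, (T * R)%type, (P \x std_normal R)%E, (mixture_V W), (mixture_W W).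
split; first exact: pair_cvg_in_distribution hN hS hind.
  exact: (mixture_infinitely_divisible hS hind).
move=> t u; rewrite characteristic_exponent /charfun2 /Cintegral /expC /=.
(* The imaginary part is the real part with phase [-pi/2], so [mixture_transform] serves for
   both. *)
have cs z : sin z = cos (z + - (pi / 2)) :> R.
  by rewrite cosB cos_pihalf sin_pihalf mulr0 mulr1 add0r.
congr (_ +i* _)%C.
  have := mixture_transform hS hind t u 0; rewrite !addr0 => <-.
  apply: eq_Rintegral => z _.
  by rewrite !mul0r !mulr0 !subr0 !addr0 expR0 !mul1r !add0r.
rewrite cs -(mixture_transform hS hind); apply: eq_Rintegral => z _.
by rewrite -cs !mul0r !mulr0 !subr0 !addr0 expR0 !mul1r !add0r.
Qed.
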